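(* Let $L\colon\mathsf{A}\rightleftarrows\mathsf{X}\colon R$ be an adjunction between topoi, $L$ left adjoint to $R$, with $L$ preserving pullbacks. Then ${}_L\mathbb{F}\mathbf{ine}\mathbb{R}\mathbf{ewrite}$ is a symmetric monoidal double category.
   Context: A topos is a category with finite limits that is cartesian closed and has a subobject classifier. A structured cospan is a cospan $La\to x\leftarrow Lb$ in $\mathsf{X}$ with $a,b$ objects of $\mathsf{A}$. A span of structured cospans is a commuting $3\times3$ diagram in $\mathsf{X}$ with rows the structured cospans $La\to x\leftarrow La'$, $Lb\to y\leftarrow Lb'$, $Lc\to z\leftarrow Lc'$ and with columns the spans $La\leftarrow Lb\to Lc$, $x\leftarrow y\to z$, $La'\leftarrow Lb'\to Lc'$. An isomorphism from it to another span of structured cospans that agrees with it except that its central object is $y'$ (with its own arrows to and from the unchanged objects) is an invertible arrow $\theta\colon y\to y'$ commuting with the arrows from $Lb$ and $Lb'$ and with the arrows to $x$ and $z$. A fine rewrite of structured cospans is an isomorphism class of spans of structured cospans whose outer vertical arrows are isomorphisms and whose central vertical arrows $y\to x$, $y\to z$ are monic. ${}_L\mathbb{F}\mathbf{ine}\mathbb{R}\mathbf{ewrite}$ is the (pseudo) double category whose objects are the objects of $\mathsf{A}$, vertical arrows are spans in $\mathsf{A}$ with invertible arrows, horizontal arrows $a\to b$ are structured cospans $La\to x\leftarrow Lb$ (composed by pushout), and squares are fine rewrites, composed horizontally by pushout in each row and vertically by pullback of the middle rows over the shared row. The symmetric monoidal structure is lifted from the coproducts of $\mathsf{A}$ and $\mathsf{X}$: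 on objects $a\otimes b=a+b$, with unit the initial object $0_{\mathsf{A}}$; on vertical arrows, the coproduct of spans; on horizontal arrows, $(La\to x\leftarrow La')\otimes(Lb\to y\leftarrow Lb')=(L(a+b)\to x+y\leftarrow L(a'+b'))$, with unit $L0_{\mathsf{A}}\to L0_{\mathsf{A}}\leftarrow L0_{\mathsf{A}}$; on squares, the same operation in each row. A symmetric monoidal double category is a double category $\mathbb{C}$, with category $\mathbb{C}_0$ of objects and vertical arrows, category $\mathbb{C}_1$ of horizontal arrows and squares, unit functor $U$, source and target functors $S,T$ and horizontal composition $\odot$, such that: $\mathbb{C}_0$ and $\mathbb{C}_1$ are symmetric monoidal; if $I$ is the unit of $\mathbb{C}_0$ then $U_I$ is the unit of $\mathbb{C}_1$; $S$ and $T$ are strict (braided) monoidal and preserve the associativity and unit constraints; and there are globular isomorphisms $(x\otimes y)\odot(x'\otimes y')\to(x\odot x')\otimes(y\odot y')$ and $U(a\otimes b)\to Ua\otimes Ub$ satisfying the coherence diagrams that make $\otimes$ a double functor and make its associativity, unit and braiding isomorphisms transformations of double categories. *)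

(* Defs.v *)
(* Stdlib only: categories are E-categories, i.e. every hom-type carries its own
   equality [==], and every uniqueness or commutation statement is up to [==].
   A category in the ordinary sense is the case where [==] is Leibniz equality;
   a category whose arrows are isomorphism classes is the case where the arrows
   are representatives and [==] is isomorphism. *)
From Stdlib Require Import List Setoid Morphisms.

Set Implicit Arguments.
Unset Strict Implicit.
Unset Printing Implicit Defensive.

(** * Categories, functors, adjunctions *)

(* Data of a category without the laws, so that "these data form a category"
   can be a conclusion and not only a hypothesis. *)
Record RawCat := {
  Ob :> Type;
  Hom : Ob -> Ob -> Type;
  eqh : forall a b, Hom a b -> Hom a b -> Prop;
  idm : forall a, Hom a a;
  comp : forall a b c, Hom b c -> Hom a b -> Hom a c
}.
Arguments Hom {_} _ _.
Arguments eqh {_ _ _} _ _.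
Arguments idm {_} _.
Arguments comp {_ _ _ _} _ _.

Notation "f == g" := (eqh f g) (at level 70, no associativity).
Notation "g \o f" := (comp g f) (at level 40, left associativity).

Record is_category (C : RawCat) : Prop := {
  eqh_equiv : forall a b : C, Equivalence (@eqh C a b);
  comp_proper : forall (a b c : C) (g g' : Hom b c) (f f' : Hom a b),
    g == g' -> f == f' -> g \o f == g' \o f';
  comp_idl : forall (a b : C) (f : Hom a b), idm b \o f == f;
  comp_idr : forall (a b : C) (f : Hom a b), f \o idm a == f;
  comp_assoc : forall (a b c d : C) (h : Hom c d) (g : Hom b c) (f : Hom a b),
    h \o (g \o f) == (h \o g) \o f
}.

Record Category := {
  rawcat :> RawCat;
  category_laws : is_category rawcat
}.

#[export] Instance eqh_Equivalence (C : Category) (a b : C) :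
  Equivalence (@eqh C a b) := eqh_equiv (category_laws C) a b.

#[export] Instance comp_Proper (C : Category) (a b c : C) :
  Proper (@eqh C b c ==> @eqh C a b ==> @eqh C a c) (@comp C a b c).
Proof.
  intros g g' Hg f f' Hf. exact (comp_proper (category_laws C) Hg Hf).
Qed.

Record Iso (C : RawCat) (a b : C) := {
  fwd :> Hom a b;
  bwd : Hom b a;
  fwd_bwd : fwd \o bwd == idm b;
  bwd_fwd : bwd \o fwd == idm a
}.
Arguments Iso {_} _ _.

Definition is_iso (C : RawCat) (a b : C) (f : Hom a b) : Prop :=
  exists g : Hom b a, f \o g == idm b /\ g \o f == idm a.

Definition monic (C : RawCat) (a b : C) (m : Hom a b) : Prop :=
  forall (d : C) (u v : Hom d a), m \o u == m \o v -> u == v.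

Definition ex_unique (C : RawCat) (a b : C) (P : Hom a b -> Prop) : Prop :=
  exists w, P w /\ forall w', P w' -> w' == w.

Record Functor (C D : Category) := {
  fob :> C -> D;
  fmap : forall a b : C, Hom a b -> Hom (fob a) (fob b);
  fmap_proper : forall (a b : C) (f g : Hom a b), f == g -> fmap f == fmap g;
  fmap_id : forall a : C, fmap (idm a) == idm (fob a);
  fmap_comp : forall (a b c : C) (g : Hom b c) (f : Hom a b),
    fmap (g \o f) == fmap g \o fmap f
}.
Arguments fmap {_ _} _ {_ _} _.

#[export] Instance fmap_Proper (C D : Category) (F : Functor C D) (a b : C) :
  Proper (@eqh C a b ==> @eqh D (F a) (F b)) (@fmap C D F a b).
Proof. intros f g H. now apply fmap_proper. Qed.

(* [L] is left adjoint to [R]: a bijection [Hom (L a) x ~ Hom a (R x)], natural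
   in [a] and [x]. *)
Record Adjunction (A X : Category) (L : Functor A X) (R : Functor X A) := {
  transp : forall (a : A) (x : X), Hom (L a) x -> Hom a (R x);
  untransp : forall (a : A) (x : X), Hom a (R x) -> Hom (L a) x;
  transp_proper : forall (a : A) (x : X) (f g : Hom (L a) x),
    f == g -> transp f == transp g;
  untransp_proper : forall (a : A) (x : X) (f g : Hom a (R x)),
    f == g -> untransp f == untransp g;
  transp_untransp : forall (a : A) (x : X) (g : Hom a (R x)),
    transp (untransp g) == g;
  untransp_transp : forall (a : A) (x : X) (f : Hom (L a) x),
    untransp (transp f) == f;
  transp_natl : forall (a' a : A) (x : X) (f : Hom (L a) x) (u : Hom a' a),
    transp (f \o fmap L u) == transp f \o u;
  transp_natr : forall (a : A) (x x' : X) (f : Hom (L a) x) (k : Hom x x'),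
    transp (k \o f) == fmap R k \o transp f
}.
Arguments transp {_ _ _ _} _ {_ _} _.
Arguments untransp {_ _ _ _} _ {_ _} _.

(** * Topoi *)

Record Cone (J C : Category) (F : Functor J C) := {
  apex : C;
  leg : forall j : J, Hom apex (F j);
  leg_natural : forall (i j : J) (f : Hom i j), fmap F f \o leg i == leg j
}.
Arguments apex {_ _ _} _.
Arguments leg {_ _ _} _ _.

Definition is_limit (J C : Category) (F : Functor J C) (K : Cone F) : Prop :=
  forall K' : Cone F,
    ex_unique (fun u : Hom (apex K') (apex K) =>
                 forall j, leg K j \o u == leg K' j).

Definition is_finite (J : Category) : Prop :=
  (exists l : list J, forall j, In j l) /\
  (forall i j : J, exists l : list (Hom i j), forall f, Exists (eqh f) l).

Definition has_finite_limits (C : Category) : Prop :=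
  forall J : Category, is_finite J ->
  forall F : Functor J C, exists K : Cone F, is_limit K.

Definition is_terminal (C : Category) (t : C) : Prop :=
  forall a : C, ex_unique (fun _ : Hom a t => True).

Definition is_product (C : Category) (a b p : C) (p1 : Hom p a) (p2 : Hom p b)
    : Prop :=
  forall (d : C) (u : Hom d a) (v : Hom d b),
    ex_unique (fun w : Hom d p => p1 \o w == u /\ p2 \o w == v).

Definition is_pullback (C : Category) (a b c p : C)
    (f : Hom a c) (g : Hom b c) (p1 : Hom p a) (p2 : Hom p b) : Prop :=
  f \o p1 == g \o p2 /\
  forall (d : C) (u : Hom d a) (v : Hom d b), f \o u == g \o v ->
    ex_unique (fun w : Hom d p => p1 \o w == u /\ p2 \o w == v).

(* [e] is the exponential [b^a], [q] the product [e * a] and [ev] the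
   evaluation; in the universal property, [h] is [g * id]. *)
Definition cartesian_closed (C : Category) : Prop :=
  forall a b : C,
  exists (e q : C) (q1 : Hom q e) (q2 : Hom q a) (ev : Hom q b),
    is_product q1 q2 /\
    forall (c p : C) (p1 : Hom p c) (p2 : Hom p a) (f : Hom p b),
      is_product p1 p2 ->
      ex_unique (fun g : Hom c e =>
        exists h : Hom p q, q1 \o h == g \o p1 /\ q2 \o h == p2 /\ ev \o h == f).

Definition has_subobject_classifier (C : Category) : Prop :=
  exists (one Omega : C) (true_ : Hom one Omega),
    is_terminal one /\
    forall (u x : C) (m : Hom u x), monic m ->
      ex_unique (fun chi : Hom x Omega =>
        exists bang : Hom u one, is_pullback chi true_ m bang).

Definition is_topos (C : Category) : Prop :=
  has_finite_limits C /\ cartesian_closed C /\ has_subobject_classifier C.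

Definition preserves_pullbacks (C D : Category) (F : Functor C D) : Prop :=
  forall (a b c p : C) (f : Hom a c) (g : Hom b c) (p1 : Hom p a) (p2 : Hom p b),
    is_pullback f g p1 p2 ->
    is_pullback (fmap F f) (fmap F g) (fmap F p1) (fmap F p2).

(** * Chosen limits and colimits *)

Record Pullback (C : Category) (a b c : C) (f : Hom a c) (g : Hom b c) := {
  pb_ob : C;
  pb1 : Hom pb_ob a;
  pb2 : Hom pb_ob b;
  pb_sq : f \o pb1 == g \o pb2;
  pb_pair : forall (d : C) (u : Hom d a) (v : Hom d b),
    f \o u == g \o v -> Hom d pb_ob;
  pb_pair1 : forall d (u : Hom d a) (v : Hom d b) (e : f \o u == g \o v),
    pb1 \o pb_pair e == u;
  pb_pair2 : forall d (u : Hom d a) (v : Hom d b) (e : f \o u == g \o v),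
    pb2 \o pb_pair e == v;
  pb_ext : forall (d : C) (w w' : Hom d pb_ob),
    pb1 \o w == pb1 \o w' -> pb2 \o w == pb2 \o w' -> w == w'
}.

Record Pushout (C : Category) (a b c : C) (f : Hom c a) (g : Hom c b) := {
  po_ob : C;
  po1 : Hom a po_ob;
  po2 : Hom b po_ob;
  po_sq : po1 \o f == po2 \o g;
  po_pair : forall (d : C) (u : Hom a d) (v : Hom b d),
    u \o f == v \o g -> Hom po_ob d;
  po_pair1 : forall d (u : Hom a d) (v : Hom b d) (e : u \o f == v \o g),
    po_pair e \o po1 == u;
  po_pair2 : forall d (u : Hom a d) (v : Hom b d) (e : u \o f == v \o g),
    po_pair e \o po2 == v;
  po_ext : forall (d : C) (w w' : Hom po_ob d),
    w \o po1 == w' \o po1 -> w \o po2 == w' \o po2 -> w == w'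
}.

Record Coproduct (C : Category) (a b : C) := {
  cp_ob : C;
  cp1 : Hom a cp_ob;
  cp2 : Hom b cp_ob;
  cp_pair : forall (d : C), Hom a d -> Hom b d -> Hom cp_ob d;
  cp_pair1 : forall d (u : Hom a d) (v : Hom b d), cp_pair u v \o cp1 == u;
  cp_pair2 : forall d (u : Hom a d) (v : Hom b d), cp_pair u v \o cp2 == v;
  cp_ext : forall (d : C) (w w' : Hom cp_ob d),
    w \o cp1 == w' \o cp1 -> w \o cp2 == w' \o cp2 -> w == w'
}.

Record Initial (C : Category) := {
  in_ob : C;
  in_map : forall d : C, Hom in_ob d;
  in_ext : forall (d : C) (w w' : Hom in_ob d), w == w'
}.

(* The limits and colimits through which the compositions and the tensor of
   fine rewrites are defined.  They are determined only up to isomorphism, so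
   the double category depends on such a choice. *)
Record Choices (A X : Category) := {
  pbA : forall (a b c : A) (f : Hom a c) (g : Hom b c), Pullback f g;
  pbX : forall (x y z : X) (f : Hom x z) (g : Hom y z), Pullback f g;
  poX : forall (x y z : X) (f : Hom z x) (g : Hom z y), Pushout f g;
  cpA : forall a b : A, Coproduct a b;
  cpX : forall x y : X, Coproduct x y;
  inA : Initial A
}.

(** * Symmetric monoidal categories *)

Record TensorData (C : RawCat) := {
  tob : C -> C -> C;
  thom : forall a b a' b' : C,
    Hom a b -> Hom a' b' -> Hom (tob a a') (tob b b');
  tunit : C
}.
Arguments tob {_} _ _ _.
Arguments thom {_} _ {_ _ _ _} _ _.
Arguments tunit {_} _.

Record SymMonoidal (C : RawCat) (T : TensorData C) := {
  thom_proper : forall (a b a' b' : C) (f g : Hom a b) (f' g' : Hom a' b'),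
    f == g -> f' == g' -> thom T f f' == thom T g g';
  thom_id : forall a b : C, thom T (idm a) (idm b) == idm (tob T a b);
  thom_comp : forall (a b c a' b' c' : C)
      (g : Hom b c) (f : Hom a b) (g' : Hom b' c') (f' : Hom a' b'),
    thom T (g \o f) (g' \o f') == thom T g g' \o thom T f f';

  massoc : forall a b c : C, Iso (tob T (tob T a b) c) (tob T a (tob T b c));
  mlun : forall a : C, Iso (tob T (tunit T) a) a;
  mrun : forall a : C, Iso (tob T a (tunit T)) a;
  mbraid : forall a b : C, Iso (tob T a b) (tob T b a);

  massoc_nat : forall (a b c a' b' c' : C)
      (f : Hom a a') (g : Hom b b') (h : Hom c c'),
    massoc a' b' c' \o thom T (thom T f g) h
    == thom T f (thom T g h) \o massoc a b c;
  mlun_nat : forall (a b : C) (f : Hom a b),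
    mlun b \o thom T (idm (tunit T)) f == f \o mlun a;
  mrun_nat : forall (a b : C) (f : Hom a b),
    mrun b \o thom T f (idm (tunit T)) == f \o mrun a;
  mbraid_nat : forall (a b a' b' : C) (f : Hom a a') (g : Hom b b'),
    mbraid a' b' \o thom T f g == thom T g f \o mbraid a b;

  mpentagon : forall a b c d : C,
    massoc a b (tob T c d) \o massoc (tob T a b) c d
    == thom T (idm a) (massoc b c d) \o massoc a (tob T b c) d
       \o thom T (massoc a b c) (idm d);
  mtriangle : forall a b : C,
    thom T (idm a) (mlun b) \o massoc a (tunit T) b
    == thom T (mrun a) (idm b);
  mhexagon : forall a b c : C,
    massoc b c a \o mbraid a (tob T b c) \o massoc a b c
    == thom T (idm b) (mbraid a c) \o massoc b a c
       \o thom T (mbraid a b) (idm c);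
  msymmetry : forall a b : C, mbraid b a \o mbraid a b == idm (tob T a b)
}.
Arguments massoc {_ _} _ _ _ _.
Arguments mlun {_ _} _ _.
Arguments mrun {_ _} _ _.
Arguments mbraid {_ _} _ _ _.

(** * Double categories *)

(* The category of objects and vertical arrows is [C0].  A horizontal arrow has
   its source and target in its type; a square has its two horizontal
   boundaries in its type and its two vertical boundaries [src], [tgt] as
   operations.  Thus S and T are typing on objects, and on objects their
   strictness needs no equation.
   [hcomp M N] is composition in diagrammatic order.  Squares compose
   horizontally when the shared vertical arrows are equal in [C0]. *)
Record DoubleData := {
  C0 : RawCat;
  H : C0 -> C0 -> Type;
  Sq : forall a b c d : C0, H a b -> H c d -> Type;
  sqeq : forall (a b c d : C0) (M : H a b) (N : H c d), Sq M N -> Sq M N -> Prop;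
  src : forall (a b c d : C0) (M : H a b) (N : H c d), Sq M N -> Hom a c;
  tgt : forall (a b c d : C0) (M : H a b) (N : H c d), Sq M N -> Hom b d;
  sqid : forall (a b : C0) (M : H a b), Sq M M;
  sqcomp : forall (a b c d e f : C0) (M : H a b) (N : H c d) (P : H e f),
    Sq N P -> Sq M N -> Sq M P;
  hU : forall a : C0, H a a;
  sqU : forall a b : C0, Hom a b -> Sq (hU a) (hU b);
  hcomp : forall a b c : C0, H a b -> H b c -> H a c;
  hsq : forall (a b c a' b' c' : C0)
      (M : H a b) (N : H b c) (M' : H a' b') (N' : H b' c')
      (s : Sq M M') (t : Sq N N'),
    tgt s == src t -> Sq (hcomp M N) (hcomp M' N')
}.
Arguments H {_} _ _.
Arguments Sq {_ _ _ _ _} _ _.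
Arguments sqeq {_ _ _ _ _ _ _} _ _.
Arguments src {_ _ _ _ _ _ _} _.
Arguments tgt {_ _ _ _ _ _ _} _.
Arguments sqid {_ _ _} _.
Arguments sqcomp {_ _ _ _ _ _ _ _ _ _} _ _.
Arguments hU {_} _.
Arguments sqU {_ _ _} _.
Arguments hcomp {_ _ _ _} _ _.
Arguments hsq {_ _ _ _ _ _ _ _ _ _ _ _ _} _.

Record HArrow (D : DoubleData) := mkH {
  hsrc : C0 D;
  htgt : C0 D;
  harr : H hsrc htgt
}.
Arguments mkH {_ _ _} _.
Arguments hsrc {_} _.
Arguments htgt {_} _.
Arguments harr {_} _.

Definition C1 (D : DoubleData) : RawCat := {|
  Ob := HArrow D;
  Hom := fun M N => Sq (harr M) (harr N);
  eqh := fun M N => @sqeq D _ _ _ _ (harr M) (harr N);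
  idm := fun M => sqid (harr M);
  comp := fun M N P => @sqcomp D _ _ _ _ _ _ (harr M) (harr N) (harr P)
|}.

Notation "s =s= t" := (sqeq s t) (at level 70, no associativity).
Notation "t \s s" := (sqcomp t s) (at level 40, left associativity).
Notation "M (.) N" := (hcomp M N) (at level 38, left associativity).

Definition SqIso (D : DoubleData) (a b c d : C0 D) (M : H a b) (N : H c d) :=
  @Iso (C1 D) (mkH M) (mkH N).
Definition cell (D : DoubleData) (a b c d : C0 D) (M : H a b) (N : H c d)
  (i : SqIso M N) : Sq M N := fwd i.
Coercion cell : SqIso >-> Sq.

Definition globular (D : DoubleData) (a b : C0 D) (M N : H a b) (s : Sq M N)
    : Prop :=
  src s == idm a /\ tgt s == idm b.

(* An equation between squares that involves [hsq] is quantified over the proofs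
   that the vertical boundaries match; such proofs always exist, by the axioms on
   the boundaries, and [hsq_proper] says that the choice is irrelevant. *)
Record DoubleCategory (D : DoubleData) := {
  C0_category : is_category (C0 D);
  C1_category : is_category (C1 D);

  (* S and T are functors *)
  src_proper : forall (a b c d : C0 D) (M : H a b) (N : H c d) (s t : Sq M N),
    s =s= t -> src s == src t;
  tgt_proper : forall (a b c d : C0 D) (M : H a b) (N : H c d) (s t : Sq M N),
    s =s= t -> tgt s == tgt t;
  src_id : forall (a b : C0 D) (M : H a b), src (sqid M) == idm a;
  tgt_id : forall (a b : C0 D) (M : H a b), tgt (sqid M) == idm b;
  src_comp : forall (a b c d e f : C0 D) (M : H a b) (N : H c d) (P : H e f)
      (t : Sq N P) (s : Sq M N), src (t \s s) == src t \o src s;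
  tgt_comp : forall (a b c d e f : C0 D) (M : H a b) (N : H c d) (P : H e f)
      (t : Sq N P) (s : Sq M N), tgt (t \s s) == tgt t \o tgt s;

  (* U is a functor, with S U = T U = id *)
  sqU_proper : forall (a b : C0 D) (f g : Hom a b), f == g -> sqU f =s= sqU g;
  sqU_id : forall a : C0 D, sqU (idm a) =s= sqid (hU a);
  sqU_comp : forall (a b c : C0 D) (g : Hom b c) (f : Hom a b),
    sqU (g \o f) =s= sqU g \s sqU f;
  src_U : forall (a b : C0 D) (f : Hom a b), src (sqU f) == f;
  tgt_U : forall (a b : C0 D) (f : Hom a b), tgt (sqU f) == f;

  (* horizontal composition is a functor over S and T *)
  src_hsq : forall (a b c a' b' c' : C0 D)
      (M : H a b) (N : H b c) (M' : H a' b') (N' : H b' c')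
      (s : Sq M M') (t : Sq N N') (e : tgt s == src t), src (hsq e) == src s;
  tgt_hsq : forall (a b c a' b' c' : C0 D)
      (M : H a b) (N : H b c) (M' : H a' b') (N' : H b' c')
      (s : Sq M M') (t : Sq N N') (e : tgt s == src t), tgt (hsq e) == tgt t;
  hsq_proper : forall (a b c a' b' c' : C0 D)
      (M : H a b) (N : H b c) (M' : H a' b') (N' : H b' c')
      (s s' : Sq M M') (t t' : Sq N N')
      (e : tgt s == src t) (e' : tgt s' == src t'),
    s =s= s' -> t =s= t' -> hsq e =s= hsq e';
  hsq_id : forall (a b c : C0 D) (M : H a b) (N : H b c)
      (e : tgt (sqid M) == src (sqid N)), hsq e =s= sqid (M (.) N);
  hsq_comp : forall (a b c a' b' c' a'' b'' c'' : C0 D)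
      (M : H a b) (N : H b c) (M' : H a' b') (N' : H b' c')
      (M'' : H a'' b'') (N'' : H b'' c'')
      (s : Sq M M') (t : Sq N N') (s' : Sq M' M'') (t' : Sq N' N'')
      (e : tgt s == src t) (e' : tgt s' == src t')
      (e'' : tgt (s' \s s) == src (t' \s t)),
    hsq e'' =s= hsq e' \s hsq e;

  hassoc : forall (a b c d : C0 D) (M : H a b) (N : H b c) (P : H c d),
    SqIso ((M (.) N) (.) P) (M (.) (N (.) P));
  hlun : forall (a b : C0 D) (M : H a b), SqIso (hU a (.) M) M;
  hrun : forall (a b : C0 D) (M : H a b), SqIso (M (.) hU b) M;
  hassoc_globular : forall (a b c d : C0 D) (M : H a b) (N : H b c) (P : H c d),
    globular (hassoc M N P);
  hlun_globular : forall (a b : C0 D) (M : H a b), globular (hlun M);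
  hrun_globular : forall (a b : C0 D) (M : H a b), globular (hrun M);

  hassoc_nat : forall (a b c d a' b' c' d' : C0 D)
      (M : H a b) (N : H b c) (P : H c d)
      (M' : H a' b') (N' : H b' c') (P' : H c' d')
      (s : Sq M M') (t : Sq N N') (r : Sq P P')
      (e1 : tgt s == src t) (e2 : tgt t == src r)
      (e3 : tgt (hsq e1) == src r) (e4 : tgt s == src (hsq e2)),
    hassoc M' N' P' \s hsq e3 =s= hsq e4 \s hassoc M N P;
  hlun_nat : forall (a b a' b' : C0 D) (M : H a b) (M' : H a' b') (s : Sq M M')
      (e : tgt (sqU (src s)) == src s),
    hlun M' \s hsq e =s= s \s hlun M;
  hrun_nat : forall (a b a' b' : C0 D) (M : H a b) (M' : H a' b') (s : Sq M M')
      (e : tgt s == src (sqU (tgt s))),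
    hrun M' \s hsq e =s= s \s hrun M;

  hpentagon : forall (a b c d f : C0 D)
      (M : H a b) (N : H b c) (P : H c d) (Q : H d f)
      (e1 : tgt (sqid M) == src (hassoc N P Q))
      (e2 : tgt (hassoc M N P) == src (sqid Q)),
    hassoc M N (P (.) Q) \s hassoc (M (.) N) P Q
    =s= hsq e1 \s hassoc M (N (.) P) Q \s hsq e2;
  htriangle : forall (a b c : C0 D) (M : H a b) (N : H b c)
      (e1 : tgt (sqid M) == src (hlun N)) (e2 : tgt (hrun M) == src (sqid N)),
    hsq e1 \s hassoc M (hU b) N =s= hsq e2
}.
Arguments hassoc {_} _ {_ _ _ _} _ _ _.
Arguments hlun {_} _ {_ _} _.
Arguments hrun {_} _ {_ _} _.

(** * Symmetric monoidal double categories *)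

(* Since [htens] is typed over the tensor of [C0], S and T are strict monoidal
   on objects. *)
Record DoubleTensor (D : DoubleData) := {
  tens0 :> TensorData (C0 D);
  htens : forall a b a' b' : C0 D,
    H a b -> H a' b' -> H (tob tens0 a a') (tob tens0 b b');
  sqtens : forall (a b c d a' b' c' d' : C0 D)
      (M : H a b) (N : H c d) (M' : H a' b') (N' : H c' d'),
    Sq M N -> Sq M' N' -> Sq (htens M M') (htens N N')
}.
Arguments htens {_} _ {_ _ _ _} _ _.
Arguments sqtens {_} _ {_ _ _ _ _ _ _ _ _ _ _ _} _ _.

(* The unit of [C1] is the horizontal identity [hU] of the unit of [C0]. *)
Definition tens1 (D : DoubleData) (T : DoubleTensor D) : TensorData (C1 D) := {|
  tob := fun M N : C1 D => (mkH (htens T (harr M) (harr N)) : C1 D);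
  thom := fun (M N M' N' : C1 D) (s : Hom M N) (s' : Hom M' N') => sqtens T s s';
  tunit := (mkH (hU (tunit T)) : C1 D)
|}.

Section Coherence.
Context (D : DoubleData) (T : DoubleTensor D) (dc : DoubleCategory D)
  (sm0 : SymMonoidal (tens0 T)) (sm1 : SymMonoidal (tens1 T)).

Local Notation "a (x) b" := (tob T a b) (at level 37, left associativity).
Local Notation "M [x] N" := (htens T M N) (at level 37, left associativity).
Local Notation "s <x> t" := (sqtens T s t) (at level 37, left associativity).
Local Notation I := (tunit T).

Definition as1 (a b a' b' a'' b'' : C0 D)
    (M : H a b) (N : H a' b') (P : H a'' b'') :
    SqIso ((M [x] N) [x] P) (M [x] (N [x] P)) :=
  massoc sm1 (mkH M) (mkH N) (mkH P).
Definition lu1 (a b : C0 D) (M : H a b) : SqIso (hU I [x] M) M :=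
  mlun sm1 (mkH M).
Definition ru1 (a b : C0 D) (M : H a b) : SqIso (M [x] hU I) M :=
  mrun sm1 (mkH M).
Definition br1 (a b a' b' : C0 D) (M : H a b) (N : H a' b') :
    SqIso (M [x] N) (N [x] M) :=
  mbraid sm1 (mkH M) (mkH N).

Record ST_strict : Prop := {
  src_tens : forall (a b c d a' b' c' d' : C0 D)
      (M : H a b) (N : H c d) (M' : H a' b') (N' : H c' d')
      (s : Sq M N) (s' : Sq M' N'), src (s <x> s') == thom T (src s) (src s');
  tgt_tens : forall (a b c d a' b' c' d' : C0 D)
      (M : H a b) (N : H c d) (M' : H a' b') (N' : H c' d')
      (s : Sq M N) (s' : Sq M' N'), tgt (s <x> s') == thom T (tgt s) (tgt s');
  src_assoc : forall (a b a' b' a'' b'' : C0 D)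
      (M : H a b) (N : H a' b') (P : H a'' b''),
    src (as1 M N P) == massoc sm0 a a' a'';
  tgt_assoc : forall (a b a' b' a'' b'' : C0 D)
      (M : H a b) (N : H a' b') (P : H a'' b''),
    tgt (as1 M N P) == massoc sm0 b b' b'';
  src_lun : forall (a b : C0 D) (M : H a b), src (lu1 M) == mlun sm0 a;
  tgt_lun : forall (a b : C0 D) (M : H a b), tgt (lu1 M) == mlun sm0 b;
  src_run : forall (a b : C0 D) (M : H a b), src (ru1 M) == mrun sm0 a;
  tgt_run : forall (a b : C0 D) (M : H a b), tgt (ru1 M) == mrun sm0 b;
  src_braid : forall (a b a' b' : C0 D) (M : H a b) (N : H a' b'),
    src (br1 M N) == mbraid sm0 a a';
  tgt_braid : forall (a b a' b' : C0 D) (M : H a b) (N : H a' b'),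
    tgt (br1 M N) == mbraid sm0 b b'
}.

(* The globular isomorphisms comparing the tensor with horizontal composition
   and with horizontal identities. *)
Record Interchange := {
  ichi : forall (a b c a' b' c' : C0 D)
      (M : H a b) (M' : H a' b') (N : H b c) (N' : H b' c'),
    SqIso ((M [x] M') (.) (N [x] N')) ((M (.) N) [x] (M' (.) N'));
  imu : forall a b : C0 D, SqIso (hU (a (x) b)) (hU a [x] hU b)
}.

Context (K : Interchange).
Local Notation chi := (ichi K).
Local Notation mu := (imu K).

Record interchange_natural : Prop := {
  chi_globular : forall (a b c a' b' c' : C0 D)
      (M : H a b) (M' : H a' b') (N : H b c) (N' : H b' c'),
    globular (chi M M' N N');
  mu_globular : forall a b : C0 D, globular (mu a b);
  chi_nat : forall (a b c a' b' c' p q r p' q' r' : C0 D)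
      (M : H a b) (M' : H a' b') (N : H b c) (N' : H b' c')
      (P : H p q) (P' : H p' q') (Q : H q r) (Q' : H q' r')
      (s : Sq M P) (s' : Sq M' P') (t : Sq N Q) (t' : Sq N' Q')
      (e1 : tgt (s <x> s') == src (t <x> t'))
      (e2 : tgt s == src t) (e3 : tgt s' == src t'),
    chi P P' Q Q' \s hsq e1 =s= (hsq e2 <x> hsq e3) \s chi M M' N N';
  mu_nat : forall (a b a' b' : C0 D) (f : Hom a b) (f' : Hom a' b'),
    mu b b' \s sqU (thom T f f') =s= (sqU f <x> sqU f') \s mu a a'
}.

Record tensor_double_functor : Prop := {
  chi_assoc : forall (a b c d a' b' c' d' : C0 D)
      (M1 : H a b) (M2 : H b c) (M3 : H c d)
      (N1 : H a' b') (N2 : H b' c') (N3 : H c' d')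
      (e1 : tgt (chi M1 N1 M2 N2) == src (sqid (M3 [x] N3)))
      (e2 : tgt (sqid (M1 [x] N1)) == src (chi M2 N2 M3 N3)),
    (hassoc dc M1 M2 M3 <x> hassoc dc N1 N2 N3)
      \s chi (M1 (.) M2) (N1 (.) N2) M3 N3 \s hsq e1
    =s= chi M1 N1 (M2 (.) M3) (N2 (.) N3) \s hsq e2
      \s hassoc dc (M1 [x] N1) (M2 [x] N2) (M3 [x] N3);
  chi_hlun : forall (a b a' b' : C0 D) (M : H a b) (N : H a' b')
      (e : tgt (mu a a') == src (sqid (M [x] N))),
    (hlun dc M <x> hlun dc N) \s chi (hU a) (hU a') M N \s hsq e
    =s= hlun dc (M [x] N);
  chi_hrun : forall (a b a' b' : C0 D) (M : H a b) (N : H a' b')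
      (e : tgt (sqid (M [x] N)) == src (mu b b')),
    (hrun dc M <x> hrun dc N) \s chi M N (hU b) (hU b') \s hsq e
    =s= hrun dc (M [x] N)
}.

Record constraints_transformations : Prop := {
  assoc_chi : forall (a b c a' b' c' a'' b'' c'' : C0 D)
      (M1 : H a b) (M2 : H b c) (N1 : H a' b') (N2 : H b' c')
      (P1 : H a'' b'') (P2 : H b'' c'')
      (e : tgt (as1 M1 N1 P1) == src (as1 M2 N2 P2)),
    (sqid (M1 (.) M2) <x> chi N1 P1 N2 P2)
      \s chi M1 (N1 [x] P1) M2 (N2 [x] P2) \s hsq e
    =s= as1 (M1 (.) M2) (N1 (.) N2) (P1 (.) P2)
      \s (chi M1 N1 M2 N2 <x> sqid (P1 (.) P2))
      \s chi (M1 [x] N1) P1 (M2 [x] N2) P2;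
  assoc_mu : forall a b c : C0 D,
    (sqid (hU a) <x> mu b c) \s mu a (b (x) c) \s sqU (massoc sm0 a b c)
    =s= as1 (hU a) (hU b) (hU c) \s (mu a b <x> sqid (hU c)) \s mu (a (x) b) c;
  lun_chi : forall (a b c : C0 D) (M : H a b) (N : H b c)
      (e : tgt (lu1 M) == src (lu1 N)),
    hsq e =s= lu1 (M (.) N) \s (hlun dc (hU I) <x> sqid (M (.) N))
      \s chi (hU I) M (hU I) N;
  lun_mu : forall a : C0 D, sqU (mlun sm0 a) =s= lu1 (hU a) \s mu I a;
  run_chi : forall (a b c : C0 D) (M : H a b) (N : H b c)
      (e : tgt (ru1 M) == src (ru1 N)),
    hsq e =s= ru1 (M (.) N) \s (sqid (M (.) N) <x> hrun dc (hU I))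
      \s chi M (hU I) N (hU I);
  run_mu : forall a : C0 D, sqU (mrun sm0 a) =s= ru1 (hU a) \s mu a I;
  braid_chi : forall (a b c a' b' c' : C0 D)
      (M1 : H a b) (M2 : H b c) (N1 : H a' b') (N2 : H b' c')
      (e : tgt (br1 M1 N1) == src (br1 M2 N2)),
    chi N1 M1 N2 M2 \s hsq e
    =s= br1 (M1 (.) M2) (N1 (.) N2) \s chi M1 N1 M2 N2;
  braid_mu : forall a b : C0 D,
    mu b a \s sqU (mbraid sm0 a b) =s= br1 (hU a) (hU b) \s mu a b
}.

End Coherence.

Record SymMonDoubleCategory (D : DoubleData) (T : DoubleTensor D) := {
  double_category : DoubleCategory D;
  symmon0 : SymMonoidal (tens0 T);
  symmon1 : SymMonoidal (tens1 T);
  strictST : ST_strict symmon0 symmon1;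
  interchange : Interchange T;
  interchange_nat : interchange_natural interchange;
  tensor_functor : tensor_double_functor double_category interchange;
  constraint_transf :
    constraints_transformations double_category symmon0 symmon1 interchange
}.

(** * Structured cospans and fine rewrites *)

Lemma iso_monic (C : Category) (a b : C) (i : Iso a b) : monic i.
Proof.
  intros d u v E.
  rewrite <- (comp_idl (category_laws C) u), <- (comp_idl (category_laws C) v).
  rewrite <- (bwd_fwd i), <- !(comp_assoc (category_laws C)), E. reflexivity.
Qed.

Lemma monic_comp (C : Category) (a b c : C) (g : Hom b c) (f : Hom a b) :
  monic g -> monic f -> monic (g \o f).
Proof.
  intros Hg Hf d u v E. apply Hf, Hg.
  now rewrite !(comp_assoc (category_laws C)).
Qed.

Lemma pb1_monic (C : Category) (a b c : C) (f : Hom a c) (g : Hom b c)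
  (P : Pullback f g) : monic g -> monic (pb1 P).
Proof.
  intros Hg d u v E. apply (pb_ext E). apply Hg.
  rewrite !(comp_assoc (category_laws C)), <- (pb_sq P).
  rewrite <- !(comp_assoc (category_laws C)). now rewrite E.
Qed.

Lemma pb2_monic (C : Category) (a b c : C) (f : Hom a c) (g : Hom b c)
  (P : Pullback f g) : monic f -> monic (pb2 P).
Proof.
  intros Hf d u v E. refine (pb_ext _ E). apply Hf.
  rewrite !(comp_assoc (category_laws C)), (pb_sq P).
  rewrite <- !(comp_assoc (category_laws C)). now rewrite E.
Qed.

Section Isos.
Context (C : Category).

Definition iso_id (a : C) : Iso a a.
Proof.
  refine {| fwd := idm a; bwd := idm a |}; apply (comp_idl (category_laws C)).
Defined.

Definition iso_comp (a b c : C) (j : Iso b c) (i : Iso a b) : Iso a c.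
Proof.
  refine {| fwd := j \o i; bwd := bwd i \o bwd j |}.
  - rewrite (comp_assoc (category_laws C)), <- (comp_assoc (category_laws C) j).
    now rewrite (fwd_bwd i), (comp_idr (category_laws C)), (fwd_bwd j).
  - rewrite (comp_assoc (category_laws C)),
      <- (comp_assoc (category_laws C) (bwd i)).
    now rewrite (bwd_fwd j), (comp_idr (category_laws C)), (bwd_fwd i).
Defined.

Definition iso_inv (a b : C) (i : Iso a b) : Iso b a :=
  {| fwd := bwd i; bwd := fwd i; fwd_bwd := bwd_fwd i; bwd_fwd := fwd_bwd i |}.

Definition pb1_iso (a b c : C) (f : Hom a c) (g : Iso b c) (P : Pullback f g) :
  Iso (pb_ob P) a.
Proof.
  assert (E : f \o idm a == g \o (bwd g \o f)).
  { now rewrite (comp_assoc (category_laws C)), (fwd_bwd g),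
      (comp_idl (category_laws C)), (comp_idr (category_laws C)). }
  refine {| fwd := pb1 P; bwd := pb_pair P E |}.
  - apply pb_pair1.
  - apply (pb1_monic (iso_monic (i := g))).
    now rewrite (comp_assoc (category_laws C)), pb_pair1,
      (comp_idl (category_laws C)), (comp_idr (category_laws C)).
Defined.

Definition pb2_iso (a b c : C) (f : Iso a c) (g : Hom b c) (P : Pullback f g) :
  Iso (pb_ob P) b.
Proof.
  assert (E : f \o (bwd f \o g) == g \o idm b).
  { now rewrite (comp_assoc (category_laws C)), (fwd_bwd f),
      (comp_idl (category_laws C)), (comp_idr (category_laws C)). }
  refine {| fwd := pb2 P; bwd := pb_pair P E |}.
  - apply pb_pair2.
  - apply (pb2_monic (iso_monic (i := f))).
    now rewrite (comp_assoc (category_laws C)), pb_pair2,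
      (comp_idl (category_laws C)), (comp_idr (category_laws C)).
Defined.

End Isos.

#[export] Instance cp_pair_Proper (C : Category) (a b d : C) (P : Coproduct a b) :
  Proper (@eqh C a d ==> @eqh C b d ==> @eqh C (cp_ob P) d) (@cp_pair C a b P d).
Proof.
  intros u u' Hu v v' Hv. apply (cp_ext (c := P)).
  - now rewrite !cp_pair1.
  - now rewrite !cp_pair2.
Qed.

Definition cp_map (C : Category) (a b a' b' : C)
    (P : Coproduct a a') (Q : Coproduct b b') (f : Hom a b) (f' : Hom a' b') :
    Hom (cp_ob P) (cp_ob Q) :=
  cp_pair P (cp1 Q \o f) (cp2 Q \o f').

Definition cp_iso (C : Category) (a b a' b' : C)
    (P : Coproduct a a') (Q : Coproduct b b') (i : Iso a b) (i' : Iso a' b') :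
  Iso (cp_ob P) (cp_ob Q).
Proof.
  refine {| fwd := cp_map P Q i i'; bwd := cp_map Q P (bwd i) (bwd i') |};
    unfold cp_map.
  - apply (cp_ext (c := Q)); rewrite (comp_idl (category_laws C)),
      <- (comp_assoc (category_laws C)).
    + rewrite cp_pair1, (comp_assoc (category_laws C)), cp_pair1,
        <- (comp_assoc (category_laws C)), (fwd_bwd i).
      apply (comp_idr (category_laws C)).
    + rewrite cp_pair2, (comp_assoc (category_laws C)), cp_pair2,
        <- (comp_assoc (category_laws C)), (fwd_bwd i').
      apply (comp_idr (category_laws C)).
  - apply (cp_ext (c := P)); rewrite (comp_idl (category_laws C)),
      <- (comp_assoc (category_laws C)).
    + rewrite cp_pair1, (comp_assoc (category_laws C)), cp_pair1,
        <- (comp_assoc (category_laws C)), (bwd_fwd i).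
      apply (comp_idr (category_laws C)).
    + rewrite cp_pair2, (comp_assoc (category_laws C)), cp_pair2,
        <- (comp_assoc (category_laws C)), (bwd_fwd i').
      apply (comp_idr (category_laws C)).
Defined.

Section FineRewrite.
Context (A X : Category) (L : Functor A X) (R : Functor X A)
  (adj : Adjunction L R) (ch : Choices A X).

Local Notation "a (+) b" := (cp_ob (cpA ch a b))
  (at level 50, left associativity).
Local Notation "x [+] y" := (cp_ob (cpX ch x y))
  (at level 50, left associativity).

(** ** Vertical arrows *)

Record VSpan (a b : A) := {
  v_ob : A;
  v_up : Iso v_ob a;
  v_dn : Iso v_ob b
}.

(* Composition by pullback is associative and unital only up to isomorphism of
   spans, which is therefore the equality of vertical arrows.  Such an
   isomorphism is unique when it exists, and it is the identity when the two
   spans are literally the same. *)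
Definition vspan_eq (a b : A) (v w : VSpan a b) : Prop :=
  exists s : Iso (v_ob v) (v_ob w), v_up w \o s == v_up v /\ v_dn w \o s == v_dn v.

Definition vspan_id (a : A) : VSpan a a := {| v_up := iso_id a; v_dn := iso_id a |}.

Definition vspan_comp (a b c : A) (w : VSpan b c) (v : VSpan a b) : VSpan a c :=
  let P := pbA ch (v_dn v) (v_up w) in
  {| v_up := iso_comp (v_up v) (pb1_iso P);
     v_dn := iso_comp (v_dn w) (pb2_iso P) |}.

Definition FineC0 : RawCat := {|
  Ob := A;
  Hom := VSpan;
  eqh := vspan_eq;
  idm := vspan_id;
  comp := vspan_comp
|}.

Definition fine_tens0 : TensorData FineC0 := {|
  tob := fun a b : FineC0 => (a : A) (+) b : FineC0;
  thom := fun (a b a' b' : FineC0) (v : VSpan a b) (w : VSpan a' b') =>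
    {| v_up := cp_iso (cpA ch (v_ob v) (v_ob w)) (cpA ch a a') (v_up v) (v_up w);
       v_dn := cp_iso (cpA ch (v_ob v) (v_ob w)) (cpA ch b b') (v_dn v) (v_dn w) |}
    : @Hom FineC0 (_ (+) _) (_ (+) _);
  tunit := in_ob (inA ch) : FineC0
|}.

(** ** Structured cospans *)

Record SCospan (a b : A) := {
  sc_ob : X;
  sc_l : Hom (L a) sc_ob;
  sc_r : Hom (L b) sc_ob
}.

Definition sc_id (a : A) : SCospan a a := {| sc_l := idm (L a); sc_r := idm (L a) |}.

Definition sc_comp (a b c : A) (M : SCospan a b) (N : SCospan b c) : SCospan a c :=
  let P := poX ch (sc_r M) (sc_l N) in
  {| sc_l := po1 P \o sc_l M; sc_r := po2 P \o sc_r N |}.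

(* The copairing out of [L (a + b)], which is a coproduct of [L a] and [L b]
   because [L] is a left adjoint. *)
Definition Lpair (a b : A) (x : X) (f : Hom (L a) x) (g : Hom (L b) x) :
    Hom (L (a (+) b)) x :=
  untransp adj (cp_pair (cpA ch a b) (transp adj f) (transp adj g)).

Definition Lzero (x : X) : Hom (L (in_ob (inA ch))) x :=
  untransp adj (in_map (inA ch) (R x)).

Definition sc_tens (a b a' b' : A) (M : SCospan a b) (N : SCospan a' b') :
    SCospan (a (+) a') (b (+) b') :=
  let P := cpX ch (sc_ob M) (sc_ob N) in
  {| sc_l := Lpair (cp1 P \o sc_l M) (cp2 P \o sc_l N);
     sc_r := Lpair (cp1 P \o sc_r M) (cp2 P \o sc_r N) |}.

(** ** Spans of structured cospans *)

(* The outer columns are the images under [L] of vertical arrows. *)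
Record SpanSC (a b c d : A) (M : SCospan a b) (N : SCospan c d) := {
  s_src : VSpan a c;
  s_tgt : VSpan b d;
  s_mid : SCospan (v_ob s_src) (v_ob s_tgt);
  s_up : Hom (sc_ob s_mid) (sc_ob M);
  s_dn : Hom (sc_ob s_mid) (sc_ob N);
  s_up_l : s_up \o sc_l s_mid == sc_l M \o fmap L (v_up s_src);
  s_up_r : s_up \o sc_r s_mid == sc_r M \o fmap L (v_up s_tgt);
  s_dn_l : s_dn \o sc_l s_mid == sc_l N \o fmap L (v_dn s_src);
  s_dn_r : s_dn \o sc_r s_mid == sc_r N \o fmap L (v_dn s_tgt)
}.
Arguments s_src {_ _ _ _ _ _} _.
Arguments s_tgt {_ _ _ _ _ _} _.
Arguments s_mid {_ _ _ _ _ _} _.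
Arguments s_up {_ _ _ _ _ _} _.
Arguments s_dn {_ _ _ _ _ _} _.

(* Isomorphism of the middle rows over the top and bottom rows; when the outer
   columns of [s] and [t] coincide, [f] and [g] are necessarily identities. *)
Definition spansc_eq (a b c d : A) (M : SCospan a b) (N : SCospan c d)
    (s t : SpanSC M N) : Prop :=
  exists (f : Iso (v_ob (s_src s)) (v_ob (s_src t)))
         (theta : Iso (sc_ob (s_mid s)) (sc_ob (s_mid t)))
         (g : Iso (v_ob (s_tgt s)) (v_ob (s_tgt t))),
    (v_up (s_src t) \o f == v_up (s_src s) /\
     v_dn (s_src t) \o f == v_dn (s_src s)) /\
    (v_up (s_tgt t) \o g == v_up (s_tgt s) /\
     v_dn (s_tgt t) \o g == v_dn (s_tgt s)) /\
    theta \o sc_l (s_mid s) == sc_l (s_mid t) \o fmap L f /\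
    theta \o sc_r (s_mid s) == sc_r (s_mid t) \o fmap L g /\
    s_up t \o theta == s_up s /\
    s_dn t \o theta == s_dn s.

Definition fine (a b c d : A) (M : SCospan a b) (N : SCospan c d)
    (s : SpanSC M N) : Prop :=
  monic (s_up s) /\ monic (s_dn s).

Definition spansc_id (a b : A) (M : SCospan a b) : SpanSC M M.
Proof.
  refine {| s_src := vspan_id a; s_tgt := vspan_id b;
            s_mid := (M : SCospan (v_ob (vspan_id a)) (v_ob (vspan_id b)));
            s_up := idm (sc_ob M); s_dn := idm (sc_ob M) |};
    cbn; now rewrite fmap_id, (comp_idl (category_laws X)),
      (comp_idr (category_laws X)).
Defined.

Lemma paste (x1 x2 x3 y1 y2 y3 : X) (p : Hom x2 x3) (q : Hom x1 x2)
  (k : Hom y1 x1) (l : Hom y2 x2) (m : Hom y3 x3)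
  (i : Hom y1 y2) (j : Hom y2 y3) (ji : Hom y1 y3) :
  q \o k == l \o i -> p \o l == m \o j -> ji == j \o i ->
  (p \o q) \o k == m \o ji.
Proof.
  intros E1 E2 E3.
  rewrite E3, <- (comp_assoc (category_laws X)), E1.
  rewrite !(comp_assoc (category_laws X)). now rewrite E2.
Qed.

Section VerticalComposition.
Context (a b c d e f : A) (M : SCospan a b) (N : SCospan c d) (P : SCospan e f)
  (t : SpanSC N P) (s : SpanSC M N).

Let v := vspan_comp (s_src t) (s_src s).
Let w := vspan_comp (s_tgt t) (s_tgt s).
Let pl := pbA ch (v_dn (s_src s)) (v_up (s_src t)).
Let pr := pbA ch (v_dn (s_tgt s)) (v_up (s_tgt t)).
Let Q := pbX ch (s_dn s) (s_up t).

Lemma spansc_comp_l :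
  s_dn s \o (sc_l (s_mid s) \o fmap L (pb1 pl))
  == s_up t \o (sc_l (s_mid t) \o fmap L (pb2 pl)).
Proof.
  rewrite !(comp_assoc (category_laws X)), s_dn_l, s_up_l.
  rewrite <- !(comp_assoc (category_laws X)), <- !fmap_comp.
  now rewrite (pb_sq pl).
Qed.

Lemma spansc_comp_r :
  s_dn s \o (sc_r (s_mid s) \o fmap L (pb1 pr))
  == s_up t \o (sc_r (s_mid t) \o fmap L (pb2 pr)).
Proof.
  rewrite !(comp_assoc (category_laws X)), s_dn_r, s_up_r.
  rewrite <- !(comp_assoc (category_laws X)), <- !fmap_comp.
  now rewrite (pb_sq pr).
Qed.

(* Pullback of the middle rows over the shared row. *)
Definition spansc_comp : SpanSC M P.
Proof.
  refine {| s_src := v; s_tgt := w;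
            s_mid := {| sc_l := pb_pair Q spansc_comp_l;
                        sc_r := pb_pair Q spansc_comp_r |}
                     : SCospan (v_ob v) (v_ob w);
            s_up := s_up s \o pb1 Q; s_dn := s_dn t \o pb2 Q |}.
  - exact (paste (pb_pair1 Q spansc_comp_l) (s_up_l s) (fmap_comp L _ _)).
  - exact (paste (pb_pair1 Q spansc_comp_r) (s_up_r s) (fmap_comp L _ _)).
  - exact (paste (pb_pair2 Q spansc_comp_l) (s_dn_l t) (fmap_comp L _ _)).
  - exact (paste (pb_pair2 Q spansc_comp_r) (s_dn_r t) (fmap_comp L _ _)).
Defined.

Lemma spansc_comp_fine : fine t -> fine s -> fine spansc_comp.
Proof.
  intros [Ht1 Ht2] [Hs1 Hs2]. split; cbn; apply monic_comp; trivial.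
  - now apply pb1_monic.
  - now apply pb2_monic.
Qed.

End VerticalComposition.

Definition spansc_U (a b : A) (v : VSpan a b) : SpanSC (sc_id a) (sc_id b).
Proof.
  refine {| s_src := v; s_tgt := v; s_mid := sc_id (v_ob v);
            s_up := fmap L (v_up v) : Hom (sc_ob (sc_id (v_ob v))) (sc_ob (sc_id a));
            s_dn := fmap L (v_dn v) : Hom (sc_ob (sc_id (v_ob v))) (sc_ob (sc_id b))
         |}; cbn; now rewrite (comp_idl (category_laws X)),
               (comp_idr (category_laws X)).
Defined.

Lemma fmap_iso_monic (a b : A) (i : Iso a b) : monic (fmap L i).
Proof.
  assert (K : fmap L (bwd i) \o fmap L i == idm (L (a : A))).
  { rewrite <- fmap_comp, <- fmap_id. apply fmap_proper, bwd_fwd. }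
  intros d u v E.
  rewrite <- (comp_idl (category_laws X) u), <- (comp_idl (category_laws X) v).
  rewrite <- K, <- !(comp_assoc (category_laws X)), E. reflexivity.
Qed.

Lemma paste_row (x1 x2 y1 y2 z1 z2 : X) (p : Hom y1 y2) (q : Hom x1 y1)
  (r : Hom x2 y2) (u : Hom x1 x2) (l : Hom z1 x1) (m : Hom z2 x2) (v : Hom z1 z2) :
  p \o q == r \o u -> u \o l == m \o v -> p \o (q \o l) == (r \o m) \o v.
Proof.
  intros E1 E2.
  rewrite (comp_assoc (category_laws X)), E1.
  rewrite <- !(comp_assoc (category_laws X)). now rewrite E2.
Qed.

Section HorizontalComposition.
Context (a b c a' b' c' : A) (M : SCospan a b) (N : SCospan b c)
  (M' : SCospan a' b') (N' : SCospan b' c') (s : SpanSC M M') (t : SpanSC N N')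
  (e : vspan_eq (s_tgt s) (s_src t)).

(* The isomorphism between the two representatives of the shared column. *)
Definition glue : Iso (v_ob (s_tgt s)) (v_ob (s_src t)) :=
  iso_comp (iso_inv (v_up (s_src t))) (v_up (s_tgt s)).

Lemma glue_up : v_up (s_src t) \o glue == v_up (s_tgt s).
Proof.
  cbn. now rewrite (comp_assoc (category_laws A)), fwd_bwd,
    (comp_idl (category_laws A)).
Qed.

Lemma glue_dn : v_dn (s_src t) \o glue == v_dn (s_tgt s).
Proof.
  destruct e as [i [Hu Hd]]. rewrite <- Hd.
  assert (E : glue == i).
  { apply (iso_monic (i := v_up (s_src t))). now rewrite glue_up, Hu. }
  now rewrite E.
Qed.

Definition s_mid_glued : SCospan (v_ob (s_tgt s)) (v_ob (s_tgt t)) :=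
  {| sc_l := sc_l (s_mid t) \o fmap L glue; sc_r := sc_r (s_mid t) |}.

Let P := poX ch (sc_r M) (sc_l N).
Let P' := poX ch (sc_r M') (sc_l N').
Let Q := poX ch (sc_r (s_mid s)) (sc_l s_mid_glued).

Lemma spansc_hcomp_up :
  (po1 P \o s_up s) \o sc_r (s_mid s) == (po2 P \o s_up t) \o sc_l s_mid_glued.
Proof.
  assert (E : s_up t \o sc_l s_mid_glued == sc_l N \o fmap L (v_up (s_tgt s))).
  { cbn. rewrite (comp_assoc (category_laws X)), s_up_l.
    rewrite <- (comp_assoc (category_laws X)), <- fmap_comp.
    now rewrite glue_up. }
  rewrite <- !(comp_assoc (category_laws X)), E, s_up_r.
  rewrite !(comp_assoc (category_laws X)). now rewrite (po_sq P).
Qed.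

Lemma spansc_hcomp_dn :
  (po1 P' \o s_dn s) \o sc_r (s_mid s) == (po2 P' \o s_dn t) \o sc_l s_mid_glued.
Proof.
  assert (E : s_dn t \o sc_l s_mid_glued == sc_l N' \o fmap L (v_dn (s_tgt s))).
  { cbn. rewrite (comp_assoc (category_laws X)), s_dn_l.
    rewrite <- (comp_assoc (category_laws X)), <- fmap_comp.
    now rewrite glue_dn. }
  rewrite <- !(comp_assoc (category_laws X)), E, s_dn_r.
  rewrite !(comp_assoc (category_laws X)). now rewrite (po_sq P').
Qed.

(* Pushout in each row. *)
Definition spansc_hcomp : SpanSC (sc_comp M N) (sc_comp M' N').
Proof.
  refine {| s_src := s_src s; s_tgt := s_tgt t;
            s_mid := sc_comp (s_mid s) s_mid_glued;
            s_up := po_pair Q spansc_hcomp_up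
              : Hom (sc_ob (sc_comp (s_mid s) s_mid_glued)) (sc_ob (sc_comp M N));
            s_dn := po_pair Q spansc_hcomp_dn
              : Hom (sc_ob (sc_comp (s_mid s) s_mid_glued)) (sc_ob (sc_comp M' N'))
         |}.
  - exact (paste_row (po_pair1 Q spansc_hcomp_up) (s_up_l s)).
  - exact (paste_row (po_pair2 Q spansc_hcomp_up) (s_up_r t)).
  - exact (paste_row (po_pair1 Q spansc_hcomp_dn) (s_dn_l s)).
  - exact (paste_row (po_pair2 Q spansc_hcomp_dn) (s_dn_r t)).
Defined.

End HorizontalComposition.

Lemma Lpair1 (a b : A) (x : X) (f : Hom (L a) x) (g : Hom (L b) x) :
  Lpair f g \o fmap L (cp1 (cpA ch a b)) == f.
Proof.
  unfold Lpair. rewrite <- (untransp_transp adj (_ \o _)).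
  etransitivity; [ | apply (untransp_transp adj)]. apply untransp_proper.
  now rewrite transp_natl, transp_untransp, cp_pair1.
Qed.

Lemma Lpair2 (a b : A) (x : X) (f : Hom (L a) x) (g : Hom (L b) x) :
  Lpair f g \o fmap L (cp2 (cpA ch a b)) == g.
Proof.
  unfold Lpair. rewrite <- (untransp_transp adj (_ \o _)).
  etransitivity; [ | apply (untransp_transp adj)]. apply untransp_proper.
  now rewrite transp_natl, transp_untransp, cp_pair2.
Qed.

Lemma Lpair_ext (a b : A) (x : X) (h k : Hom (L (a (+) b)) x) :
  h \o fmap L (cp1 (cpA ch a b)) == k \o fmap L (cp1 (cpA ch a b)) ->
  h \o fmap L (cp2 (cpA ch a b)) == k \o fmap L (cp2 (cpA ch a b)) ->
  h == k.
Proof.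
  intros E1 E2.
  rewrite <- (untransp_transp adj h), <- (untransp_transp adj k).
  apply untransp_proper, (cp_ext (c := cpA ch a b));
    rewrite <- !transp_natl; now apply transp_proper.
Qed.

Lemma Lpair_map (a b a' b' : A) (x y x' y' : X)
  (m : Hom x y) (m' : Hom x' y') (i : Hom a b) (i' : Hom a' b')
  (f : Hom (L a) x) (f' : Hom (L a') x') (g : Hom (L b) y) (g' : Hom (L b') y') :
  m \o f == g \o fmap L i -> m' \o f' == g' \o fmap L i' ->
  cp_map (cpX ch x x') (cpX ch y y') m m'
    \o Lpair (cp1 (cpX ch x x') \o f) (cp2 (cpX ch x x') \o f')
  == Lpair (cp1 (cpX ch y y') \o g) (cp2 (cpX ch y y') \o g')
    \o fmap L (cp_map (cpA ch a a') (cpA ch b b') i i').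
Proof.
  intros E E'. apply Lpair_ext; rewrite <- !(comp_assoc (category_laws X));
    rewrite ?Lpair1, ?Lpair2, <- !fmap_comp; unfold cp_map.
  - rewrite cp_pair1, fmap_comp, !(comp_assoc (category_laws X)), cp_pair1, Lpair1.
    now rewrite <- !(comp_assoc (category_laws X)), E.
  - rewrite cp_pair2, fmap_comp, !(comp_assoc (category_laws X)), cp_pair2, Lpair2.
    now rewrite <- !(comp_assoc (category_laws X)), E'.
Qed.

(* Coproduct in each row. *)
Definition spansc_tens (a b c d a' b' c' d' : A)
    (M : SCospan a b) (N : SCospan c d) (M' : SCospan a' b') (N' : SCospan c' d')
    (s : SpanSC M N) (s' : SpanSC M' N') :
  SpanSC (sc_tens M M') (sc_tens N N').
Proof.
  refine (let m := sc_tens (s_mid s) (s_mid s') in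
    {| s_src := thom fine_tens0 (s_src s : @Hom FineC0 a c) (s_src s');
       s_tgt := thom fine_tens0 (s_tgt s : @Hom FineC0 b d) (s_tgt s');
       s_mid := m;
       s_up := cp_map (cpX ch _ _) (cpX ch _ _) (s_up s) (s_up s')
         : Hom (sc_ob m) (sc_ob (sc_tens M M'));
       s_dn := cp_map (cpX ch _ _) (cpX ch _ _) (s_dn s) (s_dn s')
         : Hom (sc_ob m) (sc_ob (sc_tens N N')) |});
    cbn; apply Lpair_map;
    first [apply s_up_l | apply s_up_r | apply s_dn_l | apply s_dn_r].
Defined.

(** ** The double category of fine rewrites *)

Definition hcomp_preserves_fine : Prop :=
  forall (a b c a' b' c' : A) (M : SCospan a b) (N : SCospan b c)
    (M' : SCospan a' b') (N' : SCospan b' c') (s : SpanSC M M') (t : SpanSC N N')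
    (e : vspan_eq (s_tgt s) (s_src t)),
    fine s -> fine t -> fine (spansc_hcomp e).

Definition tens_preserves_fine : Prop :=
  forall (a b c d a' b' c' d' : A)
    (M : SCospan a b) (N : SCospan c d) (M' : SCospan a' b') (N' : SCospan c' d')
    (s : SpanSC M N) (s' : SpanSC M' N'),
    fine s -> fine s' -> fine (spansc_tens s s').

Record FineSq (a b c d : A) (M : SCospan a b) (N : SCospan c d) := {
  fs_span :> SpanSC M N;
  fs_fine : fine fs_span
}.

Lemma spansc_id_fine (a b : A) (M : SCospan a b) : fine (spansc_id M).
Proof. split; exact (iso_monic (i := iso_id (sc_ob M))). Qed.

Lemma spansc_U_fine (a b : A) (v : VSpan a b) : fine (spansc_U v).
Proof. split; apply fmap_iso_monic. Qed.

(* The data of the double category make sense only once fine rewrites are known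
   to be closed under the operations on spans of structured cospans. *)
Definition FineRewrite (Hh : hcomp_preserves_fine) : DoubleData := {|
  C0 := FineC0;
  H := SCospan;
  Sq := FineSq;
  sqeq := fun a b c d M N (s t : FineSq M N) => spansc_eq s t;
  src := fun a b c d M N (s : FineSq M N) => s_src s;
  tgt := fun a b c d M N (s : FineSq M N) => s_tgt s;
  sqid := fun a b M => {| fs_fine := spansc_id_fine M |};
  sqcomp := fun a b c d e f M N P (t : FineSq N P) (s : FineSq M N) =>
    {| fs_fine := spansc_comp_fine (fs_fine t) (fs_fine s) |};
  hU := sc_id;
  sqU := fun a b v => {| fs_fine := spansc_U_fine v |};
  hcomp := sc_comp;
  hsq := fun a b c a' b' c' M N M' N' (s : FineSq M M') (t : FineSq N N')
      (e : vspan_eq (s_tgt s) (s_src t)) =>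
    {| fs_fine := Hh _ _ _ _ _ _ _ _ _ _ _ _ e (fs_fine s) (fs_fine t) |}
|}.

Definition FineTensor (Hh : hcomp_preserves_fine) (Ht : tens_preserves_fine) :
    DoubleTensor (FineRewrite Hh) :=
  @Build_DoubleTensor (FineRewrite Hh) fine_tens0 sc_tens
    (fun a b c d a' b' c' d' M N M' N' (s : FineSq M N) (s' : FineSq M' N') =>
       {| fs_fine := Ht _ _ _ _ _ _ _ _ _ _ _ _ _ _ (fs_fine s) (fs_fine s') |}).

(** ** Canonical constraints *)

(* The span [v] is isomorphic to [a <- a -> b] with legs [id] and [f]. *)
Definition v_is (a b : A) (v : VSpan a b) (f : Hom a b) : Prop :=
  v_dn v == f \o v_up v.

(* The span of structured cospans [s] is isomorphic to the one whose middle row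
   is [M], with upper arrows [id] and lower arrows [L f], [phi], [L g]. *)
Definition sq_is (a b c d : A) (M : SCospan a b) (N : SCospan c d)
    (s : SpanSC M N) (f : Hom a c) (phi : Hom (sc_ob M) (sc_ob N)) (g : Hom b d)
    : Prop :=
  v_is (s_src s) f /\ v_is (s_tgt s) g /\
  is_iso (s_up s) /\ s_dn s == phi \o s_up s.

Definition cpA_assoc (a b c : A) : Hom (a (+) b (+) c) (a (+) (b (+) c)) :=
  cp_pair _ (cp_pair _ (cp1 _) (cp2 _ \o cp1 _)) (cp2 _ \o cp2 _).
Definition cpA_lun (a : A) : Hom (in_ob (inA ch) (+) a) a :=
  cp_pair _ (in_map _ a) (idm a).
Definition cpA_run (a : A) : Hom (a (+) in_ob (inA ch)) a :=
  cp_pair _ (idm a) (in_map _ a).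
Definition cpA_braid (a b : A) : Hom (a (+) b) (b (+) a) :=
  cp_pair _ (cp2 _) (cp1 _).

Definition cpX_assoc (x y z : X) : Hom (x [+] y [+] z) (x [+] (y [+] z)) :=
  cp_pair _ (cp_pair _ (cp1 _) (cp2 _ \o cp1 _)) (cp2 _ \o cp2 _).
Definition cpX_lun (x : X) : Hom (L (in_ob (inA ch)) [+] x) x :=
  cp_pair _ (Lzero x) (idm x).
Definition cpX_run (x : X) : Hom (x [+] L (in_ob (inA ch))) x :=
  cp_pair _ (idm x) (Lzero x).
Definition cpX_braid (x y : X) : Hom (x [+] y) (y [+] x) :=
  cp_pair _ (cp2 _) (cp1 _).

(* All constraint isomorphisms are the canonical ones given by the universal
   properties of coproducts and pushouts. *)
Record canonical_constraints (Hh : hcomp_preserves_fine) (Ht : tens_preserves_fine)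
    (S : SymMonDoubleCategory (FineTensor Hh Ht)) : Prop := {
  can_assoc0 : forall a b c : A,
    v_is (fwd (massoc (symmon0 S) a b c)) (cpA_assoc a b c);
  can_lun0 : forall a : A, v_is (fwd (mlun (symmon0 S) a)) (cpA_lun a);
  can_run0 : forall a : A, v_is (fwd (mrun (symmon0 S) a)) (cpA_run a);
  can_braid0 : forall a b : A,
    v_is (fwd (mbraid (symmon0 S) a b)) (cpA_braid a b);

  can_assoc1 : forall (a b a' b' a'' b'' : A)
      (M : SCospan a b) (N : SCospan a' b') (P : SCospan a'' b''),
    sq_is (cell (as1 (symmon1 S) M N P)) (cpA_assoc a a' a'')
      (cpX_assoc (sc_ob M) (sc_ob N) (sc_ob P)) (cpA_assoc b b' b'');
  can_lun1 : forall (a b : A) (M : SCospan a b),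
    sq_is (cell (lu1 (symmon1 S) M)) (cpA_lun a) (cpX_lun (sc_ob M)) (cpA_lun b);
  can_run1 : forall (a b : A) (M : SCospan a b),
    sq_is (cell (ru1 (symmon1 S) M)) (cpA_run a) (cpX_run (sc_ob M)) (cpA_run b);
  can_braid1 : forall (a b a' b' : A) (M : SCospan a b) (N : SCospan a' b'),
    sq_is (cell (br1 (symmon1 S) M N)) (cpA_braid a a')
      (cpX_braid (sc_ob M) (sc_ob N)) (cpA_braid b b');

  can_hassoc : forall (a b c d : A)
      (M : SCospan a b) (N : SCospan b c) (P : SCospan c d),
    let MN := poX ch (sc_r M) (sc_l N) in
    let NP := poX ch (sc_r N) (sc_l P) in
    let l := poX ch (sc_r (sc_comp M N)) (sc_l P) in
    let r := poX ch (sc_r M) (sc_l (sc_comp N P)) in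
    exists phi : Hom (po_ob l) (po_ob r),
      phi \o po1 l \o po1 MN == po1 r /\
      phi \o po1 l \o po2 MN == po2 r \o po1 NP /\
      phi \o po2 l == po2 r \o po2 NP /\
      sq_is (cell (hassoc (double_category S) M N P)) (idm a) phi (idm d);
  can_hlun : forall (a b : A) (M : SCospan a b),
    let l := poX ch (sc_r (sc_id a)) (sc_l M) in
    exists phi : Hom (po_ob l) (sc_ob M),
      phi \o po1 l == sc_l M /\ phi \o po2 l == idm (sc_ob M) /\
      sq_is (cell (hlun (double_category S) M)) (idm a) phi (idm b);
  can_hrun : forall (a b : A) (M : SCospan a b),
    let l := poX ch (sc_r M) (sc_l (sc_id b)) in
    exists phi : Hom (po_ob l) (sc_ob M),
      phi \o po1 l == idm (sc_ob M) /\ phi \o po2 l == sc_r M /\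
      sq_is (cell (hrun (double_category S) M)) (idm a) phi (idm b);

  can_chi : forall (a b c a' b' c' : A)
      (M : SCospan a b) (M' : SCospan a' b') (N : SCospan b c) (N' : SCospan b' c'),
    let l := poX ch (sc_r (sc_tens M M')) (sc_l (sc_tens N N')) in
    let p := poX ch (sc_r M) (sc_l N) in
    let p' := poX ch (sc_r M') (sc_l N') in
    let r := cpX ch (po_ob p) (po_ob p') in
    exists phi : Hom (po_ob l) (cp_ob r),
      phi \o po1 l \o cp1 _ == cp1 r \o po1 p /\
      phi \o po1 l \o cp2 _ == cp2 r \o po1 p' /\
      phi \o po2 l \o cp1 _ == cp1 r \o po2 p /\
      phi \o po2 l \o cp2 _ == cp2 r \o po2 p' /\
      sq_is (cell (ichi (interchange S) M M' N N'))
        (idm (a (+) a')) phi (idm (c (+) c'));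
  can_mu : forall a b : A,
    sq_is (cell (imu (interchange S) a b)) (idm (a (+) b))
      (Lpair (cp1 (cpX ch (L a) (L b))) (cp2 (cpX ch (L a) (L b))))
      (idm (a (+) b))
}.

End FineRewrite.

(* Main.v *)
Require Import Defs.
From Stdlib Require Import Setoid Morphisms IndefiniteDescription.

(** A category of spans with cospans composed by pushout and spans composed by
    pullback has an exchange law only if pushouts commute with the pullbacks that
    occur.  In a topos they do, because all the arrows in the direction of the
    pullbacks are monic, and pushouts behave well with respect to subobjects.

    The finite colimits.  A power object [P b] is an exponential of the subobject
    classifier, and a point of [b] is determined by its evaluation in [P (P b)].
    A pushout of [a] and [b] over [c] is carved out of [P B], where [B] is the
    object of the pairs of subsets of [a] and [b] with the same inverse image in
    [c]: it is the smallest subobject that contains the evaluations at the points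
    of [a] and of [b] ([pushout_exists]; [initial_exists] is similar).

    Pushouts and monomorphisms.  With values in a power object, a partial arrow
    becomes total, the undefined values being the empty subset.  Hence a pushout of
    a monomorphism is monic and its square is a pullback ([pushout_of_monic]), and a
    subobject of a pushout that contains the glued part is itself the pushout of its
    inverse images ([pushout_restrict]).  Two consequences carry the theorem.  A map
    of pushouts over the same object, monic on both parts, is monic
    ([pushout_map_monic]), so that fine rewrites are closed under horizontal
    composition and, coproducts being pushouts over the initial object, under the
    tensor product.  And the intersection of two such pushouts is the pushout of the
    intersections ([pushout_intersection]), which is the exchange law between
    vertical pullbacks and horizontal pushouts or tensor products
    ([exchange_pushout], [fine_hsq_comp], [fine_sqtens_comp]).

    The double category.  A span of isomorphisms amounts to an isomorphism
    ([vspan_eq_vmap]).  A fine rewrite is an internal relation between the apexes of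
    its outer cospans, and its isomorphism class is determined by its boundary and by
    the pairs of generalized elements that it relates ([spansc_eq_related]); vertical
    composition is the composition of relations ([related_comp]).  The squares with
    invertible upper arrow are the graphs of arrows, are closed under all
    compositions, and are equal when the arrows are ([sq_graph_eq]).  The constraint
    squares are graphs of comparison isomorphisms between iterated pushouts and
    coproducts, where [L], as a left adjoint, preserves coproducts; each coherence
    diagram is therefore an equation between two arrows out of an iterated colimit,
    checked on the inclusions of its constituents.  Naturality of the constraints with
    respect to arbitrary fine rewrites follows from an isomorphism between the middle
    rows ([sq_natural]), which is again a comparison of iterated colimits. *)

Set Implicit Arguments.
Unset Strict Implicit.
Unset Printing Implicit Defensive.

(** * Rewriting in a category *)

Lemma compA (C : Category) (a b c d : C) (h : Hom c d) (g : Hom b c) (f : Hom a b) :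
  h \o g \o f == h \o (g \o f).
Proof. symmetry. apply (comp_assoc (category_laws C)). Qed.

Lemma comp1f (C : Category) (a b : C) (f : Hom a b) : idm b \o f == f.
Proof. apply (comp_idl (category_laws C)). Qed.

Lemma compf1 (C : Category) (a b : C) (f : Hom a b) : f \o idm a == f.
Proof. apply (comp_idr (category_laws C)). Qed.

(** The form in which an equation between composites applies inside a longer
    composite bracketed to the right. *)
Lemma precomp (C : Category) (a b c : C) (g : Hom b c) (f : Hom a b) (h : Hom a c) :
  g \o f == h -> forall (d : C) (k : Hom d a), g \o (f \o k) == h \o k.
Proof. intros E d k. now rewrite <- compA, E. Qed.

Lemma precomp2 (C : Category) (a b b' c : C) (g : Hom b c) (f : Hom a b)
  (g' : Hom b' c) (f' : Hom a b') :
  g \o f == g' \o f' ->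
  forall (d : C) (k : Hom d a), g \o (f \o k) == g' \o (f' \o k).
Proof. intros E d k. now rewrite <- !compA, E. Qed.

Lemma precomp3 (C : Category) (a b c d : C) (h : Hom c d) (g : Hom b c) (f : Hom a b)
  (m : Hom a d) :
  h \o (g \o f) == m -> forall (e : C) (k : Hom e a), h \o (g \o (f \o k)) == m \o k.
Proof. intros E e k. now rewrite <- E, !compA. Qed.

(** * Pullbacks from finite limits *)

Section Thin.
Context (T : Type) (le : T -> T -> bool) (le_refl : forall i, le i i = true)
  (le_trans : forall i j k, le j k = true -> le i j = true -> le i k = true).

Definition thin_raw : RawCat := {|
  Ob := T; Hom := fun i j => le i j = true; eqh := fun _ _ _ _ => True;
  idm := le_refl; comp := fun i j k g f => @le_trans i j k g f |}.

Definition thin : Category.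
Proof.
  refine {| rawcat := thin_raw |}. split; try (intros; exact I).
  intros a b. split; intro; intros; exact I.
Defined.

Lemma thin_finite (l : list T) : (forall i, List.In i l) -> is_finite thin.
Proof.
  intros Hl. split; [now exists l|]. cbn. intros i j.
  destruct (le i j) eqn:E.
  - exists (cons eq_refl nil). intros f. now constructor.
  - exists nil. intros f. discriminate.
Qed.
End Thin.

Definition chosen (T : Type) (P : T -> Prop) (H : exists x, P x) : T :=
  proj1_sig (constructive_indefinite_description P H).

Lemma chosen_spec (T : Type) (P : T -> Prop) (H : exists x, P x) : P (chosen H).
Proof. exact (proj2_sig (constructive_indefinite_description P H)). Qed.

Definition the (T : Type) (H : inhabited T) : T :=
  chosen (P := fun _ : T => True) (match H with inhabits x => ex_intro _ x I end).

Section FiniteLimits.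
Context (C : Category) (HC : has_finite_limits C).

(** The order on [option bool] in which [None] is the top and [Some true] and
    [Some false] are incomparable: a functor on it is a cospan, and a cone over
    that functor a commuting square. *)
Definition cospan_le (i j : option bool) : bool :=
  match i, j with
  | _, None => true
  | Some b, Some b' => Bool.eqb b b'
  | None, Some _ => false
  end.

Lemma cospan_refl i : cospan_le i i = true.
Proof. now destruct i as [[]|]. Qed.

Lemma cospan_trans i j k :
  cospan_le j k = true -> cospan_le i j = true -> cospan_le i k = true.
Proof. now destruct i as [[]|], j as [[]|], k as [[]|]. Qed.

Section PullbackExists.
Context (a b c : C) (f : Hom a c) (g : Hom b c).
Let J := thin cospan_refl cospan_trans.

Let ob (i : J) : C :=
  match (i : option bool) with Some true => a | Some false => b | None => c end.

Let mp (i j : J) : Hom i j -> Hom (ob i) (ob j) :=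
  match i as i, j as j return (cospan_le i j = true -> Hom (ob i) (ob j)) with
  | Some true, None => fun _ => f
  | Some false, None => fun _ => g
  | None, None => fun _ => idm c
  | Some true, Some true => fun _ => idm a
  | Some false, Some false => fun _ => idm b
  | Some true, Some false => fun e => False_rect _ (Bool.diff_false_true e)
  | Some false, Some true => fun e => False_rect _ (Bool.diff_false_true e)
  | None, Some _ => fun e => False_rect _ (Bool.diff_false_true e)
  end.

Definition cospan_functor : Functor J C.
Proof.
  refine {| fob := ob; fmap := mp |}.
  - intros [[]|] [[]|] p q _; try discriminate p; reflexivity.
  - intros [[]|]; reflexivity.
  - intros [[]|] [[]|] [[]|] p q; try discriminate p; try discriminate q; cbn;
      now rewrite ?comp1f, ?compf1.
Defined.

Definition cospan_cone (d : C) (u : Hom d a) (v : Hom d b) (e : f \o u == g \o v) :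
  Cone cospan_functor.
Proof.
  refine (@Build_Cone J C cospan_functor d (fun i : J =>
    match i as i return Hom d (ob i) with
    | Some true => u | Some false => v | None => f \o u end) _).
  intros [[]|] [[]|] p; try discriminate p; cbn; rewrite ?comp1f; try reflexivity.
  now symmetry.
Defined.

Lemma pullback_exists : inhabited (Pullback f g).
Proof.
  assert (Fin : is_finite J).
  { apply thin_finite with (l := cons (Some true) (cons (Some false) (cons None nil))).
    intros [[]|]; cbn; tauto. }
  destruct (HC Fin cospan_functor) as [K HK].
  pose (la := leg K (Some true : J) : Hom (apex K) a).
  pose (lb := leg K (Some false : J) : Hom (apex K) b).
  pose (lc := leg K (None : J) : Hom (apex K) c).
  assert (E1 : f \o la == lc).
  { exact (leg_natural K (i := Some true : J) (j := None : J) eq_refl). }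
  assert (E2 : g \o lb == lc).
  { exact (leg_natural K (i := Some false : J) (j := None : J) eq_refl). }
  assert (P : forall d u v (e : f \o u == g \o v),
    {w : Hom d (apex K) | la \o w == u /\ lb \o w == v}).
  { intros d u v e. apply constructive_indefinite_description.
    destruct (HK (cospan_cone e)) as [w [Hw _]]. exists w.
    split; [exact (Hw (Some true))|exact (Hw (Some false))]. }
  constructor.
  unshelve refine {| pb_ob := apex K; pb1 := la; pb2 := lb;
    pb_pair := fun d u v e => proj1_sig (P d u v e) |}.
  - now rewrite E1, E2.
  - intros. apply (proj2_sig (P d u v e)).
  - intros. apply (proj2_sig (P d u v e)).
  - intros d w w' H1 H2.
    assert (e : f \o (la \o w') == g \o (lb \o w')).
    { now rewrite <- !compA, E1, E2. }
    destruct (HK (cospan_cone e)) as [w0 [_ Hw]].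
    assert (G : forall v, la \o v == la \o w' ->
      lb \o v == lb \o w' -> v == w0).
    { intros v F1 F2. apply Hw. intros [[]|]; cbn; trivial.
      change (lc \o v == f \o (la \o w')).
      rewrite <- E1, compA. now rewrite F1. }
    rewrite (G w H1 H2). symmetry. now apply G.
Qed.
End PullbackExists.
End FiniteLimits.

(** * Power objects *)

Definition jointly_monic (C : Category) (a b r : C) (m1 : Hom r a) (m2 : Hom r b)
    : Prop :=
  forall (d : C) (u v : Hom d r), m1 \o u == m1 \o v -> m2 \o u == m2 \o v -> u == v.

Definition factors (C : Category) (a d r : C) (m : Hom r a) (k : Hom d a) : Prop :=
  exists w : Hom d r, m \o w == k.

Definition rel_of (C : Category) (a b r d : C) (m1 : Hom r a) (m2 : Hom r b)
    (k : Hom d a) (x : Hom d b) : Prop :=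
  exists w : Hom d r, m1 \o w == k /\ m2 \o w == x.

(** A generic relation [el] from [pw] to [b]: a subobject of [pw * b] that does
    not mention the product, so that membership of a generalized element is the
    existence of an arrow into [el]. *)
Record Power (C : Category) (b : C) := {
  pw : C;
  pw_el : C;
  pw_fst : Hom pw_el pw;
  pw_snd : Hom pw_el b;
  pw_joint : jointly_monic pw_fst pw_snd;
  pw_name : forall (u r : C) (m1 : Hom r u) (m2 : Hom r b),
    jointly_monic m1 m2 -> Hom u pw;
  pw_name_in : forall (u r : C) (m1 : Hom r u) (m2 : Hom r b)
      (j : jointly_monic m1 m2) (d : C) (k : Hom d u) (x : Hom d b),
    rel_of pw_fst pw_snd (pw_name j \o k) x <-> rel_of m1 m2 k x;
  pw_ext : forall (u : C) (S S' : Hom u pw),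
    (forall (d : C) (k : Hom d u) (x : Hom d b),
      rel_of pw_fst pw_snd (S \o k) x <-> rel_of pw_fst pw_snd (S' \o k) x) ->
    S == S'
}.

#[export] Instance rel_of_Proper (C : Category) (a b r d : C) (m1 : Hom r a)
    (m2 : Hom r b) :
  Proper (@eqh C d a ==> @eqh C d b ==> iff) (@rel_of C a b r d m1 m2).
Proof.
  intros k k' Hk x x' Hx. split; intros [w [E1 E2]]; exists w; split;
    [rewrite E1|rewrite E2|rewrite E1|rewrite E2]; easy.
Qed.

#[export] Instance factors_Proper (C : Category) (a d r : C) (m : Hom r a) :
  Proper (@eqh C d a ==> iff) (@factors C a d r m).
Proof.
  intros k k' Hk. split; intros [w E]; exists w; rewrite E; easy.
Qed.

Section PowerObjects.
Context (C : Category) (pb : forall (a b c : C) (f : Hom a c) (g : Hom b c), Pullback f g)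
  (one : C) (Hone : is_terminal one).

Lemma to_one_eq (a : C) (f g : Hom a one) : f == g.
Proof. destruct (Hone a) as [w [_ Hw]]. now rewrite (Hw f I), (Hw g I). Qed.

Lemma bang_exists (a : C) : inhabited (Hom a one).
Proof. destruct (Hone a) as [w _]. now constructor. Qed.

Definition bang (a : C) : Hom a one := the (bang_exists a).

Definition prd (a b : C) : Pullback (bang a) (bang b) := pb (bang a) (bang b).

Definition pair (a b d : C) (u : Hom d a) (v : Hom d b) : Hom d (pb_ob (prd a b)) :=
  pb_pair (prd a b) (to_one_eq (bang a \o u) (bang b \o v)).

Lemma pair1 (a b d : C) (u : Hom d a) (v : Hom d b) : pb1 (prd a b) \o pair u v == u.
Proof. apply pb_pair1. Qed.

Lemma pair2 (a b d : C) (u : Hom d a) (v : Hom d b) : pb2 (prd a b) \o pair u v == v.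
Proof. apply pb_pair2. Qed.

Lemma prd_is_product (a b : C) : is_product (pb1 (prd a b)) (pb2 (prd a b)).
Proof.
  intros d u v. exists (pair u v). split.
  - split; [apply pb_pair1|apply pb_pair2].
  - intros w [E1 E2]. apply (pb_ext (p := prd a b)).
    + rewrite E1. symmetry. apply pb_pair1.
    + rewrite E2. symmetry. apply pb_pair2.
Qed.

Section FromClassifier.
Context (HCC : cartesian_closed C) (Omega : C) (tr : Hom one Omega)
  (Hcl : forall (u x : C) (m : Hom u x), monic m ->
      ex_unique (fun chi : Hom x Omega =>
        exists bang : Hom u one, is_pullback chi tr m bang)).

Lemma pullback_universal (a b c : C) (f : Hom a c) (g : Hom b c) (P : Pullback f g) :
  is_pullback f g (pb1 P) (pb2 P).
Proof.
  split; [apply pb_sq|]. intros d u v e. exists (pb_pair P e). split.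
  - split; [apply pb_pair1|apply pb_pair2].
  - intros w [E1 E2]. apply (pb_ext (p := P)).
    + now rewrite E1, pb_pair1.
    + now rewrite E2, pb_pair2.
Qed.

Lemma true_monic : monic tr.
Proof. intros d u v _. apply to_one_eq. Qed.

(** Both arrows classify the subobject [P] of the elements that [f] sends to
    [tr], so the uniqueness of classifying maps identifies them. *)
Lemma omega_ext (x : C) (f g : Hom x Omega) :
  (forall (d : C) (k : Hom d x), factors tr (f \o k) <-> factors tr (g \o k)) ->
  f == g.
Proof.
  intros Hfg. pose (P := pb f tr).
  assert (Hm : monic (pb1 P)) by apply (pb1_monic true_monic).
  destruct (Hcl Hm) as [chi [_ Hchi]].
  rewrite (Hchi f), (Hchi g); [reflexivity| |].
  - assert (F : factors tr (g \o pb1 P)).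
    { apply Hfg. exists (pb2 P). symmetry. apply pb_sq. }
    destruct F as [w Hw]. exists w. split; [now symmetry|].
    intros d u v e. assert (e' : factors tr (f \o u)).
    { apply Hfg. exists v. now symmetry. }
    destruct e' as [v' Hv']. symmetry in Hv'.
    exists (pb_pair P Hv'). split.
    + split; [apply pb_pair1|apply to_one_eq].
    + intros w' [E1 _]. apply Hm. now rewrite E1, pb_pair1.
  - exists (pb2 P). apply pullback_universal.
Qed.

(** The exponential [e] of [Omega] by [b]: [el] is the subobject of [e * b]
    on which evaluation is [tr], and the name of a relation is the transpose of
    its classifying map.  Extensionality is that of [Omega], transposed. *)
Lemma power_exists (b : C) : inhabited (Power b).
Proof.
  destruct (HCC b Omega) as (e & q & q1 & q2 & ev & Hq & Hcur).
  pose (E := pb ev tr).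
  assert (Qext : forall d (u v : Hom d q), q1 \o u == q1 \o v -> q2 \o u == q2 \o v -> u == v).
  { intros d u v E1 E2. destruct (Hq d (q1 \o v) (q2 \o v)) as [w [_ Hw]].
    rewrite (Hw u), (Hw v); easy. }
  assert (Hin : forall d (h : Hom d q),
    rel_of (q1 \o pb1 E) (q2 \o pb1 E) (q1 \o h) (q2 \o h) <-> factors tr (ev \o h)).
  { intros d h. split.
    - intros [w [E1 E2]]. exists (pb2 E \o w).
      assert (Eh : pb1 E \o w == h) by (apply Qext; now rewrite <- compA).
      rewrite <- Eh, <- !compA. now rewrite (pb_sq E).
    - intros [w Hw]. symmetry in Hw. exists (pb_pair E Hw).
      now rewrite !compA, pb_pair1. }
  assert (Hjm : jointly_monic (q1 \o pb1 E) (q2 \o pb1 E)).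
  { intros d u v E1 E2. rewrite !compA in E1, E2.
    apply (pb1_monic true_monic (P := E)). now apply Qext. }
  assert (Name : forall u r (m1 : Hom r u) (m2 : Hom r b), jointly_monic m1 m2 ->
    {S : Hom u e | forall d (k : Hom d u) (x : Hom d b),
      rel_of (q1 \o pb1 E) (q2 \o pb1 E) (S \o k) x <-> rel_of m1 m2 k x}).
  { intros u r m1 m2 Hm. apply constructive_indefinite_description.
    assert (Hmm : monic (pair m1 m2)).
    { intros d v w Ev. apply Hm.
      - rewrite <- (pair1 m1 m2), !compA. now rewrite Ev.
      - rewrite <- (pair2 m1 m2), !compA. now rewrite Ev. }
    destruct (Hcl Hmm) as [chi [[bg [Hsq Hpb]] _]].
    destruct (Hcur u _ _ _ chi (prd_is_product (a := u) (b := b))) as [S [[h (H1 & H2 & H3)] _]].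
    exists S. intros d k x.
    assert (E1 : S \o k == q1 \o (h \o pair k x)).
    { now rewrite <- compA, H1, compA, pair1. }
    assert (E2 : x == q2 \o (h \o pair k x)).
    { now rewrite <- compA, H2, pair2. }
    rewrite E1. etransitivity.
    { apply rel_of_Proper; [reflexivity|exact E2]. }
    rewrite Hin, <- compA, H3. split.
    - intros [w Hw]. symmetry in Hw. destruct (Hpb _ _ _ Hw) as [z [[Hz _] _]].
      exists z. split.
      + rewrite <- (pair1 m1 m2), compA, Hz. apply pair1.
      + rewrite <- (pair2 m1 m2), compA, Hz. apply pair2.
    - intros [w [W1 W2]]. exists (bg \o w).
      assert (Ew : pair m1 m2 \o w == pair k x).
      { apply (pb_ext (p := prd u b)); rewrite <- compA.
        - now rewrite !pair1.
        - now rewrite !pair2. }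
      now rewrite <- Ew, <- !compA, Hsq. }
  constructor.
  refine {| pw_joint := Hjm;
    pw_name := fun u r m1 m2 j => proj1_sig (Name u r m1 m2 j);
    pw_name_in := fun u r m1 m2 j => proj2_sig (Name u r m1 m2 j) |}.
  intros u S S' HS.
  assert (Unc : forall T : Hom u e, exists h : Hom (pb_ob (prd u b)) q,
    q1 \o h == T \o pb1 (prd u b) /\ q2 \o h == pb2 (prd u b)).
  { intros T. destruct (Hq _ (T \o pb1 (prd u b)) (pb2 (prd u b))) as [h [Hh _]].
    now exists h. }
  destruct (Unc S) as (h & H1 & H2), (Unc S') as (h' & H1' & H2').
  destruct (Hcur u _ _ _ (ev \o h) (prd_is_product (a := u) (b := b))) as [T [_ HT]].
  rewrite (HT S), (HT S'); [reflexivity| |now exists h].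
  exists h'. repeat split; trivial.
  apply omega_ext. intros d k. rewrite !compA, <- !Hin, <- !compA, H1, H2, H1', H2'.
  rewrite !compA. symmetry. apply HS.
Qed.
End FromClassifier.
End PowerObjects.

Section ToposStructure.
Context (C : Category) (HC : is_topos C).

Definition topos_pullback (a b c : C) (f : Hom a c) (g : Hom b c) : Pullback f g :=
  the (pullback_exists (proj1 HC) f g).

Lemma topos_power_objects :
  exists one : C, is_terminal one /\ forall b : C, inhabited (Power b).
Proof.
  destruct HC as (_ & HCC & one & Omega & tr & Hone & Hcl).
  exists one. split; [exact Hone|]. intros b.
  exact (power_exists topos_pullback Hone HCC Hcl b).
Qed.

Definition topos_one : C := chosen topos_power_objects.

Lemma topos_one_terminal : is_terminal topos_one.
Proof. exact (proj1 (chosen_spec topos_power_objects)). Qed.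

Definition topos_power (b : C) : Power b :=
  the (proj2 (chosen_spec topos_power_objects) b).
End ToposStructure.

(** * Pushouts *)

Definition is_pushout (C : Category) (a b c p : C) (f : Hom c a) (g : Hom c b)
    (p1 : Hom a p) (p2 : Hom b p) : Prop :=
  p1 \o f == p2 \o g /\
  forall (d : C) (u : Hom a d) (v : Hom b d), u \o f == v \o g ->
    ex_unique (fun w : Hom p d => w \o p1 == u /\ w \o p2 == v).

Section Pushouts.
Context (C : Category) (a b c p : C) (f : Hom c a) (g : Hom c b)
  (p1 : Hom a p) (p2 : Hom b p).

Lemma Pushout_is_pushout (P : Pushout f g) : is_pushout f g (po1 P) (po2 P).
Proof.
  split; [apply po_sq|]. intros d u v e. exists (po_pair P e). split.
  - split; [apply po_pair1|apply po_pair2].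
  - intros w [E1 E2]. apply (po_ext (p := P)).
    + now rewrite E1, po_pair1.
    + now rewrite E2, po_pair2.
Qed.

Lemma is_pushout_sym : is_pushout f g p1 p2 -> is_pushout g f p2 p1.
Proof.
  intros [E H]. split; [now symmetry|]. intros d u v e.
  symmetry in e. destruct (H d v u e) as [w [[W1 W2] U]]. exists w.
  split; [easy|]. intros w' [W1' W2']. now apply U.
Qed.

Lemma is_pushout_ext (H : is_pushout f g p1 p2) (d : C) (w w' : Hom p d) :
  w \o p1 == w' \o p1 -> w \o p2 == w' \o p2 -> w == w'.
Proof.
  intros E1 E2. destruct H as [E H].
  assert (e : (w' \o p1) \o f == (w' \o p2) \o g) by now rewrite !compA, E.
  destruct (H _ _ _ e) as [w0 [_ U]]. now rewrite (U w), (U w').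
Qed.
End Pushouts.

(** * Power objects and colimits in a topos *)

Section Topos.
Context (C : Category) (HC : is_topos C).

Local Notation pb := (topos_pullback HC).
Local Notation one := (topos_one HC).
Local Notation Hone := (topos_one_terminal HC).
Local Notation pwr := (topos_power HC).
Local Notation Pw b := (pw (pwr b)).

Definition inP (b d : C) (x : Hom d b) (S : Hom d (Pw b)) : Prop :=
  rel_of (pw_fst (pwr b)) (pw_snd (pwr b)) S x.

#[local] Instance inP_Proper (b d : C) :
  Proper (@eqh C d b ==> @eqh C d (Pw b) ==> iff) (@inP b d).
Proof. intros x x' Hx S S' HS. unfold inP. now rewrite Hx, HS. Qed.

Lemma name_in (b u r : C) (m1 : Hom r u) (m2 : Hom r b) (j : jointly_monic m1 m2)
  (d : C) (k : Hom d u) (x : Hom d b) :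
  inP x (pw_name (pwr b) j \o k) <-> rel_of m1 m2 k x.
Proof. apply pw_name_in. Qed.

Lemma set_ext (b u : C) (S S' : Hom u (Pw b)) :
  (forall (d : C) (k : Hom d u) (x : Hom d b), inP x (S \o k) <-> inP x (S' \o k)) ->
  S == S'.
Proof. apply pw_ext. Qed.

Lemma equalizer_exists (a b : C) (f g : Hom a b) :
  exists (e : C) (m : Hom e a), monic m /\ f \o m == g \o m /\
    forall (d : C) (k : Hom d a), f \o k == g \o k -> factors m k.
Proof.
  pose (P := pb (pair pb Hone f g) (pair pb Hone (idm b) (idm b))).
  assert (E1 : f \o pb1 P == pb2 P).
  { transitivity (pb1 (prd pb Hone b b) \o (pair pb Hone f g \o pb1 P)).
    - now rewrite <- compA, pair1.
    - now rewrite (pb_sq P), <- compA, pair1, comp1f. }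
  assert (E2 : g \o pb1 P == pb2 P).
  { transitivity (pb2 (prd pb Hone b b) \o (pair pb Hone f g \o pb1 P)).
    - now rewrite <- compA, pair2.
    - now rewrite (pb_sq P), <- compA, pair2, comp1f. }
  exists (pb_ob P), (pb1 P). repeat split.
  - apply pb1_monic. intros d u v E.
    rewrite <- (comp1f u), <- (comp1f v), <- (pair1 pb Hone (idm b) (idm b)), !compA.
    now rewrite E.
  - now rewrite E1, E2.
  - intros d k E.
    assert (e : pair pb Hone f g \o k == pair pb Hone (idm b) (idm b) \o (f \o k)).
    { apply (pb_ext (p := prd pb Hone b b)); rewrite <- !compA;
        rewrite ?pair1, ?pair2, ?comp1f; easy. }
    exists (pb_pair P e). apply pb_pair1.
Qed.

(** ** Operations on generalized subsets *)

Lemma flip_joint (w c : C) (f : Hom w (Pw c)) :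
  let Q := pb (pw_fst (pwr c)) f in
  jointly_monic (pw_snd (pwr c) \o pb1 Q) (pb2 Q).
Proof.
  intros Q d u v E1 E2. apply (pb_ext (p := Q)); [|exact E2].
  rewrite !compA in E1. apply (@pw_joint C c (pwr c)); [|exact E1].
  rewrite <- !compA, (pb_sq Q), !compA. now rewrite E2.
Qed.

(** The contravariant power functor is its own adjoint on the right; [flip] is
    the bijection of this adjunction. *)
Definition flip (w c : C) (f : Hom w (Pw c)) : Hom c (Pw w) :=
  pw_name (pwr w) (@flip_joint w c f).

Lemma flip_in (w c : C) (f : Hom w (Pw c)) (d : C) (k : Hom d c) (s : Hom d w) :
  inP s (flip f \o k) <-> inP k (f \o s).
Proof.
  unfold flip. rewrite name_in. set (Q := pb (pw_fst (pwr c)) f). split.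
  - intros [z [E1 E2]]. exists (pb1 Q \o z). split.
    + now rewrite <- E2, <- !compA, (pb_sq Q).
    + now rewrite <- compA.
  - intros [z [E1 E2]]. exists (pb_pair Q E1). split.
    + now rewrite compA, pb_pair1.
    + apply pb_pair2.
Qed.

(** The unit of that adjunction, which sends a point to the family of the subsets
    that contain it. *)
Definition ev (c : C) : Hom c (Pw (Pw c)) := flip (idm (Pw c)).

Lemma ev_in (c d : C) (k : Hom d c) (S : Hom d (Pw c)) : inP S (ev c \o k) <-> inP k S.
Proof. unfold ev. now rewrite flip_in, comp1f. Qed.

Definition preim (a b : C) (f : Hom a b) : Hom (Pw b) (Pw a) := flip (ev b \o f).

Lemma preim_in (a b : C) (f : Hom a b) (d : C) (k : Hom d a) (S : Hom d (Pw b)) :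
  inP k (preim f \o S) <-> inP (f \o k) S.
Proof. unfold preim. now rewrite flip_in, compA, ev_in. Qed.

Lemma sing_joint (c : C) : jointly_monic (idm c) (idm c).
Proof. intros d u v E _. now rewrite !comp1f in E. Qed.

Definition sing (c : C) : Hom c (Pw c) := pw_name (pwr c) (@sing_joint c).

Lemma sing_in (c d : C) (k x : Hom d c) : inP x (sing c \o k) <-> k == x.
Proof.
  unfold sing. rewrite name_in. split.
  - intros [w [E1 E2]]. now rewrite <- E1, <- E2.
  - intros E. exists k. now rewrite !comp1f.
Qed.

Lemma sing_monic (c : C) : monic (sing c).
Proof. intros d u v E. apply sing_in. rewrite E. now apply sing_in. Qed.

(** The singleton of a point is a subset that contains it, and contains no other
    point. *)
Lemma ev_monic (c : C) : monic (ev c).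
Proof.
  intros d u v E. apply sing_in. apply ev_in. rewrite <- E. apply ev_in.
  now apply sing_in.
Qed.

Lemma whole_joint (u a : C) :
  jointly_monic (pb1 (prd pb Hone u a)) (pb2 (prd pb Hone u a)).
Proof. intros d v w. apply pb_ext. Qed.

Definition whole (u a : C) : Hom u (Pw a) := pw_name (pwr a) (@whole_joint u a).

Lemma whole_in (u a d : C) (k : Hom d u) (x : Hom d a) : inP x (whole u a \o k).
Proof.
  unfold whole. rewrite name_in. exists (pair pb Hone k x).
  split; [apply pair1|apply pair2].
Qed.

Lemma partial_joint (a b r : C) (m : Hom r a) (f : Hom r b) :
  monic m -> jointly_monic m f.
Proof. intros Hm d u v E _. now apply Hm. Qed.

(** An arrow [f] defined on the subobject [m] of [a] is a partial arrow from [a]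
    to [b].  Letting its value be the empty subset where it is not defined makes it
    total, with values in the power object. *)
Definition graph_of (a b r : C) (m : Hom r a) (f : Hom r b) (Hm : monic m) :
  Hom a (Pw b) := pw_name (pwr b) (@partial_joint a b r m f Hm).

Lemma graph_of_in (a b r : C) (m : Hom r a) (f : Hom r b) (Hm : monic m)
  (d : C) (k : Hom d a) (x : Hom d b) :
  inP x (graph_of f Hm \o k) <-> rel_of m f k x.
Proof. apply name_in. Qed.

Lemma graph_of_dom (a b r : C) (m : Hom r a) (f : Hom r b) (Hm : monic m) :
  graph_of f Hm \o m == sing b \o f.
Proof.
  apply set_ext. intros d k x. rewrite !compA, graph_of_in, sing_in. split.
  - intros [w [E1 E2]]. apply Hm in E1. now rewrite <- E1.
  - intros E. now exists k.
Qed.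

(** ** Finite colimits *)

(** A point lies in every member of the family [f] if and only if the set of the
    indices of the members that contain it is everything, and this is the equalizer
    of two arrows. *)
Lemma intersection_exists (w c : C) (f : Hom w (Pw c)) :
  exists (s : C) (m : Hom s c), monic m /\
    forall (d : C) (k : Hom d c), factors m k <->
      forall (d' : C) (j : Hom d' d) (i : Hom d' w), inP (k \o j) (f \o i).
Proof.
  destruct (equalizer_exists (flip f) (whole c w)) as (s & m & Hm & E & Hu).
  exists s, m. split; [exact Hm|]. intros d k. split.
  - intros [z Hz] d' j i. apply flip_in. rewrite <- Hz, !compA, (precomp2 E).
    apply whole_in.
  - intros Hk. apply Hu. apply set_ext. intros d' j i. rewrite !compA, flip_in.
    split; intros _; [apply whole_in|apply Hk].
Qed.

Definition name_sub (b n : C) (m : Hom n b) (Hm : monic m) : Hom one (Pw b).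
Proof.
  refine (pw_name (pwr b) (m1 := bang Hone n) (m2 := m) _).
  intros d u v _. apply Hm.
Defined.

Lemma name_sub_in (b n : C) (m : Hom n b) (Hm : monic m) (d : C) (k : Hom d one)
  (x : Hom d b) : inP x (name_sub Hm \o k) <-> factors m x.
Proof.
  unfold name_sub. rewrite name_in. split.
  - intros [w [_ E]]. now exists w.
  - intros [w E]. exists w. split; [apply to_one_eq, Hone|exact E].
Qed.

(** The smallest subobject of a given object is initial: any arrow out of it is
    obtained by intersecting with [ev], and two such arrows agree because their
    equalizer is again a subobject. *)
Lemma initial_exists : inhabited (Initial C).
Proof.
  destruct (intersection_exists (idm (Pw (Pw one)))) as (z & m & Hm & Hz).
  assert (Least : forall (n : C) (k : Hom n (Pw one)), monic k -> factors k m).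
  { intros n k Hk. apply (name_sub_in Hk (bang Hone z)).
    rewrite <- (compf1 m), <- (comp1f (name_sub Hk \o _)).
    apply (Hz z m); exists (idm z); apply compf1. }
  assert (Map : forall d : C, inhabited (Hom z d)).
  { intros d. pose (P := pb (preim (bang Hone (Pw d))) (ev d)).
    destruct (@Least _ (pb1 P)) as [w _].
    - apply pb1_monic, ev_monic.
    - exact (inhabits (pb2 P \o w)). }
  constructor. refine {| in_ob := z; in_map := fun d => the (Map d) |}.
  intros d u v. destruct (equalizer_exists u v) as (e & n & Hn & E & _).
  destruct (Least e (m \o n)) as [w Hw]; [now apply monic_comp|].
  assert (Ew : n \o w == idm z).
  { apply Hm. now rewrite <- compA, Hw, compf1. }
  rewrite <- (compf1 u), <- (compf1 v), <- Ew. now rewrite (precomp2 E).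
Qed.

(** A pushout of [f] and [g] is the smallest subobject of [P B] that contains
    the evaluations at the points of [a] and of [b], where [B] consists of the
    pairs of subsets of [a] and [b] with the same inverse image in [c].  A cocone
    with vertex [x] induces [P x -> B], hence [P B -> P (P x)], and the inverse
    image of [x] along the latter contains the smallest subobject. *)
Lemma pushout_exists (a b c : C) (f : Hom c a) (g : Hom c b) :
  inhabited (Pushout f g).
Proof.
  pose (B := pb (preim f) (preim g)).
  pose (ia := flip (pb1 B)). pose (ib := flip (pb2 B)).
  assert (Hcoc : ia \o f == ib \o g).
  { apply set_ext. intros d k s. unfold ia, ib. rewrite !compA, !flip_in.
    rewrite <- !preim_in, <- !compA. now rewrite (pb_sq B). }
  destruct (equalizer_exists (preim ia) (whole _ a)) as (wa & ma & Hma & Ea & Ua).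
  destruct (equalizer_exists (preim ib \o ma) (whole _ b)) as (wb & mb & Hmb & Eb & Ub).
  destruct (intersection_exists (ma \o mb)) as (s & m & Hm & Hs).
  assert (Fa : factors m ia).
  { apply Hs. intros d j i. apply preim_in. rewrite !compA, (precomp2 Ea).
    apply whole_in. }
  assert (Fb : factors m ib).
  { apply Hs. intros d j i. apply preim_in. rewrite compA.
    rewrite <- (compA (preim ib) ma). rewrite (precomp2 Eb). apply whole_in. }
  destruct Fa as [pa Hpa], Fb as [pb' Hpb].
  assert (Least : forall (n : C) (k : Hom n (Pw (pb_ob B))), monic k ->
    factors k ia -> factors k ib -> factors k m).
  { intros n k Hk Ka Kb.
    assert (Na : preim ia \o name_sub Hk == whole _ a \o name_sub Hk).
    { apply set_ext. intros d j x. rewrite !compA, preim_in, name_sub_in.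
      split; intros _; [apply whole_in|]. destruct Ka as [w Hw].
      exists (w \o x). now rewrite <- compA, Hw. }
    destruct (Ua _ _ Na) as [na Hna].
    assert (Nb : (preim ib \o ma) \o na == whole _ b \o na).
    { apply set_ext. intros d j x. rewrite !compA, (precomp Hna), preim_in, name_sub_in.
      split; intros _; [apply whole_in|]. destruct Kb as [w Hw].
      exists (w \o x). now rewrite <- compA, Hw. }
    destruct (Ub _ _ Nb) as [nb Hnb].
    apply (name_sub_in Hk (bang Hone s)).
    rewrite <- (compf1 m), <- Hna, <- Hnb, <- (compA ma), compA.
    apply (Hs s m); exists (idm s); apply compf1. }
  assert (Ext : forall (d : C) (w w' : Hom s d),
    w \o pa == w' \o pa -> w \o pb' == w' \o pb' -> w == w').
  { intros d u v H1 H2. destruct (equalizer_exists u v) as (e & n & Hn & E & Ue).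
    destruct (Least e (m \o n)) as [w Hw].
    - now apply monic_comp.
    - destruct (Ue _ _ H1) as [w Hw]. exists w. now rewrite compA, Hw.
    - destruct (Ue _ _ H2) as [w Hw]. exists w. now rewrite compA, Hw.
    - assert (Ew : n \o w == idm s).
      { apply Hm. now rewrite <- compA, Hw, compf1. }
      rewrite <- (compf1 u), <- (compf1 v), <- Ew. now rewrite (precomp2 E). }
  assert (Pair : forall d (u : Hom a d) (v : Hom b d), u \o f == v \o g ->
    {w : Hom s d | w \o pa == u /\ w \o pb' == v}).
  { intros d u v e. apply constructive_indefinite_description.
    assert (e' : preim f \o preim u == preim g \o preim v).
    { apply set_ext. intros d' k x. rewrite !compA, !preim_in, <- !compA.
      now rewrite e. }
    pose (beta := pb_pair B e').
    pose (P := pb (preim beta) (ev d)).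
    assert (Ia : preim beta \o ia == ev d \o u).
    { apply set_ext. intros d' k S. unfold ia.
      rewrite !compA, preim_in, flip_in, ev_in, <- compA. unfold beta.
      now rewrite pb_pair1, preim_in. }
    assert (Ib : preim beta \o ib == ev d \o v).
    { apply set_ext. intros d' k S. unfold ib.
      rewrite !compA, preim_in, flip_in, ev_in, <- compA. unfold beta.
      now rewrite pb_pair2, preim_in. }
    destruct (Least _ (pb1 P)) as [w Hw].
    - apply pb1_monic, ev_monic.
    - exists (pb_pair P Ia). apply pb_pair1.
    - exists (pb_pair P Ib). apply pb_pair1.
    - exists (pb2 P \o w). split; apply ev_monic; rewrite <- !compA, <- (pb_sq P);
        rewrite (compA _ _ w), Hw, compA.
      + now rewrite Hpa.
      + now rewrite Hpb. }
  constructor.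
  unshelve refine {| po_ob := s; po1 := pa; po2 := pb';
    po_pair := fun d u v e => proj1_sig (Pair d u v e); po_ext := Ext |}.
  - apply Hm. now rewrite <- !compA, Hpa, Hpb.
  - intros. apply (proj2_sig (Pair d u v e)).
  - intros. apply (proj2_sig (Pair d u v e)).
Qed.

(** ** Pushouts and monomorphisms *)

(** The arrow from [a] to [P b] that extends [g] to a partial arrow and the singleton
    arrow of [b] form a cocone, and both claims can be tested after the induced
    arrow from the pushout to [P b]. *)
Lemma pushout_of_monic (a b c p : C) (m : Hom c a) (g : Hom c b)
  (p1 : Hom a p) (p2 : Hom b p) :
  is_pushout m g p1 p2 -> monic m ->
  monic p2 /\
  forall (d : C) (u : Hom d a) (v : Hom d b), p1 \o u == p2 \o v -> factors m u.
Proof.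
  intros [_ H] Hm. destruct (H _ _ _ (graph_of_dom g Hm)) as [h [[H1 H2] _]]. split.
  - intros d u v E. apply (@sing_monic b). rewrite <- H2, !compA. now rewrite E.
  - intros d u v E.
    assert (F : inP v (graph_of g Hm \o u)).
    { rewrite <- H1, compA, E, <- compA, H2. now apply sing_in. }
    apply graph_of_in in F. destruct F as [w [W _]]. now exists w.
Qed.

Definition classify (a t : C) (m : Hom t a) (Hm : monic m) : Hom a (Pw one) :=
  graph_of (bang Hone t) Hm.

Lemma classify_in (a t : C) (m : Hom t a) (Hm : monic m) (d : C) (k : Hom d a)
  (x : Hom d one) : inP x (classify Hm \o k) <-> factors m k.
Proof.
  unfold classify. rewrite graph_of_in. split; intros [w W]; exists w; [easy|].
  split; [easy|]. apply to_one_eq, Hone.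
Qed.

(** A subobject of the pushout is an arrow to the power object of [one], and an
    arrow out of the pushout is determined by its restrictions to [a] and [b]. *)
Lemma subobject_of_pushout_ext (a b c p : C) (f : Hom c a) (g : Hom c b)
  (p1 : Hom a p) (p2 : Hom b p) (H : is_pushout f g p1 p2)
  (t t' : C) (m : Hom t p) (m' : Hom t' p) (Hm : monic m) (Hm' : monic m') :
  (forall (d : C) (k : Hom d a), factors m (p1 \o k) <-> factors m' (p1 \o k)) ->
  (forall (d : C) (k : Hom d b), factors m (p2 \o k) <-> factors m' (p2 \o k)) ->
  forall (d : C) (k : Hom d p), factors m k <-> factors m' k.
Proof.
  intros H1 H2 d k. rewrite <- (classify_in Hm k (bang Hone d)).
  rewrite <- (classify_in Hm' k (bang Hone d)).
  assert (E : classify Hm == classify Hm'); [|now rewrite E].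
  apply (is_pushout_ext H); apply set_ext; intros d' j x;
    rewrite !compA, !classify_in; trivial.
Qed.

(** A subobject [t] of a pushout that contains the image of [c] is the pushout
    of its inverse images.  Arrows to [x] defined on these are partial arrows
    on [a] and [b]; they glue to an arrow from the whole pushout to [P x], and the
    part of [t] on which its values are singletons is everything. *)
Lemma pushout_restrict (a b c p : C) (f : Hom c a) (g : Hom c b)
  (p1 : Hom a p) (p2 : Hom b p) (t a' b' : C)
  (m : Hom t p) (ma : Hom a' a) (mb : Hom b' b) (f' : Hom c a') (g' : Hom c b')
  (i : Hom a' t) (j : Hom b' t) :
  is_pushout f g p1 p2 -> monic m -> monic ma -> monic mb ->
  ma \o f' == f -> mb \o g' == g ->
  m \o i == p1 \o ma -> m \o j == p2 \o mb ->
  (forall (d : C) (k : Hom d a), factors m (p1 \o k) -> factors ma k) ->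
  (forall (d : C) (k : Hom d b), factors m (p2 \o k) -> factors mb k) ->
  is_pushout f' g' i j.
Proof.
  intros H Hm Hma Hmb Ef Eg Ei Ej Fa Fb.
  assert (Large : forall (n : C) (k : Hom n t), monic k -> factors k i -> factors k j ->
    factors (m \o k) m).
  { intros n k Hk Ki Kj.
    apply (subobject_of_pushout_ext H Hm (monic_comp Hm Hk));
      [| |exists (idm t); apply compf1].
    - intros d u. split; [intros F|intros [w W]; exists (k \o w); now rewrite <- compA].
      apply Fa in F. destruct F as [w W], Ki as [z Z]. exists (z \o w).
      now rewrite compA, (precomp Z), (precomp2 Ei), W.
    - intros d u. split; [intros F|intros [w W]; exists (k \o w); now rewrite <- compA].
      apply Fb in F. destruct F as [w W], Kj as [z Z]. exists (z \o w).
      now rewrite compA, (precomp Z), (precomp2 Ej), W. }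
  assert (Ext : forall (d : C) (u v : Hom t d), u \o i == v \o i -> u \o j == v \o j ->
    u == v).
  { intros d u v E1 E2. destruct (equalizer_exists u v) as (e & n & Hn & E & Ue).
    destruct (Large e n Hn (Ue _ _ E1) (Ue _ _ E2)) as [w W].
    assert (Ew : n \o w == idm t).
    { apply Hm. now rewrite <- compA, W, compf1. }
    rewrite <- (compf1 u), <- (compf1 v), <- Ew. now rewrite (precomp2 E). }
  split.
  { apply Hm. rewrite <- !compA, Ei, Ej, !compA, Ef, Eg. apply H. }
  intros x u v E.
  assert (Eg' : graph_of u Hma \o f == graph_of v Hmb \o g).
  { rewrite <- Ef, <- Eg, <- !compA, !graph_of_dom, !compA. now rewrite E. }
  destruct H as [Hsq H]. destruct (H _ _ _ Eg') as [h [[H1 H2] _]].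
  pose (P := pb (h \o m) (sing x)).
  assert (Ki : (h \o m) \o i == sing x \o u).
  { now rewrite compA, Ei, <- compA, H1, graph_of_dom. }
  assert (Kj : (h \o m) \o j == sing x \o v).
  { now rewrite compA, Ej, <- compA, H2, graph_of_dom. }
  destruct (@Large _ (pb1 P)) as [w W].
  - apply pb1_monic, sing_monic.
  - exists (pb_pair P Ki). apply pb_pair1.
  - exists (pb_pair P Kj). apply pb_pair1.
  - assert (Ew : pb1 P \o w == idm t).
    { apply Hm. now rewrite <- compA, W, compf1. }
    assert (Es : sing x \o (pb2 P \o w) == h \o m).
    { now rewrite <- compA, <- (pb_sq P), compA, Ew, compf1. }
    exists (pb2 P \o w).
    assert (E1 : pb2 P \o w \o i == u) by (apply sing_monic; now rewrite <- compA, Es, Ki).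
    assert (E2 : pb2 P \o w \o j == v) by (apply sing_monic; now rewrite <- compA, Es, Kj).
    split; [easy|]. intros w' [W1 W2]. apply Ext; [now rewrite W1|now rewrite W2].
Qed.

(** ** Subobjects of a pushout that contain the glued part *)

(** Through the pushout [M] of [a'] and [b] over [c], the arrow [h] is the composite
    of a pushout of [mb] and a pushout of [ma], both monic.  The second pushout
    square also shows that a point of [a] that comes from [M] lies in [a']. *)
Lemma pushout_map_monic (a b c a' b' p s : C) (f : Hom c a) (g : Hom c b)
  (p1 : Hom a p) (p2 : Hom b p) (f' : Hom c a') (g' : Hom c b')
  (s1 : Hom a' s) (s2 : Hom b' s) (ma : Hom a' a) (mb : Hom b' b) (h : Hom s p) :
  is_pushout f g p1 p2 -> is_pushout f' g' s1 s2 ->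
  monic ma -> monic mb -> ma \o f' == f -> mb \o g' == g ->
  h \o s1 == p1 \o ma -> h \o s2 == p2 \o mb ->
  monic h /\ forall (d : C) (k : Hom d a), factors h (p1 \o k) -> factors ma k.
Proof.
  intros H H' Hma Hmb Ef Eg E1 E2.
  destruct (pushout_exists f' g) as [M]. pose proof (Pushout_is_pushout M) as HM.
  assert (em : (p1 \o ma) \o f' == p2 \o g) by (rewrite compA, Ef; apply H).
  assert (en : po1 M \o f' == (po2 M \o mb) \o g') by (rewrite compA, Eg; apply po_sq).
  destruct (proj2 HM _ _ _ em) as [m [[M1 M2] _]].
  destruct (proj2 H' _ _ _ en) as [n [[N1 N2] _]].
  assert (Eh : h == m \o n).
  { apply (is_pushout_ext H'); rewrite compA.
    - now rewrite N1, M1.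
    - now rewrite N2, (precomp M2). }
  assert (Om : is_pushout ma (po1 M) p1 m).
  { split; [now symmetry|]. intros d u v e.
    assert (e' : u \o f == (v \o po2 M) \o g).
    { now rewrite <- Ef, <- compA, e, !compA, (po_sq M). }
    destruct (proj2 H _ _ _ e') as [w [[W1 W2] U]]. exists w. split.
    - split; [easy|]. apply (is_pushout_ext HM); rewrite compA.
      + now rewrite M1, (precomp W1).
      + now rewrite M2.
    - intros w' [W1' W2']. apply U. split; [easy|]. now rewrite <- W2', compA, M2. }
  assert (On : is_pushout mb s2 (po2 M) n).
  { split; [now symmetry|]. intros d u v e.
    assert (e' : (v \o s1) \o f' == u \o g).
    { rewrite <- Eg, <- compA, e, !compA. now rewrite (proj1 H'). }
    destruct (proj2 HM _ _ _ e') as [w [[W1 W2] U]]. exists w. split.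
    - split; [easy|]. apply (is_pushout_ext H'); rewrite compA.
      + now rewrite N1.
      + now rewrite N2, (precomp W2).
    - intros w' [W1' W2']. apply U. split; [|easy]. now rewrite <- W2', compA, N1. }
  destruct (pushout_of_monic Om Hma) as [Hm Fm], (pushout_of_monic On Hmb) as [Hn _].
  split.
  - intros d u v E. rewrite Eh, !compA in E. now apply Hn, Hm.
  - intros d k [w W]. apply (Fm _ _ (n \o w)). now rewrite <- compA, <- Eh.
Qed.

(** The arrows [h1] and [h2] are monic, so their intersection is a subobject of the
    pushout that contains the image of [c]; its inverse images in [a] and [b] are
    the two smaller intersections. *)
Lemma pushout_intersection (a b c p a1 b1 a2 b2 s1 s2 : C)
  (f : Hom c a) (g : Hom c b) (p1 : Hom a p) (p2 : Hom b p)
  (f1 : Hom c a1) (g1 : Hom c b1) (i1 : Hom a1 s1) (j1 : Hom b1 s1)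
  (f2 : Hom c a2) (g2 : Hom c b2) (i2 : Hom a2 s2) (j2 : Hom b2 s2)
  (m1 : Hom a1 a) (n1 : Hom b1 b) (h1 : Hom s1 p)
  (m2 : Hom a2 a) (n2 : Hom b2 b) (h2 : Hom s2 p)
  (Pa : Pullback m1 m2) (Pb : Pullback n1 n2) (Pt : Pullback h1 h2)
  (f0 : Hom c (pb_ob Pa)) (g0 : Hom c (pb_ob Pb))
  (i : Hom (pb_ob Pa) (pb_ob Pt)) (j : Hom (pb_ob Pb) (pb_ob Pt)) :
  is_pushout f g p1 p2 -> is_pushout f1 g1 i1 j1 -> is_pushout f2 g2 i2 j2 ->
  monic m1 -> monic n1 -> monic m2 -> monic n2 ->
  m1 \o f1 == f -> n1 \o g1 == g -> m2 \o f2 == f -> n2 \o g2 == g ->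
  h1 \o i1 == p1 \o m1 -> h1 \o j1 == p2 \o n1 ->
  h2 \o i2 == p1 \o m2 -> h2 \o j2 == p2 \o n2 ->
  pb1 Pa \o f0 == f1 -> pb1 Pb \o g0 == g1 ->
  pb1 Pt \o i == i1 \o pb1 Pa -> pb1 Pt \o j == j1 \o pb1 Pb ->
  is_pushout f0 g0 i j.
Proof.
  intros H H1 H2 M1 N1 M2 N2 Ef1 Eg1 Ef2 Eg2 Ei1 Ej1 Ei2 Ej2 Ef0 Eg0 Ei Ej.
  destruct (pushout_map_monic H H1 M1 N1 Ef1 Eg1 Ei1 Ej1) as [Mh1 F1].
  destruct (pushout_map_monic H H2 M2 N2 Ef2 Eg2 Ei2 Ej2) as [Mh2 F2].
  destruct (pushout_map_monic (is_pushout_sym H) (is_pushout_sym H1) N1 M1 Eg1 Ef1 Ej1 Ei1)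
    as [_ G1].
  destruct (pushout_map_monic (is_pushout_sym H) (is_pushout_sym H2) N2 M2 Eg2 Ef2 Ej2 Ei2)
    as [_ G2].
  apply (@pushout_restrict a b c p f g p1 p2 _ _ _ (h1 \o pb1 Pt) (m1 \o pb1 Pa)
    (n1 \o pb1 Pb)); trivial.
  - apply monic_comp, pb1_monic; trivial.
  - apply monic_comp, pb1_monic; trivial.
  - apply monic_comp, pb1_monic; trivial.
  - now rewrite compA, Ef0.
  - now rewrite compA, Eg0.
  - now rewrite compA, Ei, (precomp2 Ei1).
  - now rewrite compA, Ej, (precomp2 Ej1).
  - intros d k [w W]. rewrite compA in W.
    destruct (F1 d k) as [u U]; [now exists (pb1 Pt \o w)|].
    destruct (F2 d k) as [v V].
    { exists (pb2 Pt \o w). now rewrite <- compA, <- (pb_sq Pt), compA. }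
    assert (e : m1 \o u == m2 \o v) by now rewrite U, V.
    exists (pb_pair Pa e). now rewrite compA, pb_pair1.
  - intros d k [w W]. rewrite compA in W.
    destruct (G1 d k) as [u U]; [now exists (pb1 Pt \o w)|].
    destruct (G2 d k) as [v V].
    { exists (pb2 Pt \o w). now rewrite <- compA, <- (pb_sq Pt), compA. }
    assert (e : n1 \o u == n2 \o v) by now rewrite U, V.
    exists (pb_pair Pb e). now rewrite compA, pb_pair1.
Qed.

Lemma coproduct_exists (a b : C) : inhabited (Coproduct a b).
Proof.
  destruct initial_exists as [z].
  destruct (pushout_exists (in_map z a) (in_map z b)) as [P].
  constructor. unshelve refine {| cp_ob := po_ob P; cp1 := po1 P; cp2 := po2 P;
    cp_pair := fun d u v => po_pair P (in_ext (u \o in_map z a) (v \o in_map z b)) |}.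
  - intros. apply po_pair1.
  - intros. apply po_pair2.
  - intros. now apply (po_ext (p := P)).
Qed.

End Topos.

Lemma topos_choices (A X : Category) : is_topos A -> is_topos X -> inhabited (Choices A X).
Proof.
  intros HA HX. constructor. constructor.
  - apply (topos_pullback HA).
  - apply (topos_pullback HX).
  - intros. apply the, (pushout_exists HX).
  - intros. apply the, (coproduct_exists HA).
  - intros. apply the, (coproduct_exists HX).
  - apply the, (initial_exists HA).
Qed.

(** * Coproducts as a symmetric monoidal structure *)

Lemma cp_pair1_comp (C : Category) (a b d e : C) (P : Coproduct a b) (u : Hom a d)
  (v : Hom b d) (k : Hom e a) : cp_pair P u v \o (cp1 P \o k) == u \o k.
Proof. apply precomp, cp_pair1. Qed.

Lemma cp_pair2_comp (C : Category) (a b d e : C) (P : Coproduct a b) (u : Hom a d)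
  (v : Hom b d) (k : Hom e b) : cp_pair P u v \o (cp2 P \o k) == v \o k.
Proof. apply precomp, cp_pair2. Qed.

(** One step towards the normal form of a composite with coproduct injections.
    The redex is found by a syntactic match because a failing setoid rewrite is
    slow. *)
Ltac cp_step :=
  match goal with
  | |- context [(?h \o ?g) \o ?f] => rewrite (compA h g f)
  | |- context [idm _ \o ?f] => rewrite (comp1f f)
  | |- context [?f \o idm _] => rewrite (compf1 f)
  | |- context [cp_pair ?P ?u ?v \o cp1 ?P] => rewrite (cp_pair1 P u v)
  | |- context [cp_pair ?P ?u ?v \o cp2 ?P] => rewrite (cp_pair2 P u v)
  | |- context [cp_pair ?P ?u ?v \o (cp1 ?P \o ?k)] => rewrite (cp_pair1_comp P u v k)
  | |- context [cp_pair ?P ?u ?v \o (cp2 ?P \o ?k)] => rewrite (cp_pair2_comp P u v k)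
  end.

Ltac cp_norm := repeat cp_step.

Ltac cp_solve :=
  repeat match goal with
         | |- @eqh _ (cp_ob _) _ _ _ => apply cp_ext
         | |- @eqh _ (in_ob _) _ _ _ => apply in_ext
         end;
  cp_norm; try reflexivity.

Lemma cp_map_comp (C : Category) (a b c a' b' c' : C) (P : Coproduct a a')
  (Q : Coproduct b b') (S : Coproduct c c') (g : Hom b c) (f : Hom a b)
  (g' : Hom b' c') (f' : Hom a' b') :
  cp_map Q S g g' \o cp_map P Q f f' == cp_map P S (g \o f) (g' \o f').
Proof. unfold cp_map. cp_solve. Qed.

Lemma cp_map_proper (C : Category) (a b a' b' : C) (P : Coproduct a a') (Q : Coproduct b b')
  (f g : Hom a b) (f' g' : Hom a' b') :
  f == g -> f' == g' -> cp_map P Q f f' == cp_map P Q g g'.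
Proof. intros E E'. unfold cp_map. now rewrite E, E'. Qed.

Section CoproductMonoidal.
Context (C : Category) (cp : forall a b : C, Coproduct a b) (z : Initial C).

Local Notation "a (+) b" := (cp_ob (cp a b)) (at level 50, left associativity).

Definition cmap (a b a' b' : C) (f : Hom a b) (f' : Hom a' b') :
  Hom (a (+) a') (b (+) b') := cp_map (cp a a') (cp b b') f f'.

Definition cassoc (a b c : C) : Hom (a (+) b (+) c) (a (+) (b (+) c)) :=
  cp_pair _ (cp_pair _ (cp1 _) (cp2 _ \o cp1 _)) (cp2 _ \o cp2 _).
Definition cassoc_inv (a b c : C) : Hom (a (+) (b (+) c)) (a (+) b (+) c) :=
  cp_pair _ (cp1 _ \o cp1 _) (cp_pair _ (cp1 _ \o cp2 _) (cp2 _)).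
Definition clun (a : C) : Hom (in_ob z (+) a) a := cp_pair _ (in_map z a) (idm a).
Definition crun (a : C) : Hom (a (+) in_ob z) a := cp_pair _ (idm a) (in_map z a).
Definition cbraid (a b : C) : Hom (a (+) b) (b (+) a) := cp_pair _ (cp2 _) (cp1 _).

Ltac cp_unfold :=
  unfold cmap, cp_map, cassoc, cassoc_inv, clun, crun, cbraid; cp_solve.

Definition cassoc_iso (a b c : C) : Iso (a (+) b (+) c) (a (+) (b (+) c)).
Proof.
  refine {| fwd := cassoc a b c; bwd := cassoc_inv a b c |}; cp_unfold.
Defined.

Definition clun_iso (a : C) : Iso (in_ob z (+) a) a.
Proof. refine {| fwd := clun a; bwd := cp2 _ |}; cp_unfold. Defined.

Definition crun_iso (a : C) : Iso (a (+) in_ob z) a.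
Proof. refine {| fwd := crun a; bwd := cp1 _ |}; cp_unfold. Defined.

Definition cbraid_iso (a b : C) : Iso (a (+) b) (b (+) a).
Proof. refine {| fwd := cbraid a b; bwd := cbraid b a |}; cp_unfold. Defined.

Lemma cmap_proper (a b a' b' : C) (f g : Hom a b) (f' g' : Hom a' b') :
  f == g -> f' == g' -> cmap f f' == cmap g g'.
Proof. apply cp_map_proper. Qed.

#[export] Instance cmap_Proper (a b a' b' : C) :
  Proper (@eqh C a b ==> @eqh C a' b' ==> @eqh C (a (+) a') (b (+) b'))
    (@cmap a b a' b').
Proof. intros f g E f' g' E'. now apply cmap_proper. Qed.

Lemma cmap_id (a b : C) : cmap (idm a) (idm b) == idm (a (+) b).
Proof. cp_unfold. Qed.

Lemma cmap_comp (a b c a' b' c' : C) (g : Hom b c) (f : Hom a b)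
  (g' : Hom b' c') (f' : Hom a' b') :
  cmap (g \o f) (g' \o f') == cmap g g' \o cmap f f'.
Proof. cp_unfold. Qed.

Lemma cassoc_nat (a b c a' b' c' : C) (f : Hom a a') (g : Hom b b') (h : Hom c c') :
  cassoc a' b' c' \o cmap (cmap f g) h == cmap f (cmap g h) \o cassoc a b c.
Proof. cp_unfold. Qed.

Lemma clun_nat (a b : C) (f : Hom a b) :
  clun b \o cmap (idm (in_ob z)) f == f \o clun a.
Proof. cp_unfold. Qed.

Lemma crun_nat (a b : C) (f : Hom a b) :
  crun b \o cmap f (idm (in_ob z)) == f \o crun a.
Proof. cp_unfold. Qed.

Lemma cbraid_nat (a b a' b' : C) (f : Hom a a') (g : Hom b b') :
  cbraid a' b' \o cmap f g == cmap g f \o cbraid a b.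
Proof. cp_unfold. Qed.

Lemma cpentagon (a b c d : C) :
  cassoc a b (c (+) d) \o cassoc (a (+) b) c d
  == cmap (idm a) (cassoc b c d) \o cassoc a (b (+) c) d \o cmap (cassoc a b c) (idm d).
Proof. cp_unfold. Qed.

Lemma ctriangle (a b : C) :
  cmap (idm a) (clun b) \o cassoc a (in_ob z) b == cmap (crun a) (idm b).
Proof. cp_unfold. Qed.

Lemma chexagon (a b c : C) :
  cassoc b c a \o cbraid a (b (+) c) \o cassoc a b c
  == cmap (idm b) (cbraid a c) \o cassoc b a c \o cmap (cbraid a b) (idm c).
Proof. cp_unfold. Qed.

Lemma csymmetry (a b : C) : cbraid b a \o cbraid a b == idm (a (+) b).
Proof. cp_unfold. Qed.
End CoproductMonoidal.

(** * The category of vertical arrows *)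

Section VerticalArrows.
Context (A X : Category) (ch : Choices A X).

(** A span of isomorphisms is determined, up to isomorphism of spans, by the
    isomorphism it composes to. *)
Definition vmap (a b : A) (v : VSpan a b) : Hom a b := v_dn v \o bwd (v_up v).

Lemma vmap_dn (a b : A) (v : VSpan a b) : v_dn v == vmap v \o v_up v.
Proof. unfold vmap. now rewrite compA, bwd_fwd, compf1. Qed.

Lemma vmap_unique (a b : A) (v : VSpan a b) (f : Hom a b) :
  v_dn v == f \o v_up v -> vmap v == f.
Proof. intros E. unfold vmap. now rewrite E, compA, fwd_bwd, compf1. Qed.

Lemma vspan_eq_vmap (a b : A) (v w : VSpan a b) : vspan_eq v w <-> vmap v == vmap w.
Proof.
  split.
  - intros [s [Hu Hd]]. apply vmap_unique. rewrite <- Hu, <- Hd, <- compA.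
    now rewrite <- vmap_dn.
  - intros E. exists (iso_comp (iso_inv (v_up w)) (v_up v)). cbn. split.
    + now rewrite <- compA, fwd_bwd, comp1f.
    + rewrite (vmap_dn w), compA, <- (compA (v_up w)), fwd_bwd, comp1f, <- E.
      now rewrite <- vmap_dn.
Qed.

Lemma vmap_id (a : A) : vmap (@idm (FineC0 ch) a) == idm a.
Proof. apply vmap_unique. cbn. now rewrite compf1. Qed.

Lemma vmap_comp (a b c : A) (w : @Hom (FineC0 ch) b c) (v : @Hom (FineC0 ch) a b) :
  vmap (w \o v) == vmap w \o vmap v.
Proof.
  apply vmap_unique. cbn. set (P := pbA ch (v_dn v) (v_up w)).
  transitivity (vmap w \o (v_up w \o pb2 P)).
  { rewrite <- compA. now rewrite <- vmap_dn. }
  rewrite <- (pb_sq P), compA. rewrite <- (compA (vmap v)). now rewrite <- vmap_dn.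
Qed.

Definition vmap_bwd (a b : A) (v : VSpan a b) : Hom b a := v_up v \o bwd (v_dn v).

Lemma vmap_bwd_vmap (a b : A) (v : VSpan a b) : vmap_bwd v \o vmap v == idm a.
Proof.
  unfold vmap, vmap_bwd. now rewrite compA, <- (compA (bwd _)), bwd_fwd, comp1f, fwd_bwd.
Qed.

Lemma vmap_vmap_bwd (a b : A) (v : VSpan a b) : vmap v \o vmap_bwd v == idm b.
Proof.
  unfold vmap, vmap_bwd. now rewrite compA, <- (compA (bwd _)), bwd_fwd, comp1f, fwd_bwd.
Qed.

Definition vspan_of (a b : A) (i : Iso a b) : VSpan a b :=
  {| v_up := iso_id a; v_dn := i |}.

Lemma vmap_of (a b : A) (i : Iso a b) : vmap (vspan_of i) == i.
Proof. apply vmap_unique. cbn. now rewrite compf1. Qed.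

Lemma vmap_tens (a b a' b' : A) (v : @Hom (FineC0 ch) a b) (w : @Hom (FineC0 ch) a' b') :
  vmap (thom (fine_tens0 ch) v w) == cmap (cpA ch) (vmap v) (vmap w).
Proof.
  apply vmap_unique. cbn. change (cmap (cpA ch) (v_dn v) (v_dn w)
    == cmap (cpA ch) (vmap v) (vmap w) \o cmap (cpA ch) (v_up v) (v_up w)).
  rewrite <- cmap_comp. apply cmap_proper; apply vmap_dn.
Qed.

Lemma v_is_of (a b : A) (i : Iso a b) : v_is (vspan_of i) i.
Proof. unfold v_is. cbn. now rewrite compf1. Qed.

Ltac vmap_norm :=
  apply vspan_eq_vmap;
  repeat first [ rewrite vmap_comp | rewrite vmap_tens | rewrite vmap_id | rewrite vmap_of ].

Lemma fine_C0_category : is_category (FineC0 ch).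
Proof.
  split.
  - intros a b. split.
    + intros v. now apply vspan_eq_vmap.
    + intros v w. cbn. rewrite !vspan_eq_vmap. easy.
    + intros u v w. cbn. rewrite !vspan_eq_vmap. intros E. now rewrite E.
  - intros a b c g g' f f' E E'. apply vspan_eq_vmap in E, E'. vmap_norm.
    now rewrite E, E'.
  - intros. vmap_norm. apply comp1f.
  - intros. vmap_norm. apply compf1.
  - intros. vmap_norm. symmetry. apply compA.
Qed.

Definition vspan_iso (a b : A) (i : Iso a b) : @Iso (FineC0 ch) a b.
Proof.
  refine (@Build_Iso (FineC0 ch) a b (vspan_of i) (vspan_of (iso_inv i)) _ _);
    vmap_norm.
  - apply fwd_bwd.
  - apply bwd_fwd.
Defined.

Local Notation cA := (cpA ch).

Definition fine_symmon0 : SymMonoidal (fine_tens0 ch).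
Proof.
  refine (@Build_SymMonoidal (FineC0 ch) (fine_tens0 ch) _ _ _
    (fun a b c => vspan_iso (cassoc_iso cA a b c))
    (fun a => vspan_iso (clun_iso cA (inA ch) a))
    (fun a => vspan_iso (crun_iso cA (inA ch) a))
    (fun a b => vspan_iso (cbraid_iso cA a b)) _ _ _ _ _ _ _ _);
  cbn [fwd vspan_iso].
  - intros a b a' b' f g f' g' E E'. apply vspan_eq_vmap in E, E'.
    vmap_norm. now apply cmap_proper.
  - intros. vmap_norm. apply cmap_id.
  - intros. vmap_norm. apply cmap_comp.
  - intros. vmap_norm. apply cassoc_nat.
  - intros. vmap_norm. apply clun_nat.
  - intros. vmap_norm. apply crun_nat.
  - intros. vmap_norm. apply cbraid_nat.
  - intros. vmap_norm. apply cpentagon.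
  - intros. vmap_norm. apply ctriangle.
  - intros. vmap_norm. apply chexagon.
  - intros. vmap_norm. apply csymmetry.
Defined.
End VerticalArrows.

(** * More on pushouts *)

Lemma is_pushout_eq (C : Category) (a b c p : C) (f f' : Hom c a) (g g' : Hom c b)
  (p1 : Hom a p) (p2 : Hom b p) :
  f == f' -> g == g' -> is_pushout f g p1 p2 -> is_pushout f' g' p1 p2.
Proof.
  intros Ef Eg [E H]. split; [now rewrite <- Ef, <- Eg|].
  intros d u v e. apply H. now rewrite Ef, Eg.
Qed.

Lemma is_pushout_precomp (C : Category) (a b c c' p : C) (f : Hom c a) (g : Hom c b)
  (p1 : Hom a p) (p2 : Hom b p) (i : Hom c' c) :
  is_iso i -> is_pushout f g p1 p2 -> is_pushout (f \o i) (g \o i) p1 p2.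
Proof.
  intros [j [Eij _]] [E H]. split; [now rewrite <- !compA, E|].
  intros d u v e. apply H.
  rewrite <- (compf1 f), <- (compf1 g), <- Eij, <- (compA f), <- (compA g), <- !compA.
  rewrite (compA u f i), (compA v g i). now rewrite e.
Qed.

(** The inverses of [ma] and [mb] induce the inverse of [h]. *)
Lemma pushout_map_is_iso (C : Category) (a b c a' b' p s : C) (f : Hom c a) (g : Hom c b)
  (p1 : Hom a p) (p2 : Hom b p) (f' : Hom c a') (g' : Hom c b')
  (s1 : Hom a' s) (s2 : Hom b' s) (ma : Hom a' a) (mb : Hom b' b) (h : Hom s p) :
  is_pushout f g p1 p2 -> is_pushout f' g' s1 s2 ->
  is_iso ma -> is_iso mb -> ma \o f' == f -> mb \o g' == g ->
  h \o s1 == p1 \o ma -> h \o s2 == p2 \o mb -> is_iso h.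
Proof.
  intros H H' [k [K1 K2]] [l [L1 L2]] Ef Eg E1 E2.
  assert (e : (s1 \o k) \o f == (s2 \o l) \o g).
  { rewrite <- Ef, <- Eg, !compA, <- (compA k), <- (compA l), K2, L2, !comp1f.
    apply H'. }
  destruct (proj2 H _ _ _ e) as [j [[J1 J2] _]]. exists j. split.
  - apply (is_pushout_ext H); rewrite compA, comp1f.
    + rewrite J1, <- compA, E1, compA, K1. apply compf1.
    + rewrite J2, <- compA, E2, compA, L1. apply compf1.
  - apply (is_pushout_ext H'); rewrite compA, comp1f.
    + rewrite E1, <- compA, J1, compA, K2. apply compf1.
    + rewrite E2, <- compA, J2, compA, L2. apply compf1.
Qed.

Lemma is_iso_extend (C : Category) (a b c : C) (h : Hom a b) (i : Hom a c) :
  is_iso h -> exists chi : Hom b c, i == chi \o h.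
Proof.
  intros [j [_ E]]. exists (i \o j). now rewrite compA, E, compf1.
Qed.

Lemma coproduct_is_pushout (C : Category) (a b : C) (z : Initial C) (P : Coproduct a b) :
  is_pushout (in_map z a) (in_map z b) (cp1 P) (cp2 P).
Proof.
  split; [apply in_ext|]. intros d u v _. exists (cp_pair P u v). split.
  - split; [apply cp_pair1|apply cp_pair2].
  - intros w [E1 E2]. apply (cp_ext (c := P)).
    + now rewrite E1, cp_pair1.
    + now rewrite E2, cp_pair2.
Qed.

Lemma fmap_is_iso (A X : Category) (L : Functor A X) (a b : A) (f : Hom a b) :
  is_iso f -> is_iso (fmap L f).
Proof.
  intros [g [E1 E2]]. exists (fmap L g).
  split; rewrite <- fmap_comp, <- fmap_id; now apply fmap_proper.
Qed.

Lemma is_iso_iso (C : Category) (a b : C) (i : Iso a b) : is_iso i.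
Proof. exists (bwd i). split; [apply fwd_bwd|apply bwd_fwd]. Qed.

Lemma vmap_is_iso (A : Category) (a b : A) (v : VSpan a b) : is_iso (vmap v).
Proof. exists (vmap_bwd v). split; [apply vmap_vmap_bwd|apply vmap_bwd_vmap]. Qed.

Lemma monic_section_is_iso (C : Category) (a b : C) (f : Hom a b) (g : Hom b a) :
  monic f -> f \o g == idm b -> is_iso f.
Proof.
  intros Hf E. exists g. split; [exact E|]. apply Hf. now rewrite <- compA, E, comp1f, compf1.
Qed.

Lemma is_iso_epic (C : Category) (a b c : C) (h : Hom a b) (f g : Hom b c) :
  is_iso h -> f \o h == g \o h -> f == g.
Proof.
  intros [k [K _]] E. rewrite <- (compf1 f), <- (compf1 g), <- K, <- !compA. now rewrite E.
Qed.

(** * Spans of structured cospans *)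

Section Spans.
Context (A X : Category) (L : Functor A X).

Section Feet.
Context (a b c d : A) (M : SCospan L a b) (N : SCospan L c d) (s : SpanSC M N).

(** The arrows of the middle row, moved along the upper vertical isomorphisms to
    the feet of the top row. *)
Definition foot_l : Hom (L a) (sc_ob (s_mid s)) :=
  sc_l (s_mid s) \o fmap L (bwd (v_up (s_src s))).
Definition foot_r : Hom (L b) (sc_ob (s_mid s)) :=
  sc_r (s_mid s) \o fmap L (bwd (v_up (s_tgt s))).

Lemma up_foot_l : s_up s \o foot_l == sc_l M.
Proof.
  unfold foot_l. now rewrite <- compA, s_up_l, compA, <- fmap_comp, fwd_bwd, fmap_id, compf1.
Qed.

Lemma up_foot_r : s_up s \o foot_r == sc_r M.
Proof.
  unfold foot_r. now rewrite <- compA, s_up_r, compA, <- fmap_comp, fwd_bwd, fmap_id, compf1.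
Qed.

Lemma dn_foot_l : s_dn s \o foot_l == sc_l N \o fmap L (vmap (s_src s)).
Proof. unfold foot_l, vmap. now rewrite <- compA, s_dn_l, compA, <- fmap_comp. Qed.

Lemma dn_foot_r : s_dn s \o foot_r == sc_r N \o fmap L (vmap (s_tgt s)).
Proof. unfold foot_r, vmap. now rewrite <- compA, s_dn_r, compA, <- fmap_comp. Qed.

(** As the upper arrow is monic, a fine rewrite is an internal relation between
    the top and the bottom objects; it is studied through the pairs of
    generalized elements that it relates. *)
Definition related (w : X) (p : Hom w (sc_ob M)) (q : Hom w (sc_ob N)) : Prop :=
  rel_of (s_up s) (s_dn s) p q.

End Feet.

(** Comparing the universal related pair of each span with the other span gives
    arrows between the middle objects in both directions, mutually inverse because
    the upper arrows are monic.  As these arrows are monic, the isomorphism is also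
    compatible with the feet. *)
Lemma spansc_eq_related (a b c d : A) (M : SCospan L a b) (N : SCospan L c d)
  (s t : SpanSC M N) : fine s -> fine t ->
  (spansc_eq s t <->
   vmap (s_src s) == vmap (s_src t) /\ vmap (s_tgt s) == vmap (s_tgt t) /\
   forall (w : X) (p : Hom w (sc_ob M)) (q : Hom w (sc_ob N)),
     related s p q <-> related t p q).
Proof.
  intros [Fs _] [Ft _]. split.
  - intros (f & th & g & Hf & Hg & _ & _ & Hu & Hd). split; [|split].
    + apply vspan_eq_vmap. now exists f.
    + apply vspan_eq_vmap. now exists g.
    + intros w p q. split; intros [k [K1 K2]].
      * exists (th \o k). now rewrite <- !compA, Hu, Hd.
      * exists (bwd th \o k). rewrite <- Hu, <- Hd, !compA, <- !(compA th), fwd_bwd.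
        now rewrite comp1f.
  - intros (Hs & Ht & Hr).
    apply vspan_eq_vmap in Hs, Ht. destruct Hs as [f Hf], Ht as [g Hg].
    destruct (proj1 (Hr _ (s_up s) (s_dn s))) as [th [U D]].
    { exists (idm _). now rewrite !compf1. }
    destruct (proj2 (Hr _ (s_up t) (s_dn t))) as [th' [U' D']].
    { exists (idm _). now rewrite !compf1. }
    assert (E1 : th \o th' == idm _).
    { apply Ft. now rewrite <- compA, U, U', compf1. }
    assert (E2 : th' \o th == idm _).
    { apply Fs. now rewrite <- compA, U', U, compf1. }
    exists f, {| fwd_bwd := E1; bwd_fwd := E2 |}, g. cbn.
    repeat split; try apply Hf; try apply Hg; trivial.
    + apply Ft. rewrite <- !compA, U, s_up_l, s_up_l, compA, <- fmap_comp.
      now rewrite (proj1 Hf).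
    + apply Ft. rewrite <- !compA, U, s_up_r, s_up_r, compA, <- fmap_comp.
      now rewrite (proj1 Hg).
Qed.

(** Stated with an invertible upper arrow rather than an identity, so that graphs
    are closed under the compositions, whose upper arrows are only isomorphisms. *)
Definition is_graph (a b c d : A) (M : SCospan L a b) (N : SCospan L c d)
    (s : SpanSC M N) (phi : Hom (sc_ob M) (sc_ob N)) : Prop :=
  is_iso (s_up s) /\ s_dn s == phi \o s_up s.

Lemma graph_related (a b c d : A) (M : SCospan L a b) (N : SCospan L c d)
  (s : SpanSC M N) (phi : Hom (sc_ob M) (sc_ob N)) : is_graph s phi ->
  forall (w : X) (p : Hom w (sc_ob M)) (q : Hom w (sc_ob N)),
    related s p q <-> phi \o p == q.
Proof.
  intros [[k [K1 K2]] D] w p q. split.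
  - intros [h [H1 H2]]. now rewrite <- H1, <- H2, D, compA.
  - intros E. exists (k \o p). now rewrite D, compA, <- (compA _ k), K1, comp1f.
Qed.

Context (ch : Choices A X).

Lemma related_comp (a b c d e f : A) (M : SCospan L a b) (N : SCospan L c d)
  (P : SCospan L e f) (t : SpanSC N P) (s : SpanSC M N)
  (w : X) (p : Hom w (sc_ob M)) (q : Hom w (sc_ob P)) :
  related (spansc_comp ch t s) p q <-> exists r, related s p r /\ related t r q.
Proof.
  split.
  - cbn. intros [k [K1 K2]]. cbn in K1, K2, k.
    set (Q := pbX ch (s_dn s) (s_up t)) in *.
    exists (s_dn s \o (pb1 Q \o k)). split.
    + exists (pb1 Q \o k). split; [|reflexivity]. now rewrite <- compA.
    + exists (pb2 Q \o k). split; [|now rewrite <- compA].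
      now rewrite <- !compA, (pb_sq Q).
  - intros (r & [k [K1 K2]] & [l [L1 L2]]).
    assert (E : s_dn s \o k == s_up t \o l) by now rewrite K2, L1.
    exists (pb_pair (pbX ch (s_dn s) (s_up t)) E). cbn.
    now rewrite !compA, pb_pair1, pb_pair2.
Qed.

Section FeetOfVerticalComposite.
Context (a b c d e f : A) (M : SCospan L a b) (N : SCospan L c d) (P : SCospan L e f)
  (t : SpanSC N P) (s : SpanSC M N).

Lemma foot_l_comp :
  pb1 (pbX ch (s_dn s) (s_up t)) \o foot_l (spansc_comp ch t s) == foot_l s.
Proof.
  unfold foot_l. cbn -[pb_pair]. rewrite <- compA, pb_pair1, fmap_comp.
  set (Q := pbA ch (v_dn (s_src s)) (v_up (s_src t))).
  rewrite !compA. rewrite <- (compA (fmap L (pb1 Q))), <- fmap_comp, pb_pair1.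
  now rewrite fmap_id, comp1f.
Qed.

Lemma foot_r_comp :
  pb1 (pbX ch (s_dn s) (s_up t)) \o foot_r (spansc_comp ch t s) == foot_r s.
Proof.
  unfold foot_r. cbn -[pb_pair]. rewrite <- compA, pb_pair1, fmap_comp.
  set (Q := pbA ch (v_dn (s_tgt s)) (v_up (s_tgt t))).
  rewrite !compA. rewrite <- (compA (fmap L (pb1 Q))), <- fmap_comp, pb_pair1.
  now rewrite fmap_id, comp1f.
Qed.
End FeetOfVerticalComposite.

Section HorizontalMiddle.
Context (a b c a' b' c' : A) (M : SCospan L a b) (N : SCospan L b c)
  (M' : SCospan L a' b') (N' : SCospan L b' c') (s : SpanSC M M') (t : SpanSC N N')
  (e : vspan_eq (s_tgt s) (s_src t)).

Definition hmid1 : Hom (sc_ob (s_mid s)) (sc_ob (s_mid (spansc_hcomp ch e))) :=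
  po1 (poX ch (sc_r (s_mid s)) (sc_l (s_mid_glued s t))).
Definition hmid2 : Hom (sc_ob (s_mid t)) (sc_ob (s_mid (spansc_hcomp ch e))) :=
  po2 (poX ch (sc_r (s_mid s)) (sc_l (s_mid_glued s t))).

(** The pushout in the definition is taken over the foot of the middle row of [s];
    moving it along an isomorphism to the foot of the top row does not change it. *)
Lemma hmid_pushout : is_pushout (foot_r s) (foot_l t) hmid1 hmid2.
Proof.
  apply is_pushout_eq with (f := sc_r (s_mid s) \o fmap L (bwd (v_up (s_tgt s))))
    (g := sc_l (s_mid_glued s t) \o fmap L (bwd (v_up (s_tgt s)))).
  - reflexivity.
  - unfold foot_l. cbn. rewrite compA, <- fmap_comp, compA, fwd_bwd, compf1. reflexivity.
  - apply is_pushout_precomp, Pushout_is_pushout.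
    apply fmap_is_iso. apply (is_iso_iso (iso_inv (v_up (s_tgt s)))).
Qed.

Lemma up_hmid1 : s_up (spansc_hcomp ch e) \o hmid1 == po1 (poX ch (sc_r M) (sc_l N)) \o s_up s.
Proof. apply po_pair1. Qed.

Lemma up_hmid2 : s_up (spansc_hcomp ch e) \o hmid2 == po2 (poX ch (sc_r M) (sc_l N)) \o s_up t.
Proof. apply po_pair2. Qed.

Lemma dn_hmid1 :
  s_dn (spansc_hcomp ch e) \o hmid1 == po1 (poX ch (sc_r M') (sc_l N')) \o s_dn s.
Proof. apply po_pair1. Qed.

Lemma dn_hmid2 :
  s_dn (spansc_hcomp ch e) \o hmid2 == po2 (poX ch (sc_r M') (sc_l N')) \o s_dn t.
Proof. apply po_pair2. Qed.

Lemma hcomp_graph (phi : Hom (sc_ob M) (sc_ob M')) (psi : Hom (sc_ob N) (sc_ob N')) :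
  is_graph s phi -> is_graph t psi ->
  exists chi : Hom (po_ob (poX ch (sc_r M) (sc_l N))) (po_ob (poX ch (sc_r M') (sc_l N'))),
    is_graph (spansc_hcomp ch e) chi /\
    chi \o po1 (poX ch (sc_r M) (sc_l N)) == po1 (poX ch (sc_r M') (sc_l N')) \o phi /\
    chi \o po2 (poX ch (sc_r M) (sc_l N)) == po2 (poX ch (sc_r M') (sc_l N')) \o psi.
Proof.
  intros [Us Es] [Ut Et].
  pose proof (pushout_map_is_iso (Pushout_is_pushout _) hmid_pushout Us Ut
    (up_foot_r s) (up_foot_l t) up_hmid1 up_hmid2) as Uh.
  destruct (is_iso_extend (s_dn (spansc_hcomp ch e)) Uh) as [chi Hchi].
  exists chi. split; [|split].
  - now split.
  - apply (is_iso_epic Us). rewrite !compA, <- Es, <- up_hmid1, <- compA.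
    etransitivity; [|apply dn_hmid1]. rewrite Hchi. reflexivity.
  - apply (is_iso_epic Ut). rewrite !compA, <- Et, <- up_hmid2, <- compA.
    etransitivity; [|apply dn_hmid2]. rewrite Hchi. reflexivity.
Qed.

Lemma foot_l_hcomp : foot_l (spansc_hcomp ch e) == hmid1 \o foot_l s.
Proof. unfold foot_l. cbn. now rewrite compA. Qed.

Lemma foot_r_hcomp : foot_r (spansc_hcomp ch e) == hmid2 \o foot_r t.
Proof. unfold foot_r. cbn. now rewrite compA. Qed.
End HorizontalMiddle.

Context (HX : is_topos X).

(** The bottom row of a horizontal composite, as a pushout over the same foot of the
    top row as its middle row, so that the two pushouts can be compared by an arrow
    that fixes the foot. *)
Lemma dn_pushout (a b c a' b' c' : A) (M : SCospan L a b) (N : SCospan L b c)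
  (M' : SCospan L a' b') (N' : SCospan L b' c') (s : SpanSC M M') (t : SpanSC N N') :
  vspan_eq (s_tgt s) (s_src t) ->
  is_pushout (s_dn s \o foot_r s) (s_dn t \o foot_l t)
    (po1 (poX ch (sc_r M') (sc_l N'))) (po2 (poX ch (sc_r M') (sc_l N'))).
Proof.
  intros e. apply is_pushout_eq with (f := sc_r M' \o fmap L (vmap (s_tgt s)))
    (g := sc_l N' \o fmap L (vmap (s_tgt s))).
  - symmetry. apply dn_foot_r.
  - apply vspan_eq_vmap in e. rewrite e. symmetry. apply dn_foot_l.
  - apply is_pushout_precomp, Pushout_is_pushout. apply fmap_is_iso, vmap_is_iso.
Qed.

(** Both central arrows compare a pushout of subobjects with the pushout that
    contains them. *)
Lemma hcomp_fine : hcomp_preserves_fine L ch.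
Proof.
  intros a b c a' b' c' M N M' N' s t e [Us Ds] [Ut Dt]. split.
  - refine (proj1 (pushout_map_monic HX (Pushout_is_pushout _) (hmid_pushout e) Us Ut
      (up_foot_r s) (up_foot_l t) (up_hmid1 e) (up_hmid2 e))).
  - refine (proj1 (pushout_map_monic HX (dn_pushout e) (hmid_pushout e) Ds Dt
      _ _ (dn_hmid1 e) (dn_hmid2 e))); reflexivity.
Qed.

Lemma cmap_monic (x x' y y' : X) (f : Hom x y) (f' : Hom x' y') :
  monic f -> monic f' -> monic (cmap (cpX ch) f f').
Proof.
  intros Hf Hf'. destruct (initial_exists HX) as [z].
  refine (proj1 (pushout_map_monic HX (coproduct_is_pushout z _) (coproduct_is_pushout z _)
    Hf Hf' _ _ _ _)); try apply in_ext.
  - apply cp_pair1.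
  - apply cp_pair2.
Qed.

Lemma tens_fine (R : Functor X A) (adj : Adjunction L R) : tens_preserves_fine adj ch.
Proof. intros a b c d a' b' c' d' M N M' N' s s' [Us Ds] [Ut Dt]. split; now apply cmap_monic. Qed.
End Spans.

(** * Squares of the double category *)

Section Boundaries.
Context (A X : Category) (L : Functor A X) (R : Functor X A) (adj : Adjunction L R)
  (ch : Choices A X) (Hh : hcomp_preserves_fine L ch) (Ht : tens_preserves_fine adj ch).

Local Notation D := (FineRewrite Hh).
Local Notation T := (FineTensor Hh Ht).

Lemma vsrc_comp (a b c d e f : C0 D) (M : H a b) (N : H c d) (P : H e f)
  (t : Sq N P) (s : Sq M N) : vmap (src (t \s s)) == vmap (src t) \o vmap (src s).
Proof. apply (vmap_comp (ch := ch)). Qed.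

Lemma vtgt_comp (a b c d e f : C0 D) (M : H a b) (N : H c d) (P : H e f)
  (t : Sq N P) (s : Sq M N) : vmap (tgt (t \s s)) == vmap (tgt t) \o vmap (tgt s).
Proof. apply (vmap_comp (ch := ch)). Qed.

Lemma vsrc_id (a b : C0 D) (M : H a b) : vmap (src (sqid M)) == idm (a : A).
Proof. apply (vmap_id ch). Qed.

Lemma vtgt_id (a b : C0 D) (M : H a b) : vmap (tgt (sqid M)) == idm (b : A).
Proof. apply (vmap_id ch). Qed.

Lemma vsrc_U (a b : C0 D) (f : Hom a b) : vmap (src (sqU f)) == vmap f.
Proof. reflexivity. Qed.

Lemma vtgt_U (a b : C0 D) (f : Hom a b) : vmap (tgt (sqU f)) == vmap f.
Proof. reflexivity. Qed.

Section BoundariesOfComposites.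
Context (a b c a' b' c' : C0 D) (M : H a b) (N : H b c) (M' : H a' b') (N' : H b' c')
  (s : Sq M M') (t : Sq N N') (e : tgt s == src t).

Lemma vsrc_hsq : vmap (src (hsq e)) == vmap (src s).
Proof. reflexivity. Qed.

Lemma vtgt_hsq : vmap (tgt (hsq e)) == vmap (tgt t).
Proof. reflexivity. Qed.
End BoundariesOfComposites.

Lemma vsrc_tens (a b c d a' b' c' d' : C0 D) (M : H a b) (N : H c d) (M' : H a' b')
  (N' : H c' d') (s : Sq M N) (s' : Sq M' N') :
  vmap (src (sqtens T s s')) == cmap (cpA ch) (vmap (src s)) (vmap (src s')).
Proof. apply (vmap_tens (ch := ch)). Qed.

Lemma vtgt_tens (a b c d a' b' c' d' : C0 D) (M : H a b) (N : H c d) (M' : H a' b')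
  (N' : H c' d') (s : Sq M N) (s' : Sq M' N') :
  vmap (tgt (sqtens T s s')) == cmap (cpA ch) (vmap (tgt s)) (vmap (tgt s')).
Proof. apply (vmap_tens (ch := ch)). Qed.

End Boundaries.

Ltac vnorm :=
  repeat match goal with
  | |- context [src (sqcomp ?t ?s)] => rewrite (vsrc_comp t s)
  | |- context [tgt (sqcomp ?t ?s)] => rewrite (vtgt_comp t s)
  | |- context [src (sqid ?M)] => rewrite (vsrc_id M)
  | |- context [tgt (sqid ?M)] => rewrite (vtgt_id M)
  | |- context [src (sqU ?f)] => rewrite (vsrc_U f)
  | |- context [tgt (sqU ?f)] => rewrite (vtgt_U f)
  | |- context [src (hsq ?e)] => rewrite (vsrc_hsq e)
  | |- context [tgt (hsq ?e)] => rewrite (vtgt_hsq e)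
  | |- context [src (sqtens (FineTensor _ ?Ht) ?s ?t)] => rewrite (vsrc_tens Ht s t)
  | |- context [tgt (sqtens (FineTensor _ ?Ht) ?s ?t)] => rewrite (vtgt_tens Ht s t)
  end.

Section Squares.
Context (A X : Category) (L : Functor A X) (ch : Choices A X)
  (Hh : hcomp_preserves_fine L ch).

Local Notation D := (FineRewrite Hh).

Definition spn (a b c d : C0 D) (M : H a b) (N : H c d) (s : Sq M N) :
  @SpanSC A X L a b c d M N := fs_span s.

Local Notation mid s := (sc_ob (s_mid (spn s))).
Local Notation up s := (s_up (spn s)).
Local Notation dn s := (s_dn (spn s)).
Local Notation obj M := (@sc_ob A X L _ _ M).

Lemma up_monic (a b c d : C0 D) (M : H a b) (N : H c d) (s : Sq M N) : monic (up s).
Proof. exact (proj1 (fs_fine s)). Qed.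

Lemma dn_monic (a b c d : C0 D) (M : H a b) (N : H c d) (s : Sq M N) : monic (dn s).
Proof. exact (proj2 (fs_fine s)). Qed.

Lemma sq_eq (a b c d : C0 D) (M : H a b) (N : H c d) (s t : Sq M N) :
  s =s= t <->
  vmap (src s) == vmap (src t) /\ vmap (tgt s) == vmap (tgt t) /\
  forall (w : X) (p : Hom w (obj M)) (q : Hom w (obj N)),
    related (spn s) p q <-> related (spn t) p q.
Proof. apply spansc_eq_related; apply fs_fine. Qed.

Lemma C0_eq (a b : C0 D) (f g : Hom a b) : f == g <-> vmap f == vmap g.
Proof. apply vspan_eq_vmap. Qed.

(** ** Vertical composition *)

(** Vertical composition is the composition of relations, so that its laws are those
    of relations. *)
Lemma sq_related_comp (a b c d e f : C0 D) (M : H a b) (N : H c d) (P : H e f)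
  (t : Sq N P) (s : Sq M N) (w : X) (p : Hom w (obj M)) (q : Hom w (obj P)) :
  related (spn (t \s s)) p q <-> exists r, related (spn s) p r /\ related (spn t) r q.
Proof. apply related_comp. Qed.

Lemma sq_related_id (a b : C0 D) (M : H a b) (w : X) (p q : Hom w (obj M)) :
  related (spn (sqid M)) p q <-> p == q.
Proof.
  split.
  - intros [k [K1 K2]]. cbn in K1, K2. rewrite comp1f in K1, K2. now rewrite <- K1.
  - intros E. exists p. cbn. now rewrite comp1f.
Qed.

Lemma fine_C1_category : is_category (C1 D).
Proof.
  split.
  - intros M N. split.
    + intros s. now apply sq_eq.
    + intros s t E. apply sq_eq in E. apply sq_eq. destruct E as (E1 & E2 & E3).
      split; [easy|split; [easy|]]. intros. now rewrite E3.
    + intros s t r E F. apply sq_eq in E, F. apply sq_eq.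
      destruct E as (E1 & E2 & E3), F as (F1 & F2 & F3).
      split; [now rewrite E1|split; [now rewrite E2|]]. intros. now rewrite E3.
  - intros M N P t t' s s' E F. apply sq_eq in E, F.
    destruct E as (E1 & E2 & E3), F as (F1 & F2 & F3).
    change (t \s s =s= t' \s s'). rewrite sq_eq. vnorm.
    split; [now rewrite E1, F1|split; [now rewrite E2, F2|]].
    intros w p q. rewrite !sq_related_comp.
    split; intros (r & H1 & H2); exists r; (split; [now apply F3|now apply E3]).
  - intros M N s. change (sqid (harr N) \s s =s= s). rewrite sq_eq. vnorm.
    split; [apply comp1f|split; [apply comp1f|]]. intros w p q.
    rewrite sq_related_comp. split.
    + intros (r & H1 & E). apply sq_related_id in E. unfold related. now rewrite <- E.
    + intros H1. exists q. split; [exact H1|]. now apply sq_related_id.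
  - intros M N s. change (s \s sqid (harr M) =s= s). rewrite sq_eq. vnorm.
    split; [apply compf1|split; [apply compf1|]]. intros w p q.
    rewrite sq_related_comp. split.
    + intros (r & E & H1). apply sq_related_id in E. unfold related. now rewrite E.
    + intros H1. exists p. split; [|exact H1]. now apply sq_related_id.
  - intros M N P Q r t s. change (r \s (t \s s) =s= r \s t \s s).
    rewrite sq_eq. vnorm.
    split; [now rewrite compA|split; [now rewrite compA|]]. intros w p q.
    rewrite !sq_related_comp. split.
    + intros (y & Hy & Hr). apply sq_related_comp in Hy. destruct Hy as (x & Hs & Ht').
      exists x. split; [exact Hs|]. apply sq_related_comp. now exists y.
    + intros (x & Hs & Hx). apply sq_related_comp in Hx. destruct Hx as (y & Ht' & Hr).
      exists y. split; [|exact Hr]. apply sq_related_comp. now exists x.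
Qed.

(** ** Graphs *)

Section Graphs.
Context (a b c d : C0 D) (M : H a b) (N : H c d).

Lemma sq_graph_eq (s t : Sq M N) (phi psi : Hom (obj M) (obj N)) :
  is_graph (spn s) phi -> is_graph (spn t) psi ->
  vmap (src s) == vmap (src t) -> vmap (tgt s) == vmap (tgt t) -> phi == psi ->
  s =s= t.
Proof.
  intros Gs Gt E1 E2 E. apply sq_eq. split; [easy|split; [easy|]]. intros w p q.
  rewrite (graph_related Gs), (graph_related Gt). now rewrite E.
Qed.

Lemma graph_monic (s : Sq M N) (phi : Hom (obj M) (obj N)) :
  is_graph (spn s) phi -> monic phi.
Proof.
  intros [[k [K1 K2]] E] w u v Euv. rewrite <- (comp1f u), <- (comp1f v), <- K1, !compA.
  assert (Hk : k \o u == k \o v); [|now rewrite Hk].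
  apply (dn_monic (s := s)). rewrite E, !compA, <- !(compA _ k), K1, !comp1f. exact Euv.
Qed.
End Graphs.

Lemma graph_id (a b : C0 D) (M : H a b) : is_graph (spn (sqid M)) (idm (obj M)).
Proof. split; [apply (is_iso_iso (iso_id (obj M)))|]. cbn. now rewrite comp1f. Qed.

(** The upper arrow of the composite is monic and has a section, the pairing of an
    element with its image. *)
Lemma graph_comp (a b c d e f : C0 D) (M : H a b) (N : H c d) (P : H e f)
  (t : Sq N P) (s : Sq M N) (phi : Hom (obj M) (obj N)) (psi : Hom (obj N) (obj P)) :
  is_graph (spn t) psi -> is_graph (spn s) phi -> is_graph (spn (t \s s)) (psi \o phi).
Proof.
  intros [[k [K1 K2]] Et] [[l [L1 L2]] Es].
  set (Q := pbX ch (dn s) (up t)).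
  assert (Ed : dn (t \s s) == (psi \o phi) \o up (t \s s)).
  { change (dn t \o pb2 Q == (psi \o phi) \o (up s \o pb1 Q)).
    transitivity (psi \o (up t \o pb2 Q)); [now rewrite <- compA, <- Et|].
    rewrite <- (pb_sq Q), !compA. rewrite <- (compA phi). now rewrite <- Es. }
  split; [|exact Ed].
  assert (E : dn s \o l == up t \o (k \o (dn s \o l))).
  { now rewrite <- (compA (up t)), K1, comp1f. }
  apply (monic_section_is_iso (up_monic (s := t \s s)) (g := pb_pair Q E)).
  change ((up s \o pb1 Q) \o pb_pair Q E == idm (obj M)). now rewrite compA, pb_pair1.
Qed.

Lemma graph_U (a b : C0 D) (f : Hom a b) : is_graph (spn (sqU f)) (fmap L (vmap f)).
Proof.
  split.
  - apply fmap_is_iso, is_iso_iso.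
  - cbn. rewrite <- fmap_comp. apply fmap_proper, vmap_dn.
Qed.

(** ** Functoriality of the compositions *)

Lemma sq_mid_map (a b c d : C0 D) (M : H a b) (N : H c d) (s t : Sq M N) :
  s =s= t -> exists th : Hom (mid s) (mid t), up t \o th == up s /\ dn t \o th == dn s.
Proof. intros (f & th & g & _ & _ & _ & _ & U & E). now exists th. Qed.

Section HorizontalProper.
Context (a b c a' b' c' : C0 D) (M : H a b) (N : H b c) (M' : H a' b') (N' : H b' c')
  (s s' : Sq M M') (t t' : Sq N N') (e : tgt s == src t) (e' : tgt s' == src t').

Lemma hsq_related_le (th : Hom (mid s) (mid s')) (th' : Hom (mid t) (mid t'))
  (w : X) (p : Hom w (obj (M (.) N))) (q : Hom w (obj (M' (.) N'))) :
  up s' \o th == up s -> dn s' \o th == dn s ->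
  up t' \o th' == up t -> dn t' \o th' == dn t ->
  related (spn (hsq e)) p q -> related (spn (hsq e')) p q.
Proof.
  intros U D' U' D'' [k [K1 K2]].
  assert (E : (hmid1 ch e' \o th) \o foot_r (spn s) == (hmid2 ch e' \o th') \o foot_l (spn t)).
  { transitivity (hmid1 ch e' \o foot_r (spn s')).
    - rewrite compA. assert (F : th \o foot_r (spn s) == foot_r (spn s')); [|now rewrite F].
      apply (up_monic (s := s')). now rewrite <- compA, U, !up_foot_r.
    - transitivity (hmid2 ch e' \o foot_l (spn t')); [apply (hmid_pushout ch e')|].
      rewrite compA. assert (F : th' \o foot_l (spn t) == foot_l (spn t')); [|now rewrite F].
      apply (up_monic (s := t')). now rewrite <- compA, U', !up_foot_l. }
  pose proof (hmid_pushout ch e) as HQ.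
  destruct (proj2 HQ _ _ _ E) as [h [[H1 H2] _]].
  exists (h \o k). rewrite <- K1, <- K2, <- !compA. split.
  - assert (F : up (hsq e') \o h == up (hsq e)); [|now rewrite F].
    apply (is_pushout_ext HQ); rewrite compA.
    + rewrite H1, <- compA. etransitivity; [|symmetry; apply (up_hmid1 ch e)].
      rewrite <- U, <- compA.
      assert (G := up_hmid1 ch e'). now rewrite G.
    + rewrite H2, <- compA. etransitivity; [|symmetry; apply (up_hmid2 ch e)].
      rewrite <- U', <- compA.
      assert (G := up_hmid2 ch e'). now rewrite G.
  - assert (F : dn (hsq e') \o h == dn (hsq e)); [|now rewrite F].
    apply (is_pushout_ext HQ); rewrite compA.
    + rewrite H1, <- compA. etransitivity; [|symmetry; apply (dn_hmid1 ch e)].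
      rewrite <- D', <- compA.
      assert (G := dn_hmid1 ch e'). now rewrite G.
    + rewrite H2, <- compA. etransitivity; [|symmetry; apply (dn_hmid2 ch e)].
      rewrite <- D'', <- compA.
      assert (G := dn_hmid2 ch e'). now rewrite G.
Qed.
End HorizontalProper.

Lemma fine_hsq_proper (a b c a' b' c' : C0 D) (M : H a b) (N : H b c) (M' : H a' b')
  (N' : H b' c') (s s' : Sq M M') (t t' : Sq N N')
  (e : tgt s == src t) (e' : tgt s' == src t') :
  s =s= s' -> t =s= t' -> hsq e =s= hsq e'.
Proof.
  intros Es Et.
  destruct (sq_mid_map Es) as (th & U & D1), (sq_mid_map Et) as (th' & U' & D1').
  pose proof (proj1 (sq_eq s s') Es) as (S1 & S2 & S3).
  pose proof (proj1 (sq_eq t t') Et) as (T1 & T2 & T3).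
  destruct (@sq_mid_map _ _ _ _ _ _ s' s) as (k & V & G1).
  { apply sq_eq. split; [easy|split; [easy|]]. intros. now rewrite S3. }
  destruct (@sq_mid_map _ _ _ _ _ _ t' t) as (k' & V' & G1').
  { apply sq_eq. split; [easy|split; [easy|]]. intros. now rewrite T3. }
  apply sq_eq. vnorm. split; [exact S1|split; [exact T2|]].
  intros w p q. split; eapply hsq_related_le; eassumption.
Qed.
End Squares.

(** * The exchange laws *)

(** [comp_chain] and [square_paste] are the diagram chases by which the arrows from
    the middle row to the outer rows are compared, isolated because rewriting inside
    composites of squares is slow. *)
Lemma comp_chain (C : Category) (a b c d e f h : C) (u : Hom a b) (m : Hom c a)
  (p : Hom d b) (u0 : Hom c d) (q : Hom e a) (i : Hom f e) (k : Hom f c)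
  (th : Hom h e) (n : Hom f h) :
  u \o m == p \o u0 -> q \o i == m \o k -> th \o n == i ->
  ((u \o q) \o th) \o n == p \o (u0 \o k).
Proof. intros E1 E2 E3. now rewrite !compA, E3, E2, (precomp2 E1). Qed.

Lemma square_paste (C : Category) (a b c d e f h : C) (u : Hom a b) (m : Hom c a)
  (p : Hom d b) (u0 : Hom c d) (k : Hom h c) (l : Hom h f) (v0 : Hom f d)
  (n : Hom f e) (v : Hom e b) :
  u \o m == p \o u0 -> u0 \o k == v0 \o l -> v \o n == p \o v0 ->
  u \o (m \o k) == v \o (n \o l).
Proof. intros E1 E2 E3. now rewrite (precomp2 E1), E2, (precomp2 E3). Qed.

Section Interchange.
Context (A X : Category) (L : Functor A X) (R : Functor X A) (adj : Adjunction L R)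
  (ch : Choices A X) (Hh : hcomp_preserves_fine L ch) (Ht : tens_preserves_fine adj ch).

Local Notation D := (FineRewrite Hh).
Local Notation T := (FineTensor Hh Ht).
Local Notation mid s := (sc_ob (s_mid (spn s))).
Local Notation up s := (s_up (spn s)).
Local Notation dn s := (s_dn (spn s)).
Local Notation obj M := (@sc_ob A X L _ _ M).
Context (HX : is_topos X).

Lemma related_mid (a b c d : C0 D) (M : H a b) (N : H c d) (s t : Sq M N)
  (th : Hom (mid s) (mid t)) (th' : Hom (mid t) (mid s)) :
  up t \o th == up s -> dn t \o th == dn s -> th \o th' == idm (mid t) ->
  forall (w : X) (p : Hom w (obj M)) (q : Hom w (obj N)),
    related (spn s) p q <-> related (spn t) p q.
Proof.
  intros U V W w p q. split; intros [k [K1 K2]].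
  - exists (th \o k). now rewrite <- !compA, U, V.
  - exists (th' \o k). now rewrite <- U, <- V, !compA, (precomp W), comp1f.
Qed.

Section Exchange.
Context (a b c a' b' c' a'' b'' c'' : C0 D)
  (M : H a b) (N : H b c) (M' : H a' b') (N' : H b' c') (M'' : H a'' b'') (N'' : H b'' c'')
  (s : Sq M M') (t : Sq N N') (s' : Sq M' M'') (t' : Sq N' N'')
  (e : tgt s == src t) (e' : tgt s' == src t') (e'' : tgt (s' \s s) == src (t' \s t)).

Let Ps := pbX ch (dn s) (up s').
Let Pt := pbX ch (dn t) (up t').
Let Q := pbX ch (dn (hsq e)) (up (hsq e')).

(** The middle object of the horizontal composite of two vertical composites is a
    pushout of intersections, and that of the vertical composite of two
    horizontal composites an intersection of pushouts, all inside the composite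
    of [M'] and [N']: they agree by [pushout_intersection]. *)
Lemma exchange_pushout :
  exists (i : Hom (pb_ob Ps) (pb_ob Q)) (j : Hom (pb_ob Pt) (pb_ob Q)),
    is_pushout (foot_r (spn (s' \s s))) (foot_l (spn (t' \s t))) i j /\
    pb1 Q \o i == hmid1 ch e \o pb1 Ps /\ pb2 Q \o i == hmid1 ch e' \o pb2 Ps /\
    pb1 Q \o j == hmid2 ch e \o pb1 Pt /\ pb2 Q \o j == hmid2 ch e' \o pb2 Pt.
Proof.
  assert (Ei : dn (hsq e) \o (hmid1 ch e \o pb1 Ps) == up (hsq e') \o (hmid1 ch e' \o pb2 Ps)).
  { exact (square_paste (dn_hmid1 ch e) (pb_sq Ps) (up_hmid1 ch e')). }
  assert (Ej : dn (hsq e) \o (hmid2 ch e \o pb1 Pt) == up (hsq e') \o (hmid2 ch e' \o pb2 Pt)).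
  { exact (square_paste (dn_hmid2 ch e) (pb_sq Pt) (up_hmid2 ch e')). }
  exists (pb_pair Q Ei), (pb_pair Q Ej).
  assert (Hiso : is_iso (fmap L (vmap (tgt s)))) by apply fmap_is_iso, vmap_is_iso.
  split; [|repeat split; first [apply pb_pair1|apply pb_pair2]].
  refine (pushout_intersection HX (dn_pushout ch e) (hmid_pushout ch e)
    (is_pushout_precomp Hiso (hmid_pushout ch e'))
    (dn_monic (s := s)) (dn_monic (s := t)) (up_monic (s := s')) (up_monic (s := t'))
    _ _ _ _ (dn_hmid1 ch e) (dn_hmid2 ch e) (up_hmid1 ch e') (up_hmid2 ch e')
    _ _ (pb_pair1 Q Ei) (pb_pair1 Q Ej)).
  - reflexivity.
  - reflexivity.
  - rewrite <- compA, up_foot_r. symmetry. apply dn_foot_r.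
  - rewrite <- compA, up_foot_l. rewrite (proj1 (C0_eq _ _) e). symmetry. apply dn_foot_l.
  - apply foot_r_comp.
  - apply foot_l_comp.
Qed.

Lemma fine_hsq_comp : hsq e'' =s= hsq e' \s hsq e.
Proof.
  destruct exchange_pushout as (i & j & HI & I1 & I2 & J1 & J2).
  pose proof (hmid_pushout ch e'') as HQ.
  destruct (proj2 HQ _ _ _ (proj1 HI)) as [th [[T1 T2] _]].
  destruct (proj2 HI _ _ _ (proj1 HQ)) as [th' [[T1' T2'] _]].
  assert (U : (up (hsq e) \o pb1 Q) \o th == up (hsq e'')).
  { apply (is_pushout_ext HQ).
    - exact (transitivity (comp_chain (up_hmid1 ch e) I1 T1) (symmetry (up_hmid1 ch e''))).
    - exact (transitivity (comp_chain (up_hmid2 ch e) J1 T2) (symmetry (up_hmid2 ch e''))). }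
  assert (V : (dn (hsq e') \o pb2 Q) \o th == dn (hsq e'')).
  { apply (is_pushout_ext HQ).
    - exact (transitivity (comp_chain (dn_hmid1 ch e') I2 T1) (symmetry (dn_hmid1 ch e''))).
    - exact (transitivity (comp_chain (dn_hmid2 ch e') J2 T2) (symmetry (dn_hmid2 ch e''))). }
  assert (W : th \o th' == idm (pb_ob Q)).
  { apply (is_pushout_ext HI); rewrite compA, comp1f.
    - now rewrite T1', T1.
    - now rewrite T2', T2. }
  apply sq_eq. vnorm. split; [reflexivity|split; [reflexivity|]].
  exact (related_mid (s := hsq e'') (t := hsq e' \s hsq e) U V W).
Qed.
End Exchange.

Section TensorExchange.
Context (a b a' b' a'' b'' c d c' d' c'' d'' : C0 D)
  (M : H a b) (M' : H a' b') (M'' : H a'' b'') (N : H c d) (N' : H c' d') (N'' : H c'' d'')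
  (s : Sq M M') (s' : Sq M' M'') (t : Sq N N') (t' : Sq N' N'').

Let Ps := pbX ch (dn s) (up s').
Let Pt := pbX ch (dn t) (up t').
Let Q := pbX ch (dn (sqtens T s t)) (up (sqtens T s' t')).

(** The case of the exchange law in which the pushouts are over the initial object. *)
Lemma fine_sqtens_comp :
  sqtens T (s' \s s) (t' \s t) =s= sqtens T s' t' \s sqtens T s t.
Proof.
  destruct (initial_exists HX) as [z].
  pose (cs := cpX ch (mid s) (mid t)). pose (cs' := cpX ch (mid s') (mid t')).
  pose (cP := cpX ch (pb_ob Ps) (pb_ob Pt)).
  assert (D1 : dn (sqtens T s t) \o cp1 cs == cp1 (cpX ch (obj M') (obj N')) \o dn s)
    by apply cp_pair1.
  assert (D2 : dn (sqtens T s t) \o cp2 cs == cp2 (cpX ch (obj M') (obj N')) \o dn t)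
    by apply cp_pair2.
  assert (U1 : up (sqtens T s' t') \o cp1 cs' == cp1 (cpX ch (obj M') (obj N')) \o up s')
    by apply cp_pair1.
  assert (U2 : up (sqtens T s' t') \o cp2 cs' == cp2 (cpX ch (obj M') (obj N')) \o up t')
    by apply cp_pair2.
  assert (Ei : dn (sqtens T s t) \o (cp1 cs \o pb1 Ps)
    == up (sqtens T s' t') \o (cp1 cs' \o pb2 Ps)).
  { exact (square_paste D1 (pb_sq Ps) U1). }
  assert (Ej : dn (sqtens T s t) \o (cp2 cs \o pb1 Pt)
    == up (sqtens T s' t') \o (cp2 cs' \o pb2 Pt)).
  { exact (square_paste D2 (pb_sq Pt) U2). }
  set (i := pb_pair Q Ei). set (j := pb_pair Q Ej).
  assert (HI : is_pushout (in_map z _) (in_map z _) i j).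
  { refine (pushout_intersection HX (coproduct_is_pushout z (cpX ch (obj M') (obj N')))
      (coproduct_is_pushout z cs) (coproduct_is_pushout z cs')
      (dn_monic (s := s)) (dn_monic (s := t)) (up_monic (s := s')) (up_monic (s := t'))
      _ _ _ _ D1 D2 U1 U2 _ _ (pb_pair1 Q Ei) (pb_pair1 Q Ej)); apply in_ext. }
  pose proof (coproduct_is_pushout z cP) as HQ.
  destruct (proj2 HQ _ _ _ (proj1 HI)) as [th [[T1 T2] _]].
  destruct (proj2 HI _ _ _ (proj1 HQ)) as [th' [[T1' T2'] _]].
  assert (W : th \o th' == idm (pb_ob Q)).
  { apply (is_pushout_ext HI); rewrite compA, comp1f.
    - now rewrite T1', T1.
    - now rewrite T2', T2. }
  assert (U : (up (sqtens T s t) \o pb1 Q) \o th == up (sqtens T (s' \s s) (t' \s t))).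
  { apply (cp_ext (c := cP)).
    - exact (transitivity
        (comp_chain (cp_pair1 cs (_ \o up s) (_ \o up t)) (pb_pair1 Q Ei) T1)
        (symmetry (cp_pair1 cP (_ \o (up s \o pb1 Ps)) (_ \o (up t \o pb1 Pt))))).
    - exact (transitivity
        (comp_chain (cp_pair2 cs (_ \o up s) (_ \o up t)) (pb_pair1 Q Ej) T2)
        (symmetry (cp_pair2 cP (_ \o (up s \o pb1 Ps)) (_ \o (up t \o pb1 Pt))))). }
  assert (V : (dn (sqtens T s' t') \o pb2 Q) \o th == dn (sqtens T (s' \s s) (t' \s t))).
  { apply (cp_ext (c := cP)).
    - exact (transitivity
        (comp_chain (cp_pair1 cs' (_ \o dn s') (_ \o dn t')) (pb_pair2 Q Ei) T1)
        (symmetry (cp_pair1 cP (_ \o (dn s' \o pb2 Ps)) (_ \o (dn t' \o pb2 Pt))))).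
    - exact (transitivity
        (comp_chain (cp_pair2 cs' (_ \o dn s') (_ \o dn t')) (pb_pair2 Q Ej) T2)
        (symmetry (cp_pair2 cP (_ \o (dn s' \o pb2 Ps)) (_ \o (dn t' \o pb2 Pt))))). }
  apply sq_eq. split; [|split].
  - vnorm. apply cmap_comp.
  - vnorm. apply cmap_comp.
  - exact (related_mid (s := sqtens T (s' \s s) (t' \s t))
      (t := sqtens T s' t' \s sqtens T s t) U V W).
Qed.
End TensorExchange.

Lemma fine_sqtens_proper (a b c d a' b' c' d' : C0 D) (M : H a b) (N : H c d)
  (M' : H a' b') (N' : H c' d') (s t : Sq M N) (s' t' : Sq M' N') :
  s =s= t -> s' =s= t' -> sqtens T s s' =s= sqtens T t t'.
Proof.
  intros E E'. pose proof (proj1 (sq_eq s t) E) as (E1 & E2 & _).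
  pose proof (proj1 (sq_eq s' t') E') as (E1' & E2' & _).
  destruct E as (f & th & g & _ & _ & _ & _ & U & V).
  destruct E' as (f' & th' & g' & _ & _ & _ & _ & U' & V').
  apply sq_eq. split; [|split].
  - vnorm. now rewrite E1, E1'.
  - vnorm. now rewrite E2, E2'.
  - apply (related_mid (s := sqtens T s s') (t := sqtens T t t')
      (th := cmap (cpX ch) th th') (th' := cmap (cpX ch) (bwd th) (bwd th'))).
    + change (cmap (cpX ch) (up t) (up t') \o cmap (cpX ch) th th'
        == cmap (cpX ch) (up s) (up s')).
      rewrite <- cmap_comp. now apply cmap_proper.
    + change (cmap (cpX ch) (dn t) (dn t') \o cmap (cpX ch) th th'
        == cmap (cpX ch) (dn s) (dn s')).
      rewrite <- cmap_comp. now apply cmap_proper.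
    + change (cmap (cpX ch) th th' \o cmap (cpX ch) (bwd th) (bwd th')
        == idm (cp_ob (cpX ch (mid t) (mid t')))).
      rewrite <- cmap_comp. etransitivity; [|apply cmap_id].
      apply cmap_proper; apply fwd_bwd.
Qed.
End Interchange.

(** * Comparison of iterated pushouts *)

Lemma pushout_unique (C : Category) (a b c p p' : C) (f : Hom c a) (g : Hom c b)
  (p1 : Hom a p) (p2 : Hom b p) (p1' : Hom a p') (p2' : Hom b p') :
  is_pushout f g p1 p2 -> is_pushout f g p1' p2' ->
  exists i : Iso p p', i \o p1 == p1' /\ i \o p2 == p2'.
Proof.
  intros H H'.
  destruct (proj2 H _ _ _ (proj1 H')) as [i [[I1 I2] _]].
  destruct (proj2 H' _ _ _ (proj1 H)) as [j [[J1 J2] _]].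
  unshelve eexists {| fwd := i; bwd := j |}.
  - apply (is_pushout_ext H'); rewrite compA, comp1f.
    + now rewrite J1.
    + now rewrite J2.
  - apply (is_pushout_ext H); rewrite compA, comp1f.
    + now rewrite I1.
    + now rewrite I2.
  - now split.
Qed.

Section Associativity.
Context (C : Category) (c d x y z P Q Lo Ro : C)
  (f : Hom c x) (g : Hom c y) (h : Hom d y) (k : Hom d z)
  (p1 : Hom x P) (p2 : Hom y P) (q1 : Hom y Q) (q2 : Hom z Q)
  (l1 : Hom P Lo) (l2 : Hom z Lo) (r1 : Hom x Ro) (r2 : Hom Q Ro)
  (HP : is_pushout f g p1 p2) (HQ : is_pushout h k q1 q2)
  (HL : is_pushout (p2 \o h) k l1 l2) (HR : is_pushout f (q1 \o g) r1 r2).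

Lemma pushout_assoc_ext (w : C) (u v : Hom Lo w) :
  u \o (l1 \o p1) == v \o (l1 \o p1) -> u \o (l1 \o p2) == v \o (l1 \o p2) ->
  u \o l2 == v \o l2 -> u == v.
Proof.
  intros E1 E2 E3. apply (is_pushout_ext HL); [|exact E3].
  apply (is_pushout_ext HP); now rewrite !compA.
Qed.

(** Both sides are colimits of the same zigzag, the objects [x], [y] and [z] glued
    along [c] and [d]. *)
Lemma pushout_assoc :
  exists i : Iso Lo Ro,
    i \o (l1 \o p1) == r1 /\ i \o (l1 \o p2) == r2 \o q1 /\ i \o l2 == r2 \o q2.
Proof.
  assert (Em : (l1 \o p2) \o h == l2 \o k) by (rewrite compA; apply HL).
  destruct (proj2 HQ _ _ _ Em) as [m [[M1 M2] _]].
  assert (H : is_pushout f (q1 \o g) (l1 \o p1) m).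
  { split; [rewrite compA, (proj1 HP), <- (compA m), M1; now rewrite compA|].
    intros w u v E.
    assert (E1 : u \o f == (v \o q1) \o g) by now rewrite compA.
    destruct (proj2 HP _ _ _ E1) as [s [[S1 S2] _]].
    assert (E2 : s \o (p2 \o h) == (v \o q2) \o k).
    { rewrite <- compA, S2, !compA. now rewrite (proj1 HQ). }
    destruct (proj2 HL _ _ _ E2) as [t [[T1 T2] _]].
    assert (Ht : t \o (l1 \o p1) == u /\ t \o m == v).
    { split; [now rewrite <- compA, T1|].
      apply (is_pushout_ext HQ); rewrite compA.
      - now rewrite M1, (precomp T1).
      - now rewrite M2. }
    exists t. split; [exact Ht|]. intros t' [T1' T2']. apply pushout_assoc_ext.
    - now rewrite T1', (proj1 Ht).
    - now rewrite <- M1, <- !compA, T2', (proj2 Ht).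
    - now rewrite <- M2, <- !compA, T2', (proj2 Ht). }
  destruct (pushout_unique H HR) as [i [I1 I2]]. exists i. split; [exact I1|].
  now rewrite <- M1, <- M2, (precomp I2), (precomp I2).
Qed.
End Associativity.

(** Used with [i] between the middle rows and [i'] between the upper or the lower
    rows: the maps between iterated pushouts that are induced by [ux], [uy] and [uz]
    commute with the associativity isomorphisms. *)
Lemma pushout_assoc_nat (C : Category)
  (c d x y z P Q Lo Ro x' y' z' P' Q' Lo' Ro' : C)
  (f : Hom c x) (g : Hom c y) (h : Hom d y) (k : Hom d z)
  (p1 : Hom x P) (p2 : Hom y P) (q1 : Hom y Q) (q2 : Hom z Q)
  (l1 : Hom P Lo) (l2 : Hom z Lo) (r1 : Hom x Ro) (r2 : Hom Q Ro)
  (p1' : Hom x' P') (p2' : Hom y' P') (q1' : Hom y' Q') (q2' : Hom z' Q')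
  (l1' : Hom P' Lo') (l2' : Hom z' Lo') (r1' : Hom x' Ro') (r2' : Hom Q' Ro')
  (i : Hom Lo Ro) (i' : Hom Lo' Ro')
  (ux : Hom x x') (uy : Hom y y') (uz : Hom z z') (uP : Hom P P') (uQ : Hom Q Q')
  (uL : Hom Lo Lo') (uR : Hom Ro Ro') :
  is_pushout f g p1 p2 -> is_pushout (p2 \o h) k l1 l2 ->
  i \o (l1 \o p1) == r1 /\ i \o (l1 \o p2) == r2 \o q1 /\ i \o l2 == r2 \o q2 ->
  i' \o (l1' \o p1') == r1' /\ i' \o (l1' \o p2') == r2' \o q1' /\ i' \o l2' == r2' \o q2' ->
  uP \o p1 == p1' \o ux -> uP \o p2 == p2' \o uy ->
  uQ \o q1 == q1' \o uy -> uQ \o q2 == q2' \o uz ->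
  uL \o l1 == l1' \o uP -> uL \o l2 == l2' \o uz ->
  uR \o r1 == r1' \o ux -> uR \o r2 == r2' \o uQ ->
  uR \o i == i' \o uL.
Proof.
  intros HP HL (I1 & I2 & I3) (I1' & I2' & I3') P1 P2 Q1 Q2 L1 L2 R1 R2.
  apply (pushout_assoc_ext HP HL); rewrite !compA.
  - rewrite I1, R1, (precomp2 L1), P1, <- I1'. now rewrite !compA.
  - rewrite I2, (precomp2 R2), Q1, (precomp2 L1), P2, <- (compA r2'), <- I2'.
    now rewrite !compA.
  - rewrite I3, (precomp2 R2), Q2, L2, <- (compA r2'), <- I3'. now rewrite !compA.
Qed.

Lemma pushout_of_iso (C : Category) (a b c p : C) (i : Hom c a) (g : Hom c b)
  (p1 : Hom a p) (p2 : Hom b p) : is_iso i -> is_pushout i g p1 p2 ->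
  exists th : Iso p b, th \o p2 == idm b /\ th \o (p1 \o i) == g.
Proof.
  intros [j [J1 J2]] H.
  assert (H' : is_pushout i g (g \o j) (idm b)).
  { split; [now rewrite compA, J2, compf1, comp1f|].
    intros d u v E. exists v. split.
    - split; [|apply compf1]. now rewrite <- compA, <- E, compA, J1, compf1.
    - intros w [_ W]. now rewrite <- W, compf1. }
  destruct (pushout_unique H H') as [th [T1 T2]]. exists th. split; [exact T2|].
  now rewrite <- compA, T1, compA, J2, compf1.
Qed.

(** Colimits commute with colimits: a coproduct of pushouts is a pushout of
    coproducts. *)
Lemma pushout_coproduct (C : Category) (c c' x x' y y' P P' W : C)
  (r : Hom c x) (l : Hom c y) (r' : Hom c' x') (l' : Hom c' y')
  (p1 : Hom x P) (p2 : Hom y P) (p1' : Hom x' P') (p2' : Hom y' P')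
  (cc : Coproduct c c') (cx : Coproduct x x') (cy : Coproduct y y') (cP : Coproduct P P')
  (t1 : Hom (cp_ob cx) W) (t2 : Hom (cp_ob cy) W) :
  is_pushout r l p1 p2 -> is_pushout r' l' p1' p2' ->
  is_pushout (cp_map cc cx r r') (cp_map cc cy l l') t1 t2 ->
  exists i : Iso W (cp_ob cP), i \o t1 == cp_map cx cP p1 p1' /\ i \o t2 == cp_map cy cP p2 p2'.
Proof.
  intros H H' HW. apply (pushout_unique HW). unfold cp_map. split.
  - apply cp_ext; cp_norm.
    + now rewrite (proj1 H).
    + now rewrite (proj1 H').
  - intros d u v E.
    assert (E1 : (u \o cp1 cx) \o r == (v \o cp1 cy) \o l).
    { transitivity ((u \o cp_pair cc (cp1 cx \o r) (cp2 cx \o r')) \o cp1 cc).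
      - now cp_norm.
      - rewrite E. now cp_norm. }
    assert (E2 : (u \o cp2 cx) \o r' == (v \o cp2 cy) \o l').
    { transitivity ((u \o cp_pair cc (cp1 cx \o r) (cp2 cx \o r')) \o cp2 cc).
      - now cp_norm.
      - rewrite E. now cp_norm. }
    destruct (proj2 H _ _ _ E1) as [s [[S1 S2] _]].
    destruct (proj2 H' _ _ _ E2) as [s' [[S1' S2'] _]].
    exists (cp_pair cP s s'). split.
    + split; apply cp_ext; cp_norm; trivial.
    + intros w [W1 W2]. apply cp_ext; cp_norm.
      * apply (is_pushout_ext H).
        -- rewrite S1, <- W1. now cp_norm.
        -- rewrite S2, <- W2. now cp_norm.
      * apply (is_pushout_ext H').
        -- rewrite S1', <- W1. now cp_norm.
        -- rewrite S2', <- W2. now cp_norm.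
Qed.

(** * Invertible squares from isomorphisms of structured cospans *)

Record CospanIso (A X : Category) (L : Functor A X) (a b c d : A)
    (M : SCospan L a b) (N : SCospan L c d) := {
  ci_src : Iso a c;
  ci_tgt : Iso b d;
  ci_map : Iso (sc_ob M) (sc_ob N);
  ci_l : ci_map \o sc_l M == sc_l N \o fmap L ci_src;
  ci_r : ci_map \o sc_r M == sc_r N \o fmap L ci_tgt
}.

Lemma iso_square_inv (A X : Category) (L : Functor A X) (a c : A) (x y : X) (i : Iso a c)
  (phi : Iso x y) (l : Hom (L a) x) (m : Hom (L c) y) :
  phi \o l == m \o fmap L i -> bwd phi \o m == l \o fmap L (bwd i).
Proof.
  intros E. rewrite <- (compf1 m), <- fmap_id, <- (fwd_bwd i), fmap_comp.
  rewrite <- (compA m), <- E, !compA, <- (compA (bwd phi)), bwd_fwd. apply comp1f.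
Qed.

Definition ci_inv (A X : Category) (L : Functor A X) (a b c d : A)
    (M : SCospan L a b) (N : SCospan L c d) (F : CospanIso M N) : CospanIso N M :=
  {| ci_src := iso_inv (ci_src F); ci_tgt := iso_inv (ci_tgt F); ci_map := iso_inv (ci_map F);
     ci_l := iso_square_inv (ci_l F); ci_r := iso_square_inv (ci_r F) |}.

Definition span_of_iso (A X : Category) (L : Functor A X) (a b c d : A)
    (M : SCospan L a b) (N : SCospan L c d) (F : CospanIso M N) : SpanSC M N.
Proof.
  refine {| s_src := vspan_of (ci_src F); s_tgt := vspan_of (ci_tgt F);
    s_mid := (M : SCospan L (v_ob (vspan_of (ci_src F))) (v_ob (vspan_of (ci_tgt F))));
    s_up := idm (sc_ob M); s_dn := ci_map F |}; cbn.
  - now rewrite fmap_id, comp1f, compf1.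
  - now rewrite fmap_id, comp1f, compf1.
  - apply ci_l.
  - apply ci_r.
Defined.

Lemma span_of_iso_graph (A X : Category) (L : Functor A X) (a b c d : A)
    (M : SCospan L a b) (N : SCospan L c d) (F : CospanIso M N) :
  is_graph (span_of_iso F) (ci_map F).
Proof. split; [apply (is_iso_iso (iso_id (sc_ob M)))|]. cbn. now rewrite compf1. Qed.

Lemma span_of_iso_fine (A X : Category) (L : Functor A X) (a b c d : A)
    (M : SCospan L a b) (N : SCospan L c d) (F : CospanIso M N) : fine (span_of_iso F).
Proof. split; [apply (iso_monic (i := iso_id (sc_ob M)))|apply iso_monic]. Qed.

Section Cells.
Context (A X : Category) (L : Functor A X) (ch : Choices A X)
  (Hh : hcomp_preserves_fine L ch).

Local Notation D := (FineRewrite Hh).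
Local Notation mid s := (sc_ob (s_mid (spn s))).
Local Notation up s := (s_up (spn s)).
Local Notation dn s := (s_dn (spn s)).
Local Notation obj M := (@sc_ob A X L _ _ M).

Definition sq_of_iso (a b c d : C0 D) (M : H a b) (N : H c d)
    (F : @CospanIso A X L a b c d M N) : Sq M N :=
  {| fs_fine := span_of_iso_fine F |}.

Lemma sq_of_iso_graph (a b c d : C0 D) (M : H a b) (N : H c d)
    (F : @CospanIso A X L a b c d M N) : is_graph (spn (sq_of_iso F)) (ci_map F).
Proof. apply span_of_iso_graph. Qed.

Lemma sq_of_iso_inv (a b c d : C0 D) (M : H a b) (N : H c d)
    (F : @CospanIso A X L a b c d M N) :
  sq_of_iso F \s sq_of_iso (ci_inv F) =s= sqid N.
Proof.
  apply (sq_graph_eq (graph_comp (sq_of_iso_graph F) (sq_of_iso_graph (ci_inv F)))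
    (graph_id N)); vnorm.
  - etransitivity; [apply comp_Proper; apply vmap_of|]. apply fwd_bwd.
  - etransitivity; [apply comp_Proper; apply vmap_of|]. apply fwd_bwd.
  - apply fwd_bwd.
Qed.

Definition cell_of_iso (a b c d : C0 D) (M : H a b) (N : H c d)
    (F : @CospanIso A X L a b c d M N) : SqIso M N.
Proof.
  refine (@Build_Iso (C1 D) (mkH M) (mkH N) (sq_of_iso F) (sq_of_iso (ci_inv F)) _ _).
  - apply sq_of_iso_inv.
  - apply (sq_graph_eq (graph_comp (sq_of_iso_graph (ci_inv F)) (sq_of_iso_graph F))
      (graph_id M)); vnorm.
    + etransitivity; [apply comp_Proper; apply vmap_of|]. apply bwd_fwd.
    + etransitivity; [apply comp_Proper; apply vmap_of|]. apply bwd_fwd.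
    + apply bwd_fwd.
Defined.

Section Cell.
Context (a b c d : C0 D) (M : H a b) (N : H c d) (F : @CospanIso A X L a b c d M N).

Lemma graph_cell : is_graph (spn (cell (cell_of_iso F))) (ci_map F).
Proof. apply span_of_iso_graph. Qed.

Lemma vsrc_cell : vmap (src (cell (cell_of_iso F))) == ci_src F.
Proof. apply vmap_of. Qed.

Lemma vtgt_cell : vmap (tgt (cell (cell_of_iso F))) == ci_tgt F.
Proof. apply vmap_of. Qed.

Lemma sq_is_cell : sq_is (fs_span (cell (cell_of_iso F))) (ci_src F) (ci_map F) (ci_tgt F).
Proof. split; [apply v_is_of|split; [apply v_is_of|]]. apply span_of_iso_graph. Qed.
End Cell.

(** A composite of the relation of [s] with a graph on either side is the relation of
    [s] with its elements transported, so naturality holds as soon as the middle rows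
    are isomorphic over the outer ones; this avoids the pullbacks by which the two
    vertical composites are defined. *)
Lemma sq_natural (a b c d a' b' c' d' : C0 D) (M : H a b) (N : H c d)
  (M' : H a' b') (N' : H c' d') (s : Sq M N) (s' : Sq M' N') (k : Sq M M') (k' : Sq N N')
  (phi : Hom (obj M) (obj M')) (phi' : Hom (obj N) (obj N')) (th : Hom (mid s) (mid s')) :
  is_graph (spn k) phi -> is_graph (spn k') phi' -> is_iso th ->
  up s' \o th == phi \o up s -> dn s' \o th == phi' \o dn s ->
  vmap (src k') \o vmap (src s) == vmap (src s') \o vmap (src k) ->
  vmap (tgt k') \o vmap (tgt s) == vmap (tgt s') \o vmap (tgt k) ->
  k' \s s =s= s' \s k.
Proof.
  intros G G' [th' [T _]] U V E1 E2. apply sq_eq. vnorm.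
  split; [exact E1|split; [exact E2|]]. intros w p q.
  rewrite (sq_related_comp k' s), (sq_related_comp s' k). split.
  - intros (r & [h [H1 H2]] & Hr). apply (graph_related G') in Hr.
    exists (phi \o p). split; [now apply (graph_related G)|].
    exists (th \o h). rewrite <- !compA, U, V, !compA, H1, H2. now split.
  - intros (r & Hr & [h [H1 H2]]). apply (graph_related G) in Hr.
    assert (Eh : th \o (th' \o h) == h) by now rewrite <- compA, T, comp1f.
    exists (dn s \o (th' \o h)). split.
    + exists (th' \o h). split; [|reflexivity]. apply (graph_monic G).
      now rewrite Hr, <- H1, <- compA, <- U, compA, Eh.
    + apply (graph_related G'). now rewrite <- H2, <- compA, <- V, compA, Eh.
Qed.
End Cells.
Arguments cell_of_iso {A X L ch} Hh {a b c d M N} F.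
Arguments vsrc_cell {A X L ch} Hh {a b c d M N} F.
Arguments vtgt_cell {A X L ch} Hh {a b c d M N} F.
Arguments graph_cell {A X L ch} Hh {a b c d M N} F.

Ltac vcell :=
  repeat (vnorm;
    match goal with
    | |- context [src (cell (cell_of_iso ?Hh ?F))] => rewrite (vsrc_cell Hh F)
    | |- context [tgt (cell (cell_of_iso ?Hh ?F))] => rewrite (vtgt_cell Hh F)
    end); vnorm.

(** * The constraint isomorphisms *)

Section LeftAdjoint.
Context (A X : Category) (L : Functor A X) (R : Functor X A) (adj : Adjunction L R)
  (ch : Choices A X).

(** The object [L (a + b)] as a coproduct of its own, so that the lemmas on coproducts
    apply to the feet of tensor products. *)
Definition Lcoproduct (a b : A) : Coproduct (L a) (L b) :=
  {| cp_ob := L (cp_ob (cpA ch a b));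
     cp1 := fmap L (cp1 (cpA ch a b)); cp2 := fmap L (cp2 (cpA ch a b));
     cp_pair := fun d u v => Lpair adj ch u v;
     cp_pair1 := fun d u v => Lpair1 adj ch u v;
     cp_pair2 := fun d u v => Lpair2 adj ch u v;
     cp_ext := fun d w w' => @Lpair_ext A X L R adj ch a b d w w' |}.

Lemma Lzero_ext (d : X) (u v : Hom (L (in_ob (inA ch))) d) : u == v.
Proof.
  rewrite <- (untransp_transp adj u), <- (untransp_transp adj v).
  apply untransp_proper, in_ext.
Qed.

Definition Linitial : Initial X :=
  {| in_ob := L (in_ob (inA ch)); in_map := Lzero adj ch; in_ext := Lzero_ext |}.

Lemma Lpair1_comp (a b : A) (x w : X) (f : Hom (L a) x) (g : Hom (L b) x) (k : Hom w (L a)) :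
  Lpair adj ch f g \o (fmap L (cp1 (cpA ch a b)) \o k) == f \o k.
Proof. apply precomp, Lpair1. Qed.

Lemma Lpair2_comp (a b : A) (x w : X) (f : Hom (L a) x) (g : Hom (L b) x) (k : Hom w (L b)) :
  Lpair adj ch f g \o (fmap L (cp2 (cpA ch a b)) \o k) == g \o k.
Proof. apply precomp, Lpair2. Qed.

Lemma fmap_cp1 (a b c : A) (P : Coproduct a b) (u : Hom a c) (v : Hom b c) :
  fmap L (cp_pair P u v) \o fmap L (cp1 P) == fmap L u.
Proof. rewrite <- fmap_comp. apply fmap_proper, cp_pair1. Qed.

Lemma fmap_cp2 (a b c : A) (P : Coproduct a b) (u : Hom a c) (v : Hom b c) :
  fmap L (cp_pair P u v) \o fmap L (cp2 P) == fmap L v.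
Proof. rewrite <- fmap_comp. apply fmap_proper, cp_pair2. Qed.

Lemma fmap_cp1_comp (a b c : A) (w : X) (P : Coproduct a b) (u : Hom a c) (v : Hom b c)
  (k : Hom w (L a)) :
  fmap L (cp_pair P u v) \o (fmap L (cp1 P) \o k) == fmap L u \o k.
Proof. apply precomp, fmap_cp1. Qed.

Lemma fmap_cp2_comp (a b c : A) (w : X) (P : Coproduct a b) (u : Hom a c) (v : Hom b c)
  (k : Hom w (L b)) :
  fmap L (cp_pair P u v) \o (fmap L (cp2 P) \o k) == fmap L v \o k.
Proof. apply precomp, fmap_cp2. Qed.
End LeftAdjoint.

Ltac co_norm :=
  repeat first
  [ cp_step
  | match goal with
    | |- context [fmap ?L (?g \o ?f)] => rewrite (fmap_comp L g f)
    | |- context [fmap ?L (idm ?a)] => rewrite (fmap_id L a)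
    | |- context [Lpair ?adj ?ch ?u ?v \o fmap _ (cp1 _)] => rewrite (Lpair1 adj ch u v)
    | |- context [Lpair ?adj ?ch ?u ?v \o fmap _ (cp2 _)] => rewrite (Lpair2 adj ch u v)
    | |- context [Lpair ?adj ?ch ?u ?v \o (fmap _ (cp1 _) \o ?k)] =>
        rewrite (Lpair1_comp adj ch u v k)
    | |- context [Lpair ?adj ?ch ?u ?v \o (fmap _ (cp2 _) \o ?k)] =>
        rewrite (Lpair2_comp adj ch u v k)
    | |- context [fmap ?L (cp_pair ?P ?u ?v) \o fmap ?L (cp1 ?P)] => rewrite (fmap_cp1 L P u v)
    | |- context [fmap ?L (cp_pair ?P ?u ?v) \o fmap ?L (cp2 ?P)] => rewrite (fmap_cp2 L P u v)
    | |- context [fmap ?L (cp_pair ?P ?u ?v) \o (fmap ?L (cp1 ?P) \o ?k)] =>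
        rewrite (fmap_cp1_comp P u v k)
    | |- context [fmap ?L (cp_pair ?P ?u ?v) \o (fmap ?L (cp2 ?P) \o ?k)] =>
        rewrite (fmap_cp2_comp P u v k)
    end ].

Ltac co_ext :=
  repeat match goal with
    | |- @eqh _ (cp_ob _) _ _ _ => apply cp_ext
    | |- @eqh _ (in_ob _) _ _ _ => apply in_ext
    | |- @eqh _ (fob ?L (cp_ob (cpA ?ch ?a ?b))) _ _ _ =>
        match goal with adj : Adjunction L _ |- _ => apply (Lpair_ext adj (ch := ch)) end
    | |- @eqh _ (fob ?L (in_ob (inA ?ch))) _ _ _ =>
        match goal with adj : Adjunction L _ |- _ => apply (Lzero_ext adj) end
    end.

Section Constraints.
Context (A X : Category) (L : Functor A X) (R : Functor X A) (adj : Adjunction L R)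
  (ch : Choices A X).

Local Notation cA := (cpA ch).
Local Notation cX := (cpX ch).

Local Notation "M <+> N" := (sc_tens adj ch M N) (at level 37, left associativity).
Local Notation "M <.> N" := (sc_comp ch M N) (at level 38, left associativity).

Section Inclusions.
Context (a b c a' b' : A) (M : SCospan L a b) (N : SCospan L b c) (M' : SCospan L a' b').

Definition cin1 : Hom (sc_ob M) (sc_ob (M <.> N)) := po1 (poX ch (sc_r M) (sc_l N)).
Definition cin2 : Hom (sc_ob N) (sc_ob (M <.> N)) := po2 (poX ch (sc_r M) (sc_l N)).
Definition tin1 : Hom (sc_ob M) (sc_ob (M <+> M')) := cp1 (cX (sc_ob M) (sc_ob M')).
Definition tin2 : Hom (sc_ob M') (sc_ob (M <+> M')) := cp2 (cX (sc_ob M) (sc_ob M')).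

(** The feet of a cospan and the summands of [L (a + b)], typed as arrows between the
    apexes of cospans: the equations of the coherence diagrams then live between
    apexes only. *)
Definition lin : Hom (sc_ob (sc_id L a)) (sc_ob M) := sc_l M.
Definition rin : Hom (sc_ob (sc_id L b)) (sc_ob M) := sc_r M.
Definition Lin1 : Hom (sc_ob (sc_id L a)) (sc_ob (sc_id L (cp_ob (cA a a')))) :=
  fmap L (cp1 (cA a a')).
Definition Lin2 : Hom (sc_ob (sc_id L a')) (sc_ob (sc_id L (cp_ob (cA a a')))) :=
  fmap L (cp2 (cA a a')).

Lemma comp_pushout : is_pushout (sc_r M) (sc_l N) cin1 cin2.
Proof. apply Pushout_is_pushout. Qed.

Lemma comp_ext (d : X) (u v : Hom (sc_ob (M <.> N)) d) :
  u \o cin1 == v \o cin1 -> u \o cin2 == v \o cin2 -> u == v.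
Proof. apply po_ext. Qed.

Lemma tens_ext (d : X) (u v : Hom (sc_ob (M <+> M')) d) :
  u \o tin1 == v \o tin1 -> u \o tin2 == v \o tin2 -> u == v.
Proof. apply cp_ext. Qed.

Lemma id_coproduct_ext (d : X) (u v : Hom (sc_ob (sc_id L (cp_ob (cA a a')))) d) :
  u \o Lin1 == v \o Lin1 -> u \o Lin2 == v \o Lin2 -> u == v.
Proof. apply (Lpair_ext adj). Qed.

Lemma id_zero_ext (d : X) (u v : Hom (sc_ob (sc_id L (in_ob (inA ch)))) d) : u == v.
Proof. apply (Lzero_ext adj). Qed.
End Inclusions.

Section Feet.
Context (a b c a' b' : A) (M : SCospan L a b) (N : SCospan L b c) (M' : SCospan L a' b').

Lemma comp_square : cin1 M N \o rin M == cin2 M N \o lin N.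
Proof. apply (proj1 (comp_pushout M N)). Qed.

Lemma tens_lin1 : lin (M <+> M') \o Lin1 a a' == tin1 M M' \o lin M.
Proof. apply Lpair1. Qed.

Lemma tens_lin2 : lin (M <+> M') \o Lin2 a a' == tin2 M M' \o lin M'.
Proof. apply Lpair2. Qed.

Lemma tens_rin1 : rin (M <+> M') \o Lin1 b b' == tin1 M M' \o rin M.
Proof. apply Lpair1. Qed.

Lemma tens_rin2 : rin (M <+> M') \o Lin2 b b' == tin2 M M' \o rin M'.
Proof. apply Lpair2. Qed.
End Feet.

Section TensorMap.
Context (a b c d a' b' c' d' : A) (M : SCospan L a b) (M' : SCospan L a' b')
  (N : SCospan L c d) (N' : SCospan L c' d') (f : Hom (sc_ob M) (sc_ob N))
  (g : Hom (sc_ob M') (sc_ob N')).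

Definition tmap : Hom (sc_ob (M <+> M')) (sc_ob (N <+> N')) := cmap cX f g.

Lemma tmap_tin1 : tmap \o tin1 M M' == tin1 N N' \o f.
Proof. apply cp_pair1. Qed.

Lemma tmap_tin2 : tmap \o tin2 M M' == tin2 N N' \o g.
Proof. apply cp_pair2. Qed.
End TensorMap.
Arguments tmap {a b c d a' b' c' d'} M M' N N' f g.

Section Tensor.
Context (a b a' b' a'' b'' : A) (M : SCospan L a b) (N : SCospan L a' b')
  (P : SCospan L a'' b'').

Definition tassoc_iso : Iso (sc_ob (M <+> N <+> P)) (sc_ob (M <+> (N <+> P))) :=
  cassoc_iso cX (sc_ob M) (sc_ob N) (sc_ob P).

Lemma tassoc_iso_spec :
  tassoc_iso \o (tin1 (M <+> N) P \o tin1 M N) == tin1 M (N <+> P) /\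
  tassoc_iso \o (tin1 (M <+> N) P \o tin2 M N) == tin2 M (N <+> P) \o tin1 N P /\
  tassoc_iso \o tin2 (M <+> N) P == tin2 M (N <+> P) \o tin2 N P.
Proof.
  unfold tin1, tin2. cbn. unfold cassoc. repeat split; co_norm; reflexivity.
Qed.

Definition tbraid_iso : Iso (sc_ob (M <+> N)) (sc_ob (N <+> M)) :=
  cbraid_iso cX (sc_ob M) (sc_ob N).

Lemma tbraid_iso_spec :
  tbraid_iso \o tin1 M N == tin2 N M /\ tbraid_iso \o tin2 M N == tin1 N M.
Proof. split; [apply cp_pair1|apply cp_pair2]. Qed.

Definition tlun_iso : Iso (sc_ob (sc_id L (in_ob (inA ch)) <+> M)) (sc_ob M) :=
  clun_iso cX (Linitial adj ch) (sc_ob M).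

Lemma tlun_iso_spec : tlun_iso \o tin2 (sc_id L (in_ob (inA ch))) M == idm (sc_ob M).
Proof. apply cp_pair2. Qed.

Definition trun_iso : Iso (sc_ob (M <+> sc_id L (in_ob (inA ch)))) (sc_ob M) :=
  crun_iso cX (Linitial adj ch) (sc_ob M).

Lemma trun_iso_spec : trun_iso \o tin1 M (sc_id L (in_ob (inA ch))) == idm (sc_ob M).
Proof. apply cp_pair1. Qed.

Definition tassoc : CospanIso (M <+> N <+> P) (M <+> (N <+> P)).
Proof.
  refine (@Build_CospanIso A X L _ _ _ _ (M <+> N <+> P) (M <+> (N <+> P))
    (cassoc_iso cA a a' a'') (cassoc_iso cA b b' b'')
    tassoc_iso _ _);
    cbn; unfold cassoc; co_ext; co_norm; reflexivity.
Defined.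

Definition tbraid : CospanIso (M <+> N) (N <+> M).
Proof.
  refine (@Build_CospanIso A X L _ _ _ _ (M <+> N) (N <+> M)
    (cbraid_iso cA a a') (cbraid_iso cA b b') tbraid_iso _ _);
    cbn; unfold cbraid; co_ext; co_norm; reflexivity.
Defined.

Definition tlun : CospanIso (sc_id L (in_ob (inA ch)) <+> M) M.
Proof.
  refine (@Build_CospanIso A X L _ _ _ _ (sc_id L (in_ob (inA ch)) <+> M) M
    (clun_iso cA (inA ch) a) (clun_iso cA (inA ch) b)
    tlun_iso _ _);
    cbn; unfold clun; cbn [in_ob in_map Linitial]; co_ext; co_norm; reflexivity.
Defined.

Definition trun : CospanIso (M <+> sc_id L (in_ob (inA ch))) M.
Proof.
  refine (@Build_CospanIso A X L _ _ _ _ (M <+> sc_id L (in_ob (inA ch))) M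
    (crun_iso cA (inA ch) a) (crun_iso cA (inA ch) b)
    trun_iso _ _);
    cbn; unfold crun; cbn [in_ob in_map Linitial]; co_ext; co_norm; reflexivity.
Defined.
End Tensor.

Section Associator.
Context (a b c d : A) (M : SCospan L a b) (N : SCospan L b c) (P : SCospan L c d).

Definition hassoc_iso : Iso (sc_ob (M <.> N <.> P)) (sc_ob (M <.> (N <.> P))) :=
  chosen (pushout_assoc (comp_pushout M N) (comp_pushout N P)
    (comp_pushout (M <.> N) P) (comp_pushout M (N <.> P))).

Lemma hassoc_iso_spec :
  hassoc_iso \o (cin1 (M <.> N) P \o cin1 M N) == cin1 M (N <.> P) /\
  hassoc_iso \o (cin1 (M <.> N) P \o cin2 M N)
  == cin2 M (N <.> P) \o cin1 N P /\
  hassoc_iso \o cin2 (M <.> N) P == cin2 M (N <.> P) \o cin2 N P.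
Proof.
  exact (chosen_spec (pushout_assoc (comp_pushout M N) (comp_pushout N P)
    (comp_pushout (M <.> N) P) (comp_pushout M (N <.> P)))).
Qed.

Definition hassoc_map : CospanIso (M <.> N <.> P) (M <.> (N <.> P)).
Proof.
  refine (@Build_CospanIso A X L _ _ _ _ (M <.> N <.> P) (M <.> (N <.> P))
    (iso_id a) (iso_id d) hassoc_iso _ _);
    destruct hassoc_iso_spec as (E1 & E2 & E3); cbn; rewrite fmap_id, compf1.
  - rewrite <- E1. now rewrite !compA.
  - now rewrite <- compA, E3, compA.
Defined.
End Associator.

Section Units.
Context (a b : A) (M : SCospan L a b).

Definition hlun_iso : Iso (sc_ob (sc_id L a <.> M)) (sc_ob M) :=
  chosen (pushout_of_iso (is_iso_iso (iso_id (L a))) (comp_pushout (sc_id L a) M)).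

Lemma hlun_iso_spec :
  hlun_iso \o cin2 (sc_id L a) M == idm (sc_ob M) /\
  hlun_iso \o cin1 (sc_id L a) M == lin M.
Proof.
  destruct (chosen_spec (pushout_of_iso (is_iso_iso (iso_id (L a)))
    (comp_pushout (sc_id L a) M))) as [E1 E2].
  split; [exact E1|]. etransitivity; [|exact E2]. cbn. now rewrite compf1.
Qed.

Definition hrun_iso : Iso (sc_ob (M <.> sc_id L b)) (sc_ob M) :=
  chosen (pushout_of_iso (is_iso_iso (iso_id (L b))) (is_pushout_sym (comp_pushout M (sc_id L b)))).

Lemma hrun_iso_spec :
  hrun_iso \o cin1 M (sc_id L b) == idm (sc_ob M) /\
  hrun_iso \o cin2 M (sc_id L b) == rin M.
Proof.
  destruct (chosen_spec (pushout_of_iso (is_iso_iso (iso_id (L b)))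
    (is_pushout_sym (comp_pushout M (sc_id L b))))) as [E1 E2].
  split; [exact E1|]. etransitivity; [|exact E2]. cbn. now rewrite compf1.
Qed.

Definition hlun_map : CospanIso (sc_id L a <.> M) M.
Proof.
  refine (@Build_CospanIso A X L _ _ _ _ (sc_id L a <.> M) M
    (iso_id a) (iso_id b) hlun_iso _ _);
    destruct hlun_iso_spec as (E1 & E2); cbn; rewrite fmap_id, compf1.
  - rewrite compf1. exact E2.
  - now rewrite <- compA, E1, comp1f.
Defined.

Definition hrun_map : CospanIso (M <.> sc_id L b) M.
Proof.
  refine (@Build_CospanIso A X L _ _ _ _ (M <.> sc_id L b) M
    (iso_id a) (iso_id b) hrun_iso _ _);
    destruct hrun_iso_spec as (E1 & E2); cbn; rewrite fmap_id, compf1.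
  - now rewrite <- compA, E1, comp1f.
  - rewrite compf1. exact E2.
Defined.
End Units.

Section Interchange.
Context (a b c a' b' c' : A) (M : SCospan L a b) (M' : SCospan L a' b')
  (N : SCospan L b c) (N' : SCospan L b' c').

(** The feet of the tensor products are glued along [L (b + b')], a coproduct because
    [L] is a left adjoint; hence this is [pushout_coproduct]. *)
Lemma chi_exists :
  exists i : Iso (sc_ob ((M <+> M') <.> (N <+> N'))) (sc_ob ((M <.> N) <+> (M' <.> N'))),
    i \o cin1 (M <+> M') (N <+> N')
    == tmap M M' (M <.> N) (M' <.> N') (cin1 M N) (cin1 M' N') /\
    i \o cin2 (M <+> M') (N <+> N')
    == tmap N N' (M <.> N) (M' <.> N') (cin2 M N) (cin2 M' N').
Proof.
  exact (pushout_coproduct (cc := Lcoproduct adj ch b b') (cx := cX (sc_ob M) (sc_ob M'))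
    (cy := cX (sc_ob N) (sc_ob N')) (cX (sc_ob (M <.> N)) (sc_ob (M' <.> N')))
    (comp_pushout M N) (comp_pushout M' N') (comp_pushout (M <+> M') (N <+> N'))).
Qed.

Definition chi_iso : Iso (sc_ob ((M <+> M') <.> (N <+> N'))) (sc_ob ((M <.> N) <+> (M' <.> N'))) :=
  chosen chi_exists.

Lemma chi_iso_spec :
  (chi_iso \o (cin1 (M <+> M') (N <+> N') \o tin1 M M') == tin1 (M <.> N) (M' <.> N') \o cin1 M N /\
   chi_iso \o (cin1 (M <+> M') (N <+> N') \o tin2 M M') == tin2 (M <.> N) (M' <.> N') \o cin1 M' N') /\
  (chi_iso \o (cin2 (M <+> M') (N <+> N') \o tin1 N N') == tin1 (M <.> N) (M' <.> N') \o cin2 M N /\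
   chi_iso \o (cin2 (M <+> M') (N <+> N') \o tin2 N N') == tin2 (M <.> N) (M' <.> N') \o cin2 M' N').
Proof.
  destruct (chosen_spec chi_exists) as [E1 E2]. fold chi_iso in E1, E2.
  repeat split; rewrite <- compA; first [rewrite E1|rewrite E2];
    first [apply tmap_tin1|apply tmap_tin2].
Qed.

Definition chi_map : CospanIso ((M <+> M') <.> (N <+> N')) ((M <.> N) <+> (M' <.> N')).
Proof.
  refine (@Build_CospanIso A X L _ _ _ _ ((M <+> M') <.> (N <+> N')) ((M <.> N) <+> (M' <.> N'))
    (iso_id (cp_ob (cA a a'))) (iso_id (cp_ob (cA c c'))) chi_iso _ _);
    destruct chi_iso_spec as [[E1 E2] [E3 E4]].
  - change (chi_iso \o (cin1 _ _ \o Lpair adj ch (tin1 M M' \o sc_l M) (tin2 M M' \o sc_l M'))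
      == Lpair adj ch (tin1 (M <.> N) (M' <.> N') \o (cin1 M N \o sc_l M))
           (tin2 (M <.> N) (M' <.> N') \o (cin1 M' N' \o sc_l M')) \o fmap L (idm _)).
    co_norm. co_ext; co_norm; now rewrite ?(precomp3 E1), ?(precomp3 E2), compA.
  - change (chi_iso \o (cin2 _ _ \o Lpair adj ch (tin1 N N' \o sc_r N) (tin2 N N' \o sc_r N'))
      == Lpair adj ch (tin1 (M <.> N) (M' <.> N') \o (cin2 M N \o sc_r N))
           (tin2 (M <.> N) (M' <.> N') \o (cin2 M' N' \o sc_r N')) \o fmap L (idm _)).
    co_norm. co_ext; co_norm; now rewrite ?(precomp3 E3), ?(precomp3 E4), compA.
Defined.
End Interchange.

Definition mu_iso (a b : A) :
  Iso (sc_ob (sc_id L (cp_ob (cA a b)))) (sc_ob (sc_id L a <+> sc_id L b)).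
Proof.
  refine (@Build_Iso X (L (cp_ob (cA a b))) (cp_ob (cX (L a) (L b)))
    (Lpair adj ch (cp1 (cX (L a) (L b))) (cp2 (cX (L a) (L b))))
    (cp_pair (cX (L a) (L b)) (fmap L (cp1 _)) (fmap L (cp2 _))) _ _);
    co_ext; co_norm; reflexivity.
Defined.

Lemma mu_iso_spec (a b : A) :
  mu_iso a b \o Lin1 a b == tin1 (sc_id L a) (sc_id L b) /\
  mu_iso a b \o Lin2 a b == tin2 (sc_id L a) (sc_id L b).
Proof. split; [apply Lpair1|apply Lpair2]. Qed.

Definition mu_map (a b : A) : CospanIso (sc_id L (cp_ob (cA a b))) (sc_id L a <+> sc_id L b).
Proof.
  refine (@Build_CospanIso A X L _ _ _ _ (sc_id L (cp_ob (cA a b))) (sc_id L a <+> sc_id L b)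
    (iso_id _) (iso_id _) (mu_iso a b) _ _);
    cbn; co_ext; co_norm; reflexivity.
Defined.
End Constraints.
Arguments tmap {A X L R} adj ch {a b c d a' b' c' d'} M M' N N' f g.
Arguments tmap_tin1 {A X L R} adj ch {a b c d a' b' c' d'} M M' N N' f g.
Arguments tmap_tin2 {A X L R} adj ch {a b c d a' b' c' d'} M M' N N' f g.

(** * Coherence *)

Section Graphs.
Context (A X : Category) (L : Functor A X) (R : Functor X A) (adj : Adjunction L R)
  (ch : Choices A X) (Hh : hcomp_preserves_fine L ch) (Ht : tens_preserves_fine adj ch).

Local Notation D := (FineRewrite Hh).
Local Notation T := (FineTensor Hh Ht).
Local Notation mid s := (sc_ob (s_mid (spn s))).
Local Notation up s := (s_up (spn s)).
Local Notation dn s := (s_dn (spn s)).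
Local Notation obj M := (@sc_ob A X L _ _ M).

Lemma graph_comp_map (a b c a' b' c' : C0 D) (M : H a b) (N : H b c) (M' : H a' b')
  (N' : H b' c') (s : Sq M M') (t : Sq N N') (e : tgt s == src t)
  (phi : Hom (obj M) (obj M')) (psi : Hom (obj N) (obj N')) :
  is_graph (spn s) phi -> is_graph (spn t) psi ->
  exists chi : Hom (obj (sc_comp ch M N)) (obj (sc_comp ch M' N')),
    is_graph (spn (hsq e)) chi /\
    chi \o cin1 ch M N == cin1 ch M' N' \o phi /\ chi \o cin2 ch M N == cin2 ch M' N' \o psi.
Proof. apply hcomp_graph. Qed.

Lemma graph_tens_map (a b c d a' b' c' d' : C0 D) (M : H a b) (N : H c d) (M' : H a' b')
  (N' : H c' d') (s : Sq M N) (s' : Sq M' N')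
  (phi : Hom (obj M) (obj N)) (psi : Hom (obj M') (obj N')) :
  is_graph (spn s) phi -> is_graph (spn s') psi ->
  is_graph (spn (sqtens T s s')) (tmap adj ch M M' N N' phi psi).
Proof.
  intros [[k [K1 K2]] Es] [[l [L1 L2]] Et]. split.
  - exists (cmap (cpX ch) k l).
    change (cmap (cpX ch) (up s) (up s') \o cmap (cpX ch) k l
              == idm (cp_ob (cpX ch (obj M) (obj M'))) /\
            cmap (cpX ch) k l \o cmap (cpX ch) (up s) (up s')
              == idm (cp_ob (cpX ch (mid s) (mid s')))).
    rewrite <- !cmap_comp, K1, K2, L1, L2. split; apply cmap_id.
  - change (cmap (cpX ch) (dn s) (dn s')
      == cmap (cpX ch) phi psi \o cmap (cpX ch) (up s) (up s')).
    rewrite <- cmap_comp. now apply cmap_proper.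
Qed.
End Graphs.

(** Computes the arrow of which a composite of coherence squares is the graph. *)
Ltac solve_graph :=
  lazymatch goal with
  | |- is_graph (spn (sqcomp _ _)) _ => eapply graph_comp; [solve_graph|solve_graph]
  | |- is_graph (spn (sqtens _ _ _)) _ => eapply graph_tens_map; [solve_graph|solve_graph]
  | |- is_graph (spn (cell (cell_of_iso ?Hh ?F))) _ => exact (graph_cell Hh F)
  | |- is_graph (spn (sqid ?M)) _ => exact (graph_id M)
  | |- is_graph (spn (sqU ?f)) _ => exact (graph_U f)
  | |- _ => eassumption
  end.

Section TensorOfSquares.
Context (A X : Category) (L : Functor A X) (R : Functor X A) (adj : Adjunction L R)
  (ch : Choices A X) (Hh : hcomp_preserves_fine L ch) (Ht : tens_preserves_fine adj ch).

Local Notation D := (FineRewrite Hh).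
Local Notation T := (FineTensor Hh Ht).
Local Notation mid s := (sc_ob (s_mid (spn s))).
Context (HX : is_topos X).

Local Notation cX := (cpX ch).
Local Notation "s <x> t" := (sqtens T s t) (at level 37, left associativity).

Local Notation massoc_c M N P := (cell (cell_of_iso Hh (tassoc adj ch M N P))).
Local Notation mlun_c M := (cell (cell_of_iso Hh (tlun adj ch M))).
Local Notation mrun_c M := (cell (cell_of_iso Hh (trun adj ch M))).
Local Notation mbraid_c M N := (cell (cell_of_iso Hh (tbraid adj ch M N))).

(** The diagrams of the constraints commute because the isomorphisms of the apexes and
    of the feet are the constraints of the coproduct. *)
Definition fine_symmon1 : SymMonoidal (tens1 T).
Proof.
  refine (@Build_SymMonoidal (C1 D) (tens1 T) _ _ _
    (fun M N P : C1 D => cell_of_iso Hh (tassoc adj ch (harr M) (harr N) (harr P)))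
    (fun M : C1 D =>
      match M as M return @Iso (C1 D) (tob (tens1 T) (tunit (tens1 T)) M) M with
      | @mkH _ _ _ m => cell_of_iso Hh (tlun adj ch m)
      end)
    (fun M : C1 D =>
      match M as M return @Iso (C1 D) (tob (tens1 T) M (tunit (tens1 T))) M with
      | @mkH _ _ _ m => cell_of_iso Hh (trun adj ch m)
      end)
    (fun M N : C1 D => cell_of_iso Hh (tbraid adj ch (harr M) (harr N)))
    _ _ _ _ _ _ _ _).
  - intros M N M' N' s t s' t' E E'. now apply (fine_sqtens_proper Ht).
  - intros M N. change (sqid (harr M) <x> sqid (harr N) =s= sqid (htens T (harr M) (harr N))).
    eapply sq_graph_eq; [solve_graph|solve_graph|..]; vcell; apply cmap_id.
  - intros. now apply (fine_sqtens_comp Ht).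
  - intros M N P M' N' P' s t r.
    refine (sq_natural (s := s <x> t <x> r) (s' := s <x> (t <x> r))
      (k := cell (cell_of_iso Hh (tassoc adj ch (harr M) (harr N) (harr P))))
      (k' := cell (cell_of_iso Hh (tassoc adj ch (harr M') (harr N') (harr P'))))
      (th := cassoc cX (mid s) (mid t) (mid r))
      (graph_cell _ _) (graph_cell _ _) (is_iso_iso (cassoc_iso cX _ _ _)) _ _ _ _).
    + symmetry. apply cassoc_nat.
    + symmetry. apply cassoc_nat.
    + vcell. apply cassoc_nat.
    + vcell. apply cassoc_nat.
  - intros [a b M] [a' b' N] s.
    refine (sq_natural (M := htens T (hU (tunit T)) M) (N := htens T (hU (tunit T)) N)
      (s := sqid (hU (tunit T)) <x> (s : Sq M N)) (s' := s)
      (k := cell (cell_of_iso Hh (tlun adj ch M)))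
      (k' := cell (cell_of_iso Hh (tlun adj ch N)))
      (th := clun cX (Linitial adj ch) (mid (s : Sq M N)))
      (graph_cell _ _) (graph_cell _ _) (is_iso_iso (clun_iso cX (Linitial adj ch) _)) _ _ _ _).
    + symmetry. apply (clun_nat cX (Linitial adj ch)).
    + symmetry. apply (clun_nat cX (Linitial adj ch)).
    + vcell. apply clun_nat.
    + vcell. apply clun_nat.
  - intros [a b M] [a' b' N] s.
    refine (sq_natural (M := htens T M (hU (tunit T))) (N := htens T N (hU (tunit T)))
      (s := (s : Sq M N) <x> sqid (hU (tunit T))) (s' := s)
      (k := cell (cell_of_iso Hh (trun adj ch M)))
      (k' := cell (cell_of_iso Hh (trun adj ch N)))
      (th := crun cX (Linitial adj ch) (mid (s : Sq M N)))
      (graph_cell _ _) (graph_cell _ _) (is_iso_iso (crun_iso cX (Linitial adj ch) _)) _ _ _ _).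
    + symmetry. apply (crun_nat cX (Linitial adj ch)).
    + symmetry. apply (crun_nat cX (Linitial adj ch)).
    + vcell. apply crun_nat.
    + vcell. apply crun_nat.
  - intros M N M' N' s t.
    refine (sq_natural (s := s <x> t) (s' := t <x> s)
      (k := cell (cell_of_iso Hh (tbraid adj ch (harr M) (harr N))))
      (k' := cell (cell_of_iso Hh (tbraid adj ch (harr M') (harr N'))))
      (th := cbraid cX (mid s) (mid t))
      (graph_cell _ _) (graph_cell _ _) (is_iso_iso (cbraid_iso cX _ _)) _ _ _ _).
    + symmetry. apply cbraid_nat.
    + symmetry. apply cbraid_nat.
    + vcell. apply cbraid_nat.
    + vcell. apply cbraid_nat.
  - intros [? ? M] [? ? N] [? ? P] [? ? Q].
    change (massoc_c M N (htens T P Q) \s massoc_c (htens T M N) P Q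
      =s= (sqid M <x> massoc_c N P Q) \s massoc_c M (htens T N P) Q
        \s (massoc_c M N P <x> sqid Q)).
    eapply sq_graph_eq; [solve_graph|solve_graph|..]; vcell; apply cpentagon.
  - intros [? ? M] [? ? N].
    change ((sqid M <x> mlun_c N) \s massoc_c M (hU (tunit T)) N =s= mrun_c M <x> sqid N).
    eapply sq_graph_eq; [solve_graph|solve_graph|..]; vcell; try apply ctriangle.
    apply (ctriangle cX (Linitial adj ch)).
  - intros [? ? M] [? ? N] [? ? P].
    change (massoc_c N P M \s mbraid_c M (htens T N P) \s massoc_c M N P
      =s= (sqid N <x> mbraid_c M P) \s massoc_c N M P \s (mbraid_c M N <x> sqid P)).
    eapply sq_graph_eq; [solve_graph|solve_graph|..]; vcell; apply chexagon.
  - intros [? ? M] [? ? N].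
    change (mbraid_c N M \s mbraid_c M N =s= sqid (htens T M N)).
    eapply sq_graph_eq; [solve_graph|solve_graph|..]; vcell; apply csymmetry.
Defined.
End TensorOfSquares.

(** ** Equations between graphs *)

(** Names the arrows of which the horizontal composites in the goal are graphs. *)
Ltac open_hsq :=
  repeat match goal with
  | |- context [hsq ?e] =>
      lazymatch goal with
      | _ : is_graph (spn (hsq e)) _ |- _ => fail
      | _ => edestruct (graph_comp_map e) as (? & ? & ? & ?); [solve_graph|solve_graph|]
      end
  end.

(** Replaces the constraint isomorphisms by variables that satisfy their
    characteristic equations. *)
Ltac open_cell c :=
  let i := fresh "i" in
  lazymatch c with
  | hassoc_iso ?ch ?M ?N ?P => destruct (hassoc_iso_spec ch M N P) as (? & ? & ?)
  | hlun_iso ?ch ?M => destruct (hlun_iso_spec ch M) as (? & ?)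
  | hrun_iso ?ch ?M => destruct (hrun_iso_spec ch M) as (? & ?)
  | chi_iso ?adj ?ch ?M ?M' ?N ?N' => destruct (chi_iso_spec adj ch M M' N N') as [[? ?] [? ?]]
  | mu_iso ?adj ?ch ?a ?b => destruct (mu_iso_spec adj ch a b) as (? & ?)
  | tassoc_iso ?adj ?ch ?M ?N ?P => destruct (tassoc_iso_spec adj ch M N P) as (? & ? & ?)
  | tbraid_iso ?adj ?ch ?M ?N => destruct (tbraid_iso_spec adj ch M N) as (? & ?)
  | tlun_iso ?adj ?ch ?M => pose proof (tlun_iso_spec adj ch M)
  | trun_iso ?adj ?ch ?M => pose proof (trun_iso_spec adj ch M)
  end; set (i := c) in *; clearbody i.

Ltac open_cells :=
  repeat match goal with
  | |- context [fwd ?c] => open_cell c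
  | _ : context [fwd ?c] |- _ => open_cell c
  end.

(** The inclusions of the constituents into the apex of [M] are jointly epic; the
    facts collected here reduce an equation between arrows out of the apex to them. *)
Ltac gen_epi M :=
  lazymatch M with
  | sc_comp ?ch ?M ?N => pose proof (@comp_ext _ _ _ ch _ _ _ M N); gen_epi M; gen_epi N
  | sc_tens ?adj ?ch ?M ?N =>
      pose proof (@tens_ext _ _ _ _ adj ch _ _ _ _ M N); gen_epi M; gen_epi N
  | sc_id ?L (cp_ob (cpA ?ch ?a ?b)) =>
      match goal with adj : Adjunction L _ |- _ =>
        pose proof (@id_coproduct_ext _ _ _ _ adj ch a b); gen_epi (sc_id L a); gen_epi (sc_id L b)
      end
  | sc_id ?L (in_ob (inA ?ch)) =>
      match goal with adj : Adjunction L _ |- _ => pose proof (@id_zero_ext _ _ _ _ adj ch) end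
  | _ => idtac
  end.

Ltac forget t := let k := fresh "k" in set (k := t) in *; clearbody k.

Ltac gen_open_atom t :=
  lazymatch t with
  | tmap ?adj ?ch ?M ?M' ?N ?N' ?f ?g =>
      pose proof (tmap_tin1 adj ch M M' N N' f g); pose proof (tmap_tin2 adj ch M M' N N' f g)
  | lin (sc_tens ?adj ?ch ?M ?N) =>
      pose proof (tens_lin1 adj ch M N); pose proof (tens_lin2 adj ch M N)
  | rin (sc_tens ?adj ?ch ?M ?N) =>
      pose proof (tens_rin1 adj ch M N); pose proof (tens_rin2 adj ch M N)
  end; forget t.

Ltac gen_atom t :=
  lazymatch t with
  | cin1 _ _ _ => forget t
  | cin2 _ _ _ => forget t
  | tin1 _ _ _ _ => forget t
  | tin2 _ _ _ _ => forget t
  | lin _ => forget t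
  | rin _ => forget t
  | Lin1 _ _ _ _ => forget t
  | Lin2 _ _ _ _ => forget t
  end.

(** Replaces all structural arrows and then the objects by variables: only the
    equations collected so far matter, and rewriting is faster with small types. *)
Ltac gen_forget :=
  repeat match goal with
  | |- context [?t \o _] => gen_open_atom t
  | |- context [_ \o ?t] => gen_open_atom t
  | |- _ == ?t => gen_open_atom t
  | _ : context [?t \o _] |- _ => gen_open_atom t
  | _ : context [_ \o ?t] |- _ => gen_open_atom t
  | _ : context [_ == ?t] |- _ => gen_open_atom t
  end;
  repeat match goal with
  | |- context [?t \o _] => gen_atom t
  | |- context [_ \o ?t] => gen_atom t
  | |- _ == ?t => gen_atom t
  | _ : context [?t \o _] |- _ => gen_atom t
  | _ : context [_ \o ?t] |- _ => gen_atom t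
  | _ : context [_ == ?t] |- _ => gen_atom t
  end;
  repeat match goal with
  | _ : @Hom _ (@sc_ob ?A ?X ?L ?a ?b ?M) _ |- _ => forget (@sc_ob A X L a b M)
  | _ : @Hom _ _ (@sc_ob ?A ?X ?L ?a ?b ?M) |- _ => forget (@sc_ob A X L a b M)
  end.

Ltac gen_ext :=
  repeat match goal with
  | E : forall (d : _) (u v : @Hom _ ?o d), _ |- @eqh _ ?o _ _ _ => apply E
  end.

Ltac gen_norm :=
  repeat match goal with
  | |- context [(?h \o ?g) \o ?f] => rewrite (compA h g f)
  | |- context [idm _ \o ?f] => rewrite (comp1f f)
  | |- context [?f \o idm _] => rewrite (compf1 f)
  | E : ?f \o ?g == _ |- context [?f \o ?g] => rewrite E
  | E : ?f \o ?g == _ |- context [?f \o (?g \o _)] => rewrite (precomp E)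
  | E : ?f \o (?g \o ?h) == _ |- context [?f \o (?g \o (?h \o _))] => rewrite (precomp3 E)
  end.

(** Rewrites the operations of the double category as those on cospans, without
    unfolding the latter: the objects of unfolded iterated composites are huge. *)
Ltac gen_simpl :=
  cbn [hcomp htens hU tunit tob tens0 FineRewrite FineTensor fine_tens0 ci_map hassoc_map
       hlun_map hrun_map chi_map mu_map tassoc tlun trun tbraid] in *.

Ltac gen_solve :=
  repeat match goal with
  | G : is_graph _ _ |- _ => clear G
  | e : tgt _ == src _ |- _ => clear e
  end;
  gen_simpl; open_cells;
  lazymatch goal with |- @eqh _ (sc_ob ?M) _ _ _ => gen_epi M end;
  gen_forget; gen_ext; gen_norm; try reflexivity.

Section DoubleCategoryOfFineRewrites.
Context (A X : Category) (L : Functor A X) (ch : Choices A X)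
  (Hh : hcomp_preserves_fine L ch).

Local Notation D := (FineRewrite Hh).
Context (HX : is_topos X).

Local Notation hassoc_c M N P := (cell (cell_of_iso Hh (hassoc_map ch M N P))).
Local Notation hlun_c M := (cell (cell_of_iso Hh (hlun_map ch M))).
Local Notation hrun_c M := (cell (cell_of_iso Hh (hrun_map ch M))).

Lemma fine_hsq_id (a b c : C0 D) (M : H a b) (N : H b c)
  (e : tgt (sqid M) == src (sqid N)) : hsq e =s= sqid (M (.) N).
Proof.
  open_hsq. eapply sq_graph_eq; [solve_graph|solve_graph|vcell|vcell|].
  - reflexivity.
  - reflexivity.
  - gen_solve.
Qed.

Lemma fine_hpentagon (a b c d f : C0 D) (M : H a b) (N : H b c) (P : H c d) (Q : H d f)
  (e1 : tgt (sqid M) == src (hassoc_c N P Q)) (e2 : tgt (hassoc_c M N P) == src (sqid Q)) :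
  hassoc_c M N (P (.) Q) \s hassoc_c (M (.) N) P Q
  =s= hsq e1 \s hassoc_c M (N (.) P) Q \s hsq e2.
Proof.
  open_hsq. eapply sq_graph_eq; [solve_graph|solve_graph|vcell|vcell|].
  - cbn. now rewrite !comp1f.
  - cbn. now rewrite !comp1f.
  - gen_solve.
Qed.

Lemma fine_htriangle (a b c : C0 D) (M : H a b) (N : H b c)
  (e1 : tgt (sqid M) == src (hlun_c N)) (e2 : tgt (hrun_c M) == src (sqid N)) :
  hsq e1 \s hassoc_c M (hU b) N =s= hsq e2.
Proof.
  open_hsq. eapply sq_graph_eq; [solve_graph|solve_graph|vcell|vcell|].
  - cbn. now rewrite ?comp1f.
  - cbn. now rewrite ?comp1f.
  - pose proof (comp_square ch M N). gen_solve.
Qed.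

(** The middle rows of the two horizontal composites are iterated pushouts of the same
    middle rows, hence related by [pushout_assoc]. *)
Lemma fine_hassoc_nat (a b c d a' b' c' d' : C0 D)
  (M : H a b) (N : H b c) (P : H c d) (M' : H a' b') (N' : H b' c') (P' : H c' d')
  (s : Sq M M') (t : Sq N N') (r : Sq P P') (e1 : tgt s == src t) (e2 : tgt t == src r)
  (e3 : tgt (hsq e1) == src r) (e4 : tgt s == src (hsq e2)) :
  hassoc_c M' N' P' \s hsq e3 =s= hsq e4 \s hassoc_c M N P.
Proof.
  pose proof (hmid_pushout ch (s := spn s) (t := spn t) e1) as HP.
  pose proof (hmid_pushout ch (s := spn t) (t := spn r) e2) as HQ.
  pose proof (is_pushout_eq (foot_r_hcomp ch (s := spn s) (t := spn t) e1) (reflexivity _)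
    (hmid_pushout ch (s := spn (hsq e1)) (t := spn r) e3)) as HL.
  pose proof (is_pushout_eq (reflexivity _) (foot_l_hcomp ch (s := spn t) (t := spn r) e2)
    (hmid_pushout ch (s := spn s) (t := spn (hsq e2)) e4)) as HR.
  destruct (pushout_assoc HP HQ HL HR) as [th Hth].
  refine (sq_natural (s := hsq e3) (s' := hsq e4) (th := fwd th) (graph_cell Hh _) (graph_cell Hh _) (is_iso_iso th) _ _ _ _).
  - exact (pushout_assoc_nat HP HL Hth (hassoc_iso_spec ch M N P)
      (up_hmid1 ch e1) (up_hmid2 ch e1) (up_hmid1 ch e2) (up_hmid2 ch e2)
      (up_hmid1 ch e3) (up_hmid2 ch e3) (up_hmid1 ch e4) (up_hmid2 ch e4)).
  - exact (pushout_assoc_nat HP HL Hth (hassoc_iso_spec ch M' N' P')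
      (dn_hmid1 ch e1) (dn_hmid2 ch e1) (dn_hmid1 ch e2) (dn_hmid2 ch e2)
      (dn_hmid1 ch e3) (dn_hmid2 ch e3) (dn_hmid1 ch e4) (dn_hmid2 ch e4)).
  - vcell. cbn. now rewrite comp1f, compf1.
  - vcell. cbn. now rewrite comp1f, compf1.
Qed.

Lemma foot_r_U (a b : A) (v : VSpan a b) : is_iso (foot_r (spansc_U L v)).
Proof.
  exists (fmap L (v_up v)). unfold foot_r. cbn. rewrite comp1f, <- !fmap_comp, <- !fmap_id.
  split; apply fmap_proper; [apply bwd_fwd|apply fwd_bwd].
Qed.

Lemma foot_l_U (a b : A) (v : VSpan a b) : is_iso (foot_l (spansc_U L v)).
Proof. exact (foot_r_U v). Qed.

(** The comparison of the middle rows in the naturality of the unit constraints;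
    it is tested on the middle row of [s] and on the feet. *)
Lemma pushout_unit_nat (C : Category) (c x y p p' z z' : C) (i : Hom c x) (g : Hom c y)
  (m1 : Hom x p) (m2 : Hom y p) (th : Hom p y) (u : Hom p p') (phi : Hom p' z)
  (m1' : Hom z' p') (m2' : Hom z p') (ux : Hom x z') (uy : Hom y z) (k : Hom z' z) :
  is_iso i -> is_pushout i g m1 m2 -> th \o m2 == idm y -> th \o (m1 \o i) == g ->
  u \o m1 == m1' \o ux -> u \o m2 == m2' \o uy ->
  phi \o m2' == idm z -> phi \o m1' == k -> uy \o g == k \o (ux \o i) ->
  uy \o th == phi \o u.
Proof.
  intros Hi H T2 T1 U1 U2 F2 F1 E. apply (is_pushout_ext H); rewrite !compA.
  - apply (is_iso_epic Hi). rewrite !compA, T1, (precomp2 U1), (precomp F1). exact E.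
  - now rewrite T2, U2, (precomp F2), comp1f, compf1.
Qed.

Lemma fine_hlun_nat (a b a' b' : C0 D) (M : H a b) (M' : H a' b') (s : Sq M M')
  (e : tgt (sqU (src s)) == src s) : hlun_c M' \s hsq e =s= s \s hlun_c M.
Proof.
  pose proof (hmid_pushout ch (s := spn (sqU (src s))) (t := spn s) e) as HQ.
  pose proof (foot_r_U (src s)) as Hi.
  destruct (pushout_of_iso Hi HQ) as [th [T2 T1]].
  destruct (hlun_iso_spec ch M) as [F2 F1], (hlun_iso_spec ch M') as [F2' F1'].
  refine (sq_natural (s := hsq e) (s' := s) (th := fwd th) (graph_cell Hh _) (graph_cell Hh _) (is_iso_iso th) _ _ _ _).
  - refine (pushout_unit_nat Hi HQ T2 T1 (up_hmid1 ch e) (up_hmid2 ch e) F2 F1 _).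
    unfold lin. rewrite up_foot_l, (up_foot_r (spansc_U L (src s))). cbn. now rewrite compf1.
  - refine (pushout_unit_nat Hi HQ T2 T1 (dn_hmid1 ch e) (dn_hmid2 ch e) F2' F1' _).
    unfold lin. rewrite dn_foot_l, (dn_foot_r (spansc_U L (src s))). cbn. now rewrite comp1f.
  - vcell. cbn. now rewrite comp1f, compf1.
  - vcell. cbn. now rewrite comp1f, compf1.
Qed.

Lemma fine_hrun_nat (a b a' b' : C0 D) (M : H a b) (M' : H a' b') (s : Sq M M')
  (e : tgt s == src (sqU (tgt s))) : hrun_c M' \s hsq e =s= s \s hrun_c M.
Proof.
  pose proof (is_pushout_sym (hmid_pushout ch (s := spn s) (t := spn (sqU (tgt s))) e)) as HQ.
  pose proof (foot_l_U (tgt s)) as Hi.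
  destruct (pushout_of_iso Hi HQ) as [th [T2 T1]].
  destruct (hrun_iso_spec ch M) as [F2 F1], (hrun_iso_spec ch M') as [F2' F1'].
  refine (sq_natural (s := hsq e) (s' := s) (th := fwd th) (graph_cell Hh _) (graph_cell Hh _) (is_iso_iso th) _ _ _ _).
  - refine (pushout_unit_nat Hi HQ T2 T1 (up_hmid2 ch e) (up_hmid1 ch e) F2 F1 _).
    unfold rin. rewrite up_foot_r, (up_foot_l (spansc_U L (tgt s))). cbn. now rewrite compf1.
  - refine (pushout_unit_nat Hi HQ T2 T1 (dn_hmid2 ch e) (dn_hmid1 ch e) F2' F1' _).
    unfold rin. rewrite dn_foot_r, (dn_foot_l (spansc_U L (tgt s))). cbn. now rewrite comp1f.
  - vcell. cbn. now rewrite comp1f, compf1.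
  - vcell. cbn. now rewrite comp1f, compf1.
Qed.

Definition fine_double_category : DoubleCategory D.
Proof.
  refine (@Build_DoubleCategory D (fine_C0_category ch) (fine_C1_category Hh)
    _ _ _ _ _ _ _ _ _ _ _ _ _ (@fine_hsq_proper A X L ch Hh) fine_hsq_id (fine_hsq_comp HX)
    (fun a b c d M N P => cell_of_iso Hh (hassoc_map ch M N P))
    (fun a b M => cell_of_iso Hh (hlun_map ch M))
    (fun a b M => cell_of_iso Hh (hrun_map ch M))
    _ _ _ fine_hassoc_nat fine_hlun_nat fine_hrun_nat fine_hpentagon fine_htriangle).
  - intros. apply C0_eq. now apply sq_eq.
  - intros. apply C0_eq. now apply sq_eq.
  - intros. apply C0_eq. reflexivity.
  - intros. apply C0_eq. reflexivity.
  - intros. apply C0_eq. reflexivity.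
  - intros. apply C0_eq. reflexivity.
  - intros a b f g E. apply C0_eq in E.
    apply (sq_graph_eq (graph_U f) (graph_U g)); vnorm; trivial. now apply fmap_proper.
  - intros a. apply (sq_graph_eq (graph_U _) (graph_id _)); vnorm.
    + apply (vmap_id ch).
    + apply (vmap_id ch).
    + etransitivity; [apply fmap_proper; apply (vmap_id ch)|]. apply fmap_id.
  - intros a b c g f. apply (sq_graph_eq (graph_U _) (graph_comp (graph_U g) (graph_U f))); vnorm.
    + apply (vmap_comp (ch := ch)).
    + apply (vmap_comp (ch := ch)).
    + transitivity (fmap L (vmap g \o vmap f)); [|apply fmap_comp].
      apply fmap_proper, (vmap_comp (ch := ch)).
  - intros. apply C0_eq. reflexivity.
  - intros. apply C0_eq. reflexivity.
  - intros. apply C0_eq. reflexivity.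
  - intros. apply C0_eq. reflexivity.
  - intros. split; apply C0_eq; vcell; symmetry; apply (vmap_id ch).
  - intros. split; apply C0_eq; vcell; symmetry; apply (vmap_id ch).
  - intros. split; apply C0_eq; vcell; symmetry; apply (vmap_id ch).
Defined.
End DoubleCategoryOfFineRewrites.

(** * Compatibility of the tensor product with horizontal composition *)

(** As for [pushout_assoc_nat], [th] is the comparison of the middle rows and [chi]
    that of the upper or the lower rows. *)
Lemma pushout_coproduct_nat (C : Category) (c x x' y y' p p' w v v' z z' q q' w0 : C)
  (p1 : Hom x p) (p2 : Hom y p) (p1' : Hom x' p') (p2' : Hom y' p')
  (q1 : Hom v q) (q2 : Hom z q) (q1' : Hom v' q') (q2' : Hom z' q')
  (cx : Coproduct x x') (cy : Coproduct y y') (cp : Coproduct p p')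
  (cv : Coproduct v v') (cz : Coproduct z z') (cq : Coproduct q q')
  (r : Hom c (cp_ob cx)) (l : Hom c (cp_ob cy))
  (t1 : Hom (cp_ob cx) w) (t2 : Hom (cp_ob cy) w)
  (s1 : Hom (cp_ob cv) w0) (s2 : Hom (cp_ob cz) w0)
  (th : Hom w (cp_ob cp)) (chi : Hom w0 (cp_ob cq))
  (ux : Hom x v) (ux' : Hom x' v') (uy : Hom y z) (uy' : Hom y' z')
  (up : Hom p q) (up' : Hom p' q') (uw : Hom w w0) :
  is_pushout r l t1 t2 ->
  th \o t1 == cp_map cx cp p1 p1' /\ th \o t2 == cp_map cy cp p2 p2' ->
  chi \o s1 == cp_map cv cq q1 q1' /\ chi \o s2 == cp_map cz cq q2 q2' ->
  up \o p1 == q1 \o ux -> up \o p2 == q2 \o uy ->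
  up' \o p1' == q1' \o ux' -> up' \o p2' == q2' \o uy' ->
  uw \o t1 == s1 \o cp_map cx cv ux ux' -> uw \o t2 == s2 \o cp_map cy cz uy uy' ->
  cp_map cp cq up up' \o th == chi \o uw.
Proof.
  intros H [T1 T2] [S1 S2] U1 U2 U1' U2' W1 W2. apply (is_pushout_ext H); rewrite !compA.
  - rewrite T1, W1, (precomp S1), !cp_map_comp. now apply cp_map_proper.
  - rewrite T2, W2, (precomp S2), !cp_map_comp. now apply cp_map_proper.
Qed.

Section TensorFunctor.
Context (A X : Category) (L : Functor A X) (R : Functor X A) (adj : Adjunction L R)
  (ch : Choices A X) (Hh : hcomp_preserves_fine L ch) (Ht : tens_preserves_fine adj ch).

Local Notation D := (FineRewrite Hh).
Local Notation T := (FineTensor Hh Ht).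
Local Notation mid s := (sc_ob (s_mid (spn s))).
Context (HX : is_topos X).

Local Notation "M [x] N" := (htens T M N) (at level 37, left associativity).
Local Notation "s <x> t" := (sqtens T s t) (at level 37, left associativity).
Local Notation I := (tunit T).
Local Notation hassoc_c M N P := (cell (cell_of_iso Hh (hassoc_map ch M N P))).
Local Notation hlun_c M := (cell (cell_of_iso Hh (hlun_map ch M))).
Local Notation hrun_c M := (cell (cell_of_iso Hh (hrun_map ch M))).
Local Notation as_c M N P := (cell (cell_of_iso Hh (tassoc adj ch M N P))).
Local Notation lu_c M := (cell (cell_of_iso Hh (tlun adj ch M))).
Local Notation ru_c M := (cell (cell_of_iso Hh (trun adj ch M))).
Local Notation br_c M N := (cell (cell_of_iso Hh (tbraid adj ch M N))).
Local Notation chi_c M M' N N' := (cell (cell_of_iso Hh (chi_map adj ch M M' N N'))).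
Local Notation mu_c a b := (cell (cell_of_iso Hh (mu_map adj ch a b))).

Lemma foot_r_tens (a b c d a' b' c' d' : A) (M : SCospan L a b) (N : SCospan L c d)
  (M' : SCospan L a' b') (N' : SCospan L c' d') (s : SpanSC M N) (s' : SpanSC M' N') :
  foot_r (spansc_tens adj ch s s')
  == cp_map (Lcoproduct adj ch b b') (cpX ch (sc_ob (s_mid s)) (sc_ob (s_mid s')))
       (foot_r s) (foot_r s').
Proof.
  unfold foot_r, cp_map. cbn. unfold cp_map. co_ext; co_norm; reflexivity.
Qed.

Lemma foot_l_tens (a b c d a' b' c' d' : A) (M : SCospan L a b) (N : SCospan L c d)
  (M' : SCospan L a' b') (N' : SCospan L c' d') (s : SpanSC M N) (s' : SpanSC M' N') :
  foot_l (spansc_tens adj ch s s')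
  == cp_map (Lcoproduct adj ch a a') (cpX ch (sc_ob (s_mid s)) (sc_ob (s_mid s')))
       (foot_l s) (foot_l s').
Proof.
  unfold foot_l, cp_map. cbn. unfold cp_map. co_ext; co_norm; reflexivity.
Qed.

Lemma chi_iso_maps (a b c a' b' c' : A) (M : SCospan L a b) (M' : SCospan L a' b')
  (N : SCospan L b c) (N' : SCospan L b' c') :
  chi_iso adj ch M M' N N' \o cin1 ch (sc_tens adj ch M M') (sc_tens adj ch N N')
  == tmap adj ch M M' (sc_comp ch M N) (sc_comp ch M' N') (cin1 ch M N) (cin1 ch M' N') /\
  chi_iso adj ch M M' N N' \o cin2 ch (sc_tens adj ch M M') (sc_tens adj ch N N')
  == tmap adj ch N N' (sc_comp ch M N) (sc_comp ch M' N') (cin2 ch M N) (cin2 ch M' N').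
Proof. exact (chosen_spec (chi_exists adj ch M M' N N')). Qed.

Lemma fine_chi_nat (a b c a' b' c' p q r p' q' r' : C0 D)
  (M : H a b) (M' : H a' b') (N : H b c) (N' : H b' c')
  (P : H p q) (P' : H p' q') (Q : H q r) (Q' : H q' r')
  (s : Sq M P) (s' : Sq M' P') (t : Sq N Q) (t' : Sq N' Q')
  (e1 : tgt (s <x> s') == src (t <x> t')) (e2 : tgt s == src t) (e3 : tgt s' == src t') :
  chi_c P P' Q Q' \s hsq e1 =s= (hsq e2 <x> hsq e3) \s chi_c M M' N N'.
Proof.
  pose proof (hmid_pushout ch (s := spn s) (t := spn t) e2) as H2.
  pose proof (hmid_pushout ch (s := spn s') (t := spn t') e3) as H3.
  pose proof (is_pushout_eq (foot_r_tens (spn s) (spn s')) (foot_l_tens (spn t) (spn t'))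
    (hmid_pushout ch (s := spn (s <x> s')) (t := spn (t <x> t')) e1)) as H1.
  destruct (pushout_coproduct (cc := Lcoproduct adj ch b b')
    (cx := cpX ch (mid s) (mid s')) (cy := cpX ch (mid t) (mid t'))
    (cpX ch (mid (hsq e2)) (mid (hsq e3))) H2 H3 H1) as [th Hth].
  refine (sq_natural (s := hsq e1) (s' := hsq e2 <x> hsq e3) (th := fwd th)
    (graph_cell Hh _) (graph_cell Hh _) (is_iso_iso th) _ _ _ _).
  - exact (pushout_coproduct_nat H1 Hth (chi_iso_maps M M' N N')
      (up_hmid1 ch e2) (up_hmid2 ch e2) (up_hmid1 ch e3) (up_hmid2 ch e3)
      (up_hmid1 ch e1) (up_hmid2 ch e1)).
  - exact (pushout_coproduct_nat H1 Hth (chi_iso_maps P P' Q Q')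
      (dn_hmid1 ch e2) (dn_hmid2 ch e2) (dn_hmid1 ch e3) (dn_hmid2 ch e3)
      (dn_hmid1 ch e1) (dn_hmid2 ch e1)).
  - vcell. cbn. now rewrite comp1f, compf1.
  - vcell. cbn. now rewrite comp1f, compf1.
Qed.

Ltac boundary := vcell; cbn; rewrite ?cmap_id, ?comp1f, ?compf1; reflexivity.

Ltac graph_solve :=
  open_hsq; eapply sq_graph_eq; [solve_graph|solve_graph|boundary|boundary|gen_solve].

Lemma fine_chi_assoc (a b c d a' b' c' d' : C0 D)
  (M1 : H a b) (M2 : H b c) (M3 : H c d) (N1 : H a' b') (N2 : H b' c') (N3 : H c' d')
  (e1 : tgt (chi_c M1 N1 M2 N2) == src (sqid (M3 [x] N3)))
  (e2 : tgt (sqid (M1 [x] N1)) == src (chi_c M2 N2 M3 N3)) :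
  (hassoc_c M1 M2 M3 <x> hassoc_c N1 N2 N3)
    \s chi_c (M1 (.) M2) (N1 (.) N2) M3 N3 \s hsq e1
  =s= chi_c M1 N1 (M2 (.) M3) (N2 (.) N3) \s hsq e2
    \s hassoc_c (M1 [x] N1) (M2 [x] N2) (M3 [x] N3).
Proof. graph_solve. Qed.

Lemma fine_chi_hlun (a b a' b' : C0 D) (M : H a b) (N : H a' b')
  (e : tgt (mu_c a a') == src (sqid (M [x] N))) :
  (hlun_c M <x> hlun_c N) \s chi_c (hU a) (hU a') M N \s hsq e =s= hlun_c (M [x] N).
Proof. graph_solve. Qed.

Lemma fine_chi_hrun (a b a' b' : C0 D) (M : H a b) (N : H a' b')
  (e : tgt (sqid (M [x] N)) == src (mu_c b b')) :
  (hrun_c M <x> hrun_c N) \s chi_c M N (hU b) (hU b') \s hsq e =s= hrun_c (M [x] N).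
Proof. graph_solve. Qed.

Lemma fine_assoc_chi (a b c a' b' c' a'' b'' c'' : C0 D)
  (M1 : H a b) (M2 : H b c) (N1 : H a' b') (N2 : H b' c') (P1 : H a'' b'') (P2 : H b'' c'')
  (e : tgt (as_c M1 N1 P1) == src (as_c M2 N2 P2)) :
  (sqid (M1 (.) M2) <x> chi_c N1 P1 N2 P2)
    \s chi_c M1 (N1 [x] P1) M2 (N2 [x] P2) \s hsq e
  =s= as_c (M1 (.) M2) (N1 (.) N2) (P1 (.) P2)
    \s (chi_c M1 N1 M2 N2 <x> sqid (P1 (.) P2))
    \s chi_c (M1 [x] N1) P1 (M2 [x] N2) P2.
Proof. graph_solve. Qed.

Lemma fine_lun_chi (a b c : C0 D) (M : H a b) (N : H b c)
  (e : tgt (lu_c M) == src (lu_c N)) :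
  hsq e =s= lu_c (M (.) N) \s (hlun_c (hU I) <x> sqid (M (.) N)) \s chi_c (hU I) M (hU I) N.
Proof. graph_solve. Qed.

Lemma fine_run_chi (a b c : C0 D) (M : H a b) (N : H b c)
  (e : tgt (ru_c M) == src (ru_c N)) :
  hsq e =s= ru_c (M (.) N) \s (sqid (M (.) N) <x> hrun_c (hU I)) \s chi_c M (hU I) N (hU I).
Proof. graph_solve. Qed.

Lemma fine_braid_chi (a b c a' b' c' : C0 D)
  (M1 : H a b) (M2 : H b c) (N1 : H a' b') (N2 : H b' c')
  (e : tgt (br_c M1 N1) == src (br_c M2 N2)) :
  chi_c N1 M1 N2 M2 \s hsq e =s= br_c (M1 (.) M2) (N1 (.) N2) \s chi_c M1 N1 M2 N2.
Proof. graph_solve. Qed.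
End TensorFunctor.

Section TensorUnits.
Context (A X : Category) (L : Functor A X) (R : Functor X A) (adj : Adjunction L R)
  (ch : Choices A X) (Hh : hcomp_preserves_fine L ch) (Ht : tens_preserves_fine adj ch).

Local Notation D := (FineRewrite Hh).
Local Notation T := (FineTensor Hh Ht).

Local Notation cA := (cpA ch).
Local Notation "a (x) b" := (tob T a b) (at level 37, left associativity).
Local Notation "s <x> t" := (sqtens T s t) (at level 37, left associativity).
Local Notation I := (tunit T).
Local Notation as_c M N P := (cell (cell_of_iso Hh (tassoc adj ch M N P))).
Local Notation lu_c M := (cell (cell_of_iso Hh (tlun adj ch M))).
Local Notation ru_c M := (cell (cell_of_iso Hh (trun adj ch M))).
Local Notation br_c M N := (cell (cell_of_iso Hh (tbraid adj ch M N))).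
Local Notation mu_c a b := (cell (cell_of_iso Hh (mu_map adj ch a b))).
Local Notation viso i := (fwd (vspan_iso ch i)).
Local Notation sqU_iso i := (@sqU D _ _ (viso i)).

Lemma graph_U_iso (a b : C0 D) (i : @Iso A a b) :
  is_graph (spn (@sqU D a b (viso i))) (fmap L i).
Proof.
  destruct (graph_U (viso i : @Hom (C0 D) a b)) as [E1 E2]. split; [exact E1|].
  rewrite E2. apply comp_Proper; [|reflexivity]. apply fmap_proper, vmap_of.
Qed.

Ltac mu_unfold :=
  cbn; unfold tmap, cmap, cp_map, cassoc, clun, crun, cbraid; cbn [in_ob in_map Linitial sc_ob sc_id sc_tens];
  co_ext; co_norm; try reflexivity.

Ltac boundary_U :=
  vcell; cbn; rewrite ?cmap_id, ?comp1f, ?compf1; first [apply vmap_of|reflexivity].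

Lemma fine_mu_nat (a b a' b' : C0 D) (f : Hom a b) (f' : Hom a' b') :
  mu_c b b' \s sqU (thom T f f') =s= (sqU f <x> sqU f') \s mu_c a a'.
Proof.
  refine (sq_graph_eq (graph_comp (graph_cell Hh _) (graph_U _))
    (graph_comp (graph_tens_map Ht (graph_U f) (graph_U f')) (graph_cell Hh _)) _ _ _).
  - vcell. etransitivity; [apply comp_Proper; [reflexivity|apply (vmap_tens (ch := ch))]|].
    cbn. now rewrite comp1f, compf1.
  - vcell. etransitivity; [apply comp_Proper; [reflexivity|apply (vmap_tens (ch := ch))]|].
    cbn. now rewrite comp1f, compf1.
  - etransitivity; [apply comp_Proper; [reflexivity|]|].
    + apply fmap_proper, (vmap_tens (ch := ch)).
    + mu_unfold.
Qed.

Lemma fine_assoc_mu (a b c : C0 D) :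
  (sqid (hU a) <x> mu_c b c) \s mu_c a (b (x) c) \s sqU_iso (cassoc_iso cA a b c)
  =s= as_c (hU a) (hU b) (hU c) \s (mu_c a b <x> sqid (hU c)) \s mu_c (a (x) b) c.
Proof.
  refine (sq_graph_eq
    (graph_comp (graph_comp (graph_tens_map Ht (graph_id _) (graph_cell Hh _)) (graph_cell Hh _))
      (graph_U_iso (cassoc_iso cA a b c)))
    (graph_comp (graph_comp (graph_cell Hh _) (graph_tens_map Ht (graph_cell Hh _) (graph_id _)))
      (graph_cell Hh _)) _ _ _).
  - boundary_U.
  - boundary_U.
  - mu_unfold.
Qed.

Lemma fine_lun_mu (a : C0 D) :
  sqU_iso (clun_iso cA (inA ch) a) =s= lu_c (hU a) \s mu_c I a.
Proof.
  refine (sq_graph_eq (graph_U_iso (clun_iso cA (inA ch) a))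
    (graph_comp (graph_cell Hh _) (graph_cell Hh _)) _ _ _).
  - boundary_U.
  - boundary_U.
  - mu_unfold.
Qed.

Lemma fine_run_mu (a : C0 D) :
  sqU_iso (crun_iso cA (inA ch) a) =s= ru_c (hU a) \s mu_c a I.
Proof.
  refine (sq_graph_eq (graph_U_iso (crun_iso cA (inA ch) a))
    (graph_comp (graph_cell Hh _) (graph_cell Hh _)) _ _ _).
  - boundary_U.
  - boundary_U.
  - mu_unfold.
Qed.

Lemma fine_braid_mu (a b : C0 D) :
  mu_c b a \s sqU_iso (cbraid_iso cA a b) =s= br_c (hU a) (hU b) \s mu_c a b.
Proof.
  refine (sq_graph_eq (graph_comp (graph_cell Hh _) (graph_U_iso (cbraid_iso cA a b)))
    (graph_comp (graph_cell Hh _) (graph_cell Hh _)) _ _ _).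
  - boundary_U.
  - boundary_U.
  - mu_unfold.
Qed.
End TensorUnits.

(** * The symmetric monoidal double category *)

Section Assembly.
Context (A X : Category) (L : Functor A X) (R : Functor X A) (adj : Adjunction L R)
  (ch : Choices A X) (Hh : hcomp_preserves_fine L ch) (Ht : tens_preserves_fine adj ch).

Local Notation D := (FineRewrite Hh).
Local Notation T := (FineTensor Hh Ht).
Context (HX : is_topos X).

Definition fine_interchange : Interchange T :=
  @Build_Interchange D T
    (fun a b c a' b' c' M M' N N' => cell_of_iso Hh (chi_map adj ch M M' N N'))
    (fun a b => cell_of_iso Hh (mu_map adj ch a b)).

Lemma fine_ST_strict : ST_strict (T := T) (fine_symmon0 ch) (fine_symmon1 Hh Ht HX).
Proof. split; intros; apply C0_eq; reflexivity. Qed.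

Lemma fine_interchange_natural : interchange_natural fine_interchange.
Proof.
  split.
  - intros. split; apply C0_eq; reflexivity.
  - intros. split; apply C0_eq; reflexivity.
  - apply fine_chi_nat.
  - apply fine_mu_nat.
Qed.

Lemma fine_tensor_double_functor :
  tensor_double_functor (fine_double_category Hh HX) fine_interchange.
Proof.
  split.
  - apply fine_chi_assoc.
  - apply fine_chi_hlun.
  - apply fine_chi_hrun.
Qed.

Lemma fine_constraints_transformations :
  constraints_transformations (T := T) (fine_double_category Hh HX) (fine_symmon0 ch)
    (fine_symmon1 Hh Ht HX) fine_interchange.
Proof.
  split.
  - apply fine_assoc_chi.
  - apply fine_assoc_mu.
  - apply fine_lun_chi.
  - apply fine_lun_mu.
  - apply fine_run_chi.
  - apply fine_run_mu.
  - apply fine_braid_chi.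
  - apply fine_braid_mu.
Qed.

Definition fine_symmon_double_category : SymMonDoubleCategory T := {|
  strictST := fine_ST_strict;
  interchange_nat := fine_interchange_natural;
  tensor_functor := fine_tensor_double_functor;
  constraint_transf := fine_constraints_transformations
|}.

Lemma fine_canonical : canonical_constraints fine_symmon_double_category.
Proof.
  split; intros.
  - apply v_is_of.
  - apply v_is_of.
  - apply v_is_of.
  - apply v_is_of.
  - apply sq_is_cell.
  - apply sq_is_cell.
  - apply sq_is_cell.
  - apply sq_is_cell.
  - exists (hassoc_iso ch M N P). destruct (hassoc_iso_spec ch M N P) as (E1 & E2 & E3).
    rewrite !compA. split; [exact E1|split; [exact E2|split; [exact E3|apply sq_is_cell]]].
  - exists (hlun_iso ch M). destruct (hlun_iso_spec ch M) as (E1 & E2).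
    split; [exact E2|split; [exact E1|apply sq_is_cell]].
  - exists (hrun_iso ch M). destruct (hrun_iso_spec ch M) as (E1 & E2).
    split; [exact E1|split; [exact E2|apply sq_is_cell]].
  - exists (chi_iso adj ch M M' N N').
    destruct (chi_iso_spec adj ch M M' N N') as [[E1 E2] [E3 E4]].
    rewrite !compA. split; [exact E1|split; [exact E2|split; [exact E3|split; [exact E4|]]]].
    apply sq_is_cell.
  - apply sq_is_cell.
Qed.
End Assembly.

Theorem lemma31 (A X : Category) (L : Functor A X) (R : Functor X A)
    (adj : Adjunction L R) (HA : is_topos A) (HX : is_topos X)
    (HL : preserves_pullbacks L) :
  inhabited (Choices A X) /\
  forall ch : Choices A X,
    exists (Hh : hcomp_preserves_fine L ch) (Ht : tens_preserves_fine adj ch)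
           (S : SymMonDoubleCategory (FineTensor Hh Ht)),
      canonical_constraints S.
Proof.
  split; [now apply topos_choices|]. intros ch.
  exists (hcomp_fine ch HX), (tens_fine ch HX adj),
    (fine_symmon_double_category (hcomp_fine ch HX) (tens_fine ch HX adj) HX).
  apply fine_canonical.
Qed.
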